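(* Let $\{\lambda_n\}_{n=1}^\infty$ be any real sequence of the form $\lambda_n = n+\alpha_n$, where $\alpha_n \neq 0$ for every $n$ and $\alpha_n \to 0$ as $n \to \infty$. Then there is a nonnegative function $g \in \bigcap_{p>1} L^p(\mathbb{R})$ such that the system of translates $\{g(x - \lambda_n)\}_{n=1}^{\infty}$ is complete in the space $L^p(\mathbb{R})$ for every $p>1$.
   Context: Here $p$ ranges over real numbers $1<p<\infty$, and $L^p(\mathbb{R})$ is the (complex) Lebesgue space. A system of vectors in a topological vector space is called complete if its finite linear combinations are dense in the space. *)

(* Defs.v *)
From HB Require Import structures.
From mathcomp Require Import all_boot all_order all_algebra.
From mathcomp Require Import all_classical all_reals all_analysis.
From mathcomp Require Export complex.

Set Implicit Arguments.
Unset Strict Implicit.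
Unset Printing Implicit Defensive.

Import Order.TTheory GRing.Theory Num.Theory.
Import numFieldNormedType.Exports.

Local Open Scope classical_set_scope.
Local Open Scope ring_scope.

(* [hoelder.v] only treats real-valued functions.  The library norm [`|z|] of
   [z : R[i]] is an element of [R[i]] with zero imaginary part; its real part
   is the modulus as an element of [R]. *)
Definition Lp_norm (R : realType) (p : R) (f : R -> R[i]) : \bar R :=
  Lnorm (@lebesgue_measure R) p%:E (fun x => (complex.Re `|f x|)%:E).

(* Functions are not quotiented by equality almost everywhere: [Lp_norm] is a
   seminorm here, and it does not distinguish a.e. equal functions. *)
Definition in_Lp (R : realType) (p : R) (f : R -> R[i]) : Prop :=
  [/\ measurable_fun [set: R] (fun x => complex.Re (f x)),
      measurable_fun [set: R] (fun x => complex.Im (f x))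
    & (Lp_norm p f < +oo)%E].

Definition lin_comb (R : realType) (u : nat -> R -> R[i]) (N : nat)
    (c : nat -> R[i]) : R -> R[i] :=
  fun x => \sum_(n < N) c n * u n x.

Definition complete_in_Lp (R : realType) (p : R) (u : nat -> R -> R[i]) :
    Prop :=
  (forall n, in_Lp p (u n)) /\
  (forall f, in_Lp p f -> forall e : R, 0 < e ->
     exists (N : nat) (c : nat -> R[i]),
       (Lp_norm p (fun x => f x - lin_comb u N c x)%R < e%:E)%E).

(* Main.v *)
Require Import Defs.
From HB Require Import structures.
From mathcomp Require Import all_boot all_order all_algebra.
From mathcomp Require Import all_classical all_reals all_analysis.
From mathcomp Require Import measurable_realfun.
From mathcomp Require Import ring lra zify.
Import Order.TTheory GRing.Theory Num.Theory.
Import numFieldNormedType.Exports.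
Local Open Scope ring_scope.

(* Fix p. The set S of limits of combinations of the translates of g contains
   every function once it contains all x^j exp(-x^2).  Take g = A(exp(-x^2)),
   where A is a limit of convolutions (recentred by integer shifts)
   with polynomials q_k in the unit shift having nonnegative coefficients, and
     q_(k+1) = (X^n + v)(X^N) q_k,
   v having coefficients small enough for the limit to exist in every L^p.
   The polynomials are chosen so that
   - for some W with W(0) = 1, W (X^n + v) is small: hence A h (x - t) is almost
     a combination of the A h (x - t - mN), m > 0, with coefficients bounded
     before N is chosen;
   - c q_k is close to a power of X for some polynomial c: hence h is almost a
     combination of integer translates of A h.
   With a_n = alpha_n, exp(a_n^2) g(x - lambda_n) is the translate by n + 1 of
   A(exp(2 a_n x - x^2)). Expanding to order j and subtracting the terms of order
   l < j, which are in S by induction, the translate by n + 1 of A(x^j exp(-x^2))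
   is within O(|a_n|) of S; this is where a_n != 0 is used. Since a_n -> 0, the
   first property of q_k makes this error arbitrarily small, for all integer
   translates, and the second one gives x^j exp(-x^2) in S.

   A nearly invariant X^n + v comes from writing X^n as
     4^-n ((1 + X)^2 - (1 - X)^2)^n
   and keeping the terms divisible by a high power of 1 + X: its tail is small
   in the coefficientwise sense, can be majorized by positive kernels, and
   a Cesaro mean nearly inverts 1 + X. "Small" always means that the largest
   coefficient times a high power of the sum of the moduli is small, which is
   what L^p estimates with p > 1 require, p = 1 being excluded. *)

Set Implicit Arguments.
Unset Strict Implicit.

(** * Polynomials that are nearly invariant under a convolution *)

(** The rate at which [alpha] tends to 0 is unknown, so [W] must be fixed before [N]: only then can
    [N] be so large that [alpha] is small against the norm of [W] from about [N] on. Substituting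
    X^N for X must therefore be harmless, and neither the largest coefficient nor the sum of the
    moduli is increased by it. Nonnegative coefficients make g nonnegative and make the recentred
    convolutions of a nonnegative function increase with k. So A is a positive operator, and |h| <=
    C / (1 + x^2) gives |A h| <= C A(1 / (1 + x^2)): the estimates on A reduce to one function. W
    (X^n + v) is small because a factor (1 + X)^(2K) is replaced by (1 + rX)^(2K) with r slightly
    below 1. Since X f has the norm of f, (1 + X) f and (1 - X) f are orthogonal, and the square
    norm of (1 + rX) f mixes theirs with weights ((1 + r)/2)^2 < 1 and ((1 - r)/2)^2. With r = 1 -
    1/m and n = m K, the gain from 2K uses of the first weight outweighs the loss from the
    second. *)

Section CoefficientNorms.
Variable K : numDomainType.
Implicit Types f g : {poly K}.

Definition norm1 f : K := \sum_(i < size f) `|f`_i|.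

Definition coef_bounded f (c : K) := forall i, `|f`_i| <= c.

Lemma norm1_wide f n : (size f <= n)%N -> norm1 f = \sum_(i < n) `|f`_i|.
Proof.
move=> sfn; rewrite /norm1 (big_ord_widen n (fun i => `|f`_i|)) //.
rewrite [RHS](bigID (fun i : 'I_n => (i < size f)%N)) /= [X in _ + X]big1 ?addr0 //.
by move=> i; rewrite -leqNgt => ?; rewrite nth_default ?normr0.
Qed.

Lemma norm1_ge0 f : 0 <= norm1 f.
Proof. exact: sumr_ge0. Qed.

Lemma norm1D f g : norm1 (f + g) <= norm1 f + norm1 g.
Proof.
set n := maxn (size f) (size g).
rewrite (@norm1_wide f n) ?leq_maxl // (@norm1_wide g n) ?leq_maxr //.
rewrite (@norm1_wide (f + g) n) ?size_polyD // -big_split /=.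
by apply: ler_sum => i _; rewrite coefD ler_normD.
Qed.

Lemma norm1N f : norm1 (- f) = norm1 f.
Proof. by rewrite /norm1 size_polyN; apply: eq_bigr => i _; rewrite coefN normrN. Qed.

Lemma norm1Z c f : norm1 (c *: f) = `|c| * norm1 f.
Proof.
rewrite (@norm1_wide _ (size f)) ?size_scale_leq // mulr_sumr.
by apply: eq_bigr => i _; rewrite coefZ normrM.
Qed.

Lemma norm1_0 : norm1 0 = 0.
Proof. by rewrite /norm1 size_poly0 big_ord0. Qed.

Lemma norm1_sum I (r : seq I) (P : pred I) (F : I -> {poly K}) :
  norm1 (\sum_(i <- r | P i) F i) <= \sum_(i <- r | P i) norm1 (F i).
Proof.
elim/big_rec2: _ => [|i y x _ H]; first by rewrite norm1_0.
by apply: le_trans (norm1D _ _) _; rewrite lerD2l.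
Qed.

Lemma norm1MX f : norm1 ('X * f) = norm1 f.
Proof.
rewrite (@norm1_wide _ (size f).+1); last first.
  by apply: leq_trans (size_polyMleq _ _) _; rewrite size_polyX.
rewrite big_ord_recl coefXM eqxx normr0 add0r.
by apply: eq_bigr => i _; rewrite coefXM.
Qed.

Lemma norm1MXn n f : norm1 ('X^n * f) = norm1 f.
Proof. by elim: n => [|n IH]; rewrite ?expr0 ?mul1r // exprS -mulrA norm1MX. Qed.

Lemma norm1C c : norm1 c%:P = `|c|.
Proof.
rewrite (@norm1_wide _ 1) ?size_polyC ?leq_b1 // big_ord1 coefC eqxx //.
Qed.

Lemma norm1_1 : norm1 1 = 1.
Proof. by rewrite norm1C normr1. Qed.

Lemma norm1Xn n : norm1 'X^n = 1.
Proof. by rewrite -['X^n]mulr1 norm1MXn norm1_1. Qed.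

Lemma norm1M f g : norm1 (f * g) <= norm1 f * norm1 g.
Proof.
rewrite -[X in X * g]coefK poly_def mulr_suml.
apply: le_trans (norm1_sum _ _ _) _; rewrite mulr_suml.
by apply: ler_sum => i _; rewrite -scalerAl norm1Z norm1MXn.
Qed.

Lemma norm1X f n : norm1 (f ^+ n) <= norm1 f ^+ n.
Proof.
elim: n => [|n IH]; first by rewrite !expr0 norm1_1.
rewrite !exprS; apply: le_trans (norm1M _ _) _.
by rewrite ler_wpM2l ?norm1_ge0.
Qed.

Lemma coef_le_norm1 f : coef_bounded f (norm1 f).
Proof.
move=> i; have [lti|] := ltnP i (size f); last first.
  by move=> ?; rewrite nth_default ?normr0 ?norm1_ge0.
by rewrite /norm1 (bigD1 (Ordinal lti)) //= lerDl sumr_ge0.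
Qed.

Lemma coef_boundedM f g c : coef_bounded f c -> coef_bounded (g * f) (norm1 g * c).
Proof.
move=> fc i; have c0 : 0 <= c by apply: le_trans (fc 0%N).
rewrite -[X in X * f]coefK poly_def mulr_suml coef_sum /norm1 mulr_suml.
apply: le_trans (ler_norm_sum _ _ _) _; apply: ler_sum => j _.
rewrite -scalerAl coefZ normrM coefXnM.
by case: ifP => _; rewrite ?normr0 ?mulr0 ?mulr_ge0 // ler_wpM2l.
Qed.

End CoefficientNorms.

(** * Square norm of the coefficients *)

Section SquareNorm.
Variable R : realFieldType.
Implicit Types f g : {poly R}.

Lemma cauchy_schwarz_sum n (a b : nat -> R) :
  (\sum_(i < n) a i * b i) ^+ 2 <= (\sum_(i < n) a i ^+ 2) * \sum_(i < n) b i ^+ 2.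
Proof.
elim: n => [|n IH]; first by rewrite !big_ord0 expr0n mulr0.
rewrite !big_ord_recr /=.
set S := \sum_(i < n) _ in IH *; set A := \sum_(i < n) _ in IH *.
set B := \sum_(i < n) _ in IH *.
have A0 : 0 <= A by apply: sumr_ge0 => i _; rewrite sqr_ge0.
have B0 : 0 <= B by apply: sumr_ge0 => i _; rewrite sqr_ge0.
set x := a n; set y := b n.
(* Since S^2 <= A B, the square of the left side is at most 4 (A y^2) (x^2 B), hence at most the
   square of the right side. *)
have H : 2 * (S * (x * y)) <= A * y ^+ 2 + x ^+ 2 * B.
  have C0 : 0 <= A * y ^+ 2 + x ^+ 2 * B by rewrite addr_ge0 // mulr_ge0 ?sqr_ge0.
  apply: le_trans (ler_norm _) _.
  rewrite -(@ler_pXn2r _ 2) ?nnegrE // real_normK ?num_real //.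
  have : S ^+ 2 * (x * y) ^+ 2 <= A * B * (x * y) ^+ 2 by rewrite ler_wpM2r ?sqr_ge0.
  have : 0 <= (A * y ^+ 2 - x ^+ 2 * B) ^+ 2 by rewrite sqr_ge0.
  lra.
rewrite mulrDl !mulrDr; nra.
Qed.

Definition norm2sq f : R := \sum_(i < size f) f`_i ^+ 2.

Lemma norm2sq_wide f n : (size f <= n)%N -> norm2sq f = \sum_(i < n) f`_i ^+ 2.
Proof.
move=> sfn; rewrite /norm2sq (big_ord_widen n (fun i => f`_i ^+ 2)) //.
rewrite [RHS](bigID (fun i : 'I_n => (i < size f)%N)) /= [X in _ + X]big1 ?addr0 //.
by move=> i; rewrite -leqNgt => ?; rewrite nth_default ?expr0n.
Qed.

Lemma norm2sq_ge0 f : 0 <= norm2sq f.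
Proof. by apply: sumr_ge0 => i _; rewrite sqr_ge0. Qed.

Lemma norm2sqZ c f : norm2sq (c *: f) = c ^+ 2 * norm2sq f.
Proof.
rewrite (@norm2sq_wide _ (size f)) ?size_scale_leq // mulr_sumr.
by apply: eq_bigr => i _; rewrite coefZ exprMn.
Qed.

Lemma norm2sqMX f : norm2sq ('X * f) = norm2sq f.
Proof.
rewrite (@norm2sq_wide _ (size f).+1); last first.
  by apply: leq_trans (size_polyMleq _ _) _; rewrite size_polyX.
rewrite big_ord_recl coefXM eqxx expr0n add0r.
by apply: eq_bigr => i _; rewrite coefXM.
Qed.

(* Multiplication by ['X] is an isometry, so both identities below are instances
   of the expansion of the square of a norm. *)
Lemma norm2sq_comb a b f : norm2sq ((a%:P + b *: 'X) * f) =
  (a ^+ 2 + b ^+ 2) * norm2sq f + (2 * (a * b)) * \sum_(i < size f) f`_i * ('X * f)`_i.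
Proof.
set n := (size f).+1.
have sX : (size ('X * f)%R <= n)%N.
  by apply: leq_trans (size_polyMleq _ _) _; rewrite size_polyX.
have sf : (size f <= n)%N by rewrite leqnSn.
have -> : (a%:P + b *: 'X) * f = a *: f + b *: ('X * f).
  by rewrite mulrDl mul_polyC scalerAl.
rewrite (@norm2sq_wide _ n); last first.
  apply: leq_trans (size_polyD _ _) _; rewrite geq_max.
  by apply/andP; split; apply: leq_trans (size_scale_leq _ _) _.
have -> : \sum_(i < size f) f`_i * ('X * f)`_i = \sum_(i < n) f`_i * ('X * f)`_i.
  by rewrite /n big_ord_recr /= (@nth_default _ _ _ (size f)) ?mul0r ?addr0.
rewrite mulrDl -{2}(norm2sqMX f) (norm2sq_wide sf) (norm2sq_wide sX).
rewrite !mulr_sumr -!big_split /=; apply: eq_bigr => i _.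
by rewrite coefD !coefZ; ring.
Qed.

Lemma norm2sq_parallelogram f :
  norm2sq ((1 - 'X) * f) + norm2sq ((1 + 'X) * f) = 4 * norm2sq f.
Proof.
have := norm2sq_comb 1 1 f; have := norm2sq_comb 1 (-1) f.
rewrite scale1r scaleN1r => -> ->; ring.
Qed.

Lemma norm2sq_mix r f : norm2sq ((1 + r *: 'X) * f) =
  ((1 + r) / 2) ^+ 2 * norm2sq ((1 + 'X) * f) +
  ((1 - r) / 2) ^+ 2 * norm2sq ((1 - 'X) * f).
Proof.
have := norm2sq_comb 1 1 f; have := norm2sq_comb 1 (-1) f; have := norm2sq_comb 1 r f.
rewrite scale1r scaleN1r => -> -> ->; by field.
Qed.

Lemma coefM_sq_le f g j : (f * g)`_j ^+ 2 <= norm2sq f * norm2sq g.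
Proof.
rewrite coefM; apply: le_trans (cauchy_schwarz_sum _ (fun i => f`_i) (fun i => g`_(j - i))) _.
(* Each factor given by Cauchy-Schwarz runs over distinct coefficients, so its sum of squares is
   part of the full norm. *)
have sub (h : {poly R}) n (P : 'I_n -> nat) : injective P ->
    \sum_(i < n) h`_(P i) ^+ 2 <= norm2sq h.
  move=> Pinj; set m := maxn (size h) (\max_(i < n) P i).+1.
  have Pm i : (P i < m)%N by rewrite leq_max ltnS leq_bigmax orbT.
  rewrite (@norm2sq_wide _ m) ?leq_maxl //.
  pose Q i := Ordinal (Pm i).
  have Qinj : injective Q by move=> x y [] /Pinj.
  rewrite -(big_imset (fun k : 'I_m => h`_k ^+ 2) (h := Q)) /=; last exact: in2W.
  rewrite [leRHS](bigID (mem [set Q x | x in 'I_n])) /= lerDl.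
  by apply: sumr_ge0 => k _; rewrite sqr_ge0.
apply: ler_pM; [by apply: sumr_ge0 => i _; rewrite sqr_ge0 ..| |].
  by have := sub f j.+1 (@nat_of_ord _) (@ord_inj _).
have := sub g j.+1 (fun i => (j - i)%N); apply=> x y H; apply: val_inj => /=.
by have := ltn_ord x; have := ltn_ord y; lia.
Qed.

Lemma norm1_sq_le f n : (size f <= n)%N -> norm1 f ^+ 2 <= n%:R * norm2sq f.
Proof.
move=> sf; rewrite (norm1_wide sf) (norm2sq_wide sf).
have := cauchy_schwarz_sum n (fun=> 1) (fun i => `|f`_i|).
under eq_bigr do rewrite mul1r; move/le_trans; apply.
rewrite sumr_const card_ord expr1n.
rewrite (eq_bigr (fun i : 'I_n => f`_i ^+ 2)) // => i _.
by rewrite real_normK ?num_real.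
Qed.

End SquareNorm.

(** * Central binomial coefficients and the square norm of (1 - X)^a (1 + X)^b *)

HB.lock Definition cbin (R : realFieldType) (i : nat) : R :=
  'C(2 * i, i)%:R / 4 ^+ i.

Section CentralBinomial.
Variable R : realFieldType.
Implicit Types f g : {poly R}.
Local Notation cbin := (@cbin R).

Lemma cbinE i : cbin i = 'C(2 * i, i)%:R / 4 ^+ i.
Proof. by rewrite unlock. Qed.

Lemma cbin0 : cbin 0 = 1.
Proof. by rewrite cbinE muln0 bin0 expr0 divr1. Qed.

Lemma cbinS i : cbin i.+1 = cbin i * ((2 * i + 1)%:R / (2 * i + 2)%:R).
Proof.
have H : ('C(2 * i.+1, i.+1) * i.+1 = 2 * (2 * i + 1) * 'C(2 * i, i))%N.
  have := @mul_bin_diag (2 * i).+1 i; have := @mul_bin_left (2 * i).+1 i.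
  have := @mul_bin_diag (2 * i) i; have := @mul_bin_left (2 * i) i.
  have -> : (2 * i.+1 = (2 * i).+2)%N by lia.
  have -> : ((2 * i).+1 - i = i.+1)%N by lia.
  have -> : (2 * i - i = i)%N by lia.
  rewrite /= !binS; nia.
have H' : 'C(2 * i.+1, i.+1)%:R * i.+1%:R = 2 * (2 * i + 1)%:R * 'C(2 * i, i)%:R :> R.
  by rewrite -!natrM H.
have i1 : i.+1%:R != 0 :> R by rewrite pnatr_eq0.
have -> : (2 * i + 2)%:R = 2 * i.+1%:R :> R by rewrite -natrM; congr (_%:R); lia.
apply: (mulIf i1); rewrite !cbinE mulrAC H' exprS.
by field; rewrite nat1r i1 expf_neq0 ?pnatr_eq0.
Qed.

Lemma cbin_gt0 i : 0 < cbin i.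
Proof. by rewrite cbinE divr_gt0 ?exprn_gt0 ?ltr0n // bin_gt0 leq_pmull. Qed.

Lemma cbin_dec i j : (i <= j)%N -> cbin j <= cbin i.
Proof.
elim: j => [|j IH]; first by rewrite leqn0 => /eqP->.
rewrite leq_eqVlt => /predU1P[-> //|]; rewrite ltnS => /IH; apply: le_trans.
rewrite cbinS ler_piMr ?(ltW (cbin_gt0 _)) // ler_pdivrMr ?ltr0n ?addn2 //.
by rewrite mul1r ler_nat; lia.
Qed.

(** [cbin i] is the probability that a simple random walk is back at its start after 2i steps, of
    order i^(-1/2). By [cbinS] this product decreases in i; with 4 i in place of 2 i + 1, as in the
    next lemma, it increases. *)
Lemma cbin_sq_le i : cbin i ^+ 2 * (2 * i + 1)%:R <= 1.
Proof.
elim: i => [|i IH]; first by rewrite cbin0 expr1n mul1r.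
apply: le_trans IH; rewrite cbinS (exprMn _ (cbin i)) -mulrA ler_wpM2l ?sqr_ge0 //.
rewrite expr_div_n mulrAC ler_pdivrMr ?exprn_gt0 ?ltr0n ?addn2 //.
by rewrite -!natrX -!natrM ler_nat; nia.
Qed.

Lemma cbin_sq_ge i : (0 < i)%N -> 1 <= cbin i ^+ 2 * (4 * i)%:R.
Proof.
case: i => // i _; elim: i => [|i IH].
  rewrite cbinS cbin0 mul1r expr_div_n mulrAC ler_pdivlMr ?exprn_gt0 ?ltr0n //.
  by rewrite mul1r -!natrX -!natrM ler_nat.
apply: (le_trans IH); rewrite [cbin i.+2]cbinS (exprMn _ (cbin i.+1)) -[leRHS]mulrA ler_wpM2l ?sqr_ge0 //.
rewrite expr_div_n mulrAC ler_pdivlMr ?exprn_gt0 ?ltr0n ?addn2 //.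
by rewrite -!natrX -!natrM ler_nat; nia.
Qed.

Lemma sum_cbin k : \sum_(i < k) cbin i = (2 * k)%:R * cbin k.
Proof.
elim: k => [|k IH]; first by rewrite big_ord0 muln0 mul0r.
rewrite big_ord_recr /= IH cbinS.
have -> : (2 * k.+1 = 2 * k + 2)%N by lia.
rewrite mulrCA [X in _ = _ * X]mulrCA divff ?pnatr_eq0 ?addn2 // mulr1.
by rewrite addn1 -natr1 mulrDr mulr1 mulrC.
Qed.

Lemma coef_add1X_exp N i : ((1 + 'X : {poly R}) ^+ N)`_i = 'C(N, i)%:R.
Proof.
rewrite addrC exprD1n coef_sum.
have [iN|Ni] := leqP i N; last first.
  rewrite bin_small // big1 // => j _; rewrite coefMn coefXn.
  by case: eqP => [E|]; rewrite ?mul0rn //; have := ltn_ord j; lia.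
rewrite (bigD1 (inord i)) //= inordK // big1 ?addr0; last first.
  move=> j; rewrite -val_eqE /= inordK // => ji.
  by rewrite coefMn coefXn eq_sym (negbTE ji) mul0rn.
by rewrite coefMn coefXn eqxx.
Qed.

Lemma norm2sq_binomial b : norm2sq ((1 + 'X : {poly R}) ^+ b) = 'C(2 * b, b)%:R.
Proof.
rewrite (@norm2sq_wide _ _ b.+1); last first.
  by apply/leq_sizeP => j bj; rewrite coef_add1X_exp bin_small.
rewrite mul2n -addnn -binomial.Vandermonde natr_sum; apply: eq_bigr => i _.
by rewrite coef_add1X_exp natrM bin_sub // -ltnS.
Qed.

(** By Parseval this is a Beta integral on the unit circle. The proof stays algebraic: the
    parallelogram identity trades a factor 1 - X for a factor 1 + X, which is an induction on a with
    b arbitrary. *)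
Lemma norm2sq_pow a b :
  norm2sq ((1 - 'X : {poly R}) ^+ a * (1 + 'X) ^+ b) =
  4 ^+ (a + b) * cbin a * cbin b / 'C(a + b, a)%:R.
Proof.
elim: a b => [|a IH] b.
  rewrite expr0 mul1r norm2sq_binomial cbin0 mulr1 bin0 divr1 !cbinE mulrCA divff ?mulr1 ?expf_neq0 ?pnatr_eq0 //.
have := norm2sq_parallelogram ((1 - 'X : {poly R}) ^+ a * (1 + 'X) ^+ b).
have -> : (1 + 'X : {poly R}) * ((1 - 'X) ^+ a * (1 + 'X) ^+ b) =
    (1 - 'X) ^+ a * (1 + 'X) ^+ b.+1 by rewrite exprS; ring.
rewrite mulrA -exprS !IH => /(canRL (addrK _)) ->.
have C0 : 'C(a + b, a)%:R != 0 :> R by rewrite pnatr_eq0 -lt0n bin_gt0 leq_addr.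
have C1 : 'C(a + b.+1, a)%:R = 'C(a + b, a)%:R * (a + b).+1%:R / b.+1%:R :> R.
  apply: (canRL (mulfK _)); rewrite ?pnatr_eq0 // -!natrM; congr (_%:R).
  rewrite addnS [RHS]mulnC (mul_bin_down (a + b).+1 a) mulnC subSn ?leq_addr //.
  by rewrite addKn.
have C2 : 'C(a.+1 + b, a.+1)%:R = 'C(a + b, a)%:R * (a + b).+1%:R / a.+1%:R :> R.
  apply: (canRL (mulfK _)); rewrite ?pnatr_eq0 // -!natrM; congr (_%:R).
  by rewrite addSn [RHS]mulnC mul_bin_diag mulnC.
have E1 k : (2 * k + 1)%:R = 2 * k%:R + 1 :> R by rewrite natrD natrM.
have E2 k : (2 * k + 2)%:R = 2 * k%:R + 2 :> R by rewrite natrD natrM.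
rewrite C1 C2 !cbinS !E1 !E2 !addnS !addSn !(exprS 4) -!natr1 natrD.
by field; rewrite C0 -natrD !natr1 -!E2 !pnatr_eq0 !addn2.
Qed.

End CentralBinomial.

(** * Square norm of (1 + rX)^M f *)

Section MixedPowers.
Variable R : realFieldType.
Implicit Types f g : {poly R}.

Lemma sum_pascal M (h : nat -> R) :
  \sum_(l < M.+1) 'C(M, l)%:R * (h l + h l.+1) = \sum_(l < M.+2) 'C(M.+1, l)%:R * h l.
Proof.
under eq_bigr do rewrite mulrDr.
rewrite big_split /= [RHS]big_ord_recl bin0 /=.
under [in RHS]eq_bigr do rewrite /bump leq0n add1n binS natrD mulrDl.
rewrite big_split /= addrA; congr (_ + _).
rewrite big_ord_recl bin0 [in RHS]big_ord_recr /= bin_small // mul0r addr0.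
by congr (_ + _); apply: eq_bigr => i _; rewrite /bump leq0n add1n.
Qed.

(** Each use of [norm2sq_mix] sends one factor 1 + rX to 1 + X or to 1 - X, so M uses give binomial
    weights; [sum_pascal] is the induction step. *)
Lemma norm2sq_mix_pow r M f :
  norm2sq ((1 + r *: 'X) ^+ M * f) =
  \sum_(l < M.+1) 'C(M, l)%:R *
    ((((1 + r) / 2) ^+ 2) ^+ (M - l) * (((1 - r) / 2) ^+ 2) ^+ l *
     norm2sq ((1 - 'X) ^+ l * (1 + 'X) ^+ (M - l) * f)).
Proof.
elim: M f => [|M IH] f.
  by rewrite big_ord1 bin0 subn0 !expr0 !mul1r.
rewrite -(sum_pascal M (fun l => (((1 + r) / 2) ^+ 2) ^+ (M.+1 - l) *
  (((1 - r) / 2) ^+ 2) ^+ l * norm2sq ((1 - 'X) ^+ l * (1 + 'X) ^+ (M.+1 - l) * f))).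
rewrite exprSr -mulrA IH; apply: eq_bigr => l _; congr (_ * _).
rewrite mulrCA norm2sq_mix subSn -1?ltnS // subSS !(exprS (_ ^+ 2)).
have -> : (1 + 'X) * ((1 - 'X) ^+ l * (1 + 'X) ^+ (M - l) * f) =
  (1 - 'X) ^+ l * (1 + 'X) ^+ (M - l).+1 * f by rewrite exprS; ring.
have -> : (1 - 'X) * ((1 - 'X) ^+ l * (1 + 'X) ^+ (M - l) * f) =
  (1 - 'X) ^+ l.+1 * (1 + 'X) ^+ (M - l) * f by rewrite exprS; ring.
by ring.
Qed.

(** The square is the middle term of the Vandermonde sum. *)
Lemma bin_sq_le n i : ('C(n, i) ^ 2 <= 'C(2 * n, 2 * i))%N.
Proof.
rewrite !mul2n -!addnn -binomial.Vandermonde.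
have lti : (i < (i + i).+1)%N by rewrite ltnS leq_addr.
by rewrite (bigD1 (Ordinal lti)) //= addnK -mulnn leq_addr.
Qed.

Lemma bin_trinomial N k l : (l <= k <= N)%N ->
  ('C(N, k) * 'C(k, l) = 'C(N, l) * 'C(N - l, k - l))%N.
Proof.
move=> /andP[lk kN].
have lN := leq_trans lk kN.
have := bin_fact kN; have := bin_fact lk; have := bin_fact lN.
have klN : (k - l <= N - l)%N by rewrite leq_sub2r.
have := bin_fact klN; have -> : (N - l - (k - l) = N - k)%N by lia.
move: (fact_gt0 l) (fact_gt0 (k - l)) (fact_gt0 (N - k)) => h1 h2 h3 E1 E2 E3 E4.
have h : (0 < l`! * (k - l)`! * (N - k)`!)%N by rewrite !muln_gt0 h1 h2.
apply/eqP; rewrite -(eqn_pmul2r h); apply/eqP.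
transitivity N`!.
  by rewrite -E4 -E3; ring.
by rewrite -E2 -E1; ring.
Qed.

(** Enlarge C(2K, l) to C(2i, l), revise the product C(2n, 2i) C(2i, l) by [bin_trinomial], and
    enlarge the second factor again. *)
Lemma bin_mul_le n K i l : (K <= i <= n)%N -> (l <= 2 * K)%N ->
  ('C(2 * K, l) * 'C(2 * n, 2 * i) <= 'C(2 * n, l) * 'C(2 * n, 2 * i - l))%N.
Proof.
move=> /andP[Ki iN] lK.
apply: (@leq_trans ('C(2 * n, 2 * i) * 'C(2 * i, l))).
  by rewrite mulnC leq_mul2l leq_bin2l ?orbT // leq_mul2l.
rewrite bin_trinomial; last by lia.
by rewrite leq_mul2l leq_bin2l ?orbT // leq_subr.
Qed.

(* The term of index [i] of the Bernstein-type sum [(1 + rX)^(2K) * U], where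
   [(1 + X)^(2K) * U] is the tail [i >= K] of the binomial expansion of
   [4^-n ((1 + X)^2 - (1 - X)^2)^n = X^n]. *)
Lemma norm2sq_tail_term (r : R) n K i (s := ((1 + r) / 2) ^+ 2) (t := ((1 - r) / 2) ^+ 2) :
  0 < s -> (K <= i <= n)%N ->
  ('C(n, i)%:R / 4 ^+ n) ^+ 2 *
    norm2sq ((1 + r *: 'X) ^+ (2 * K) *
             ((1 - 'X) ^+ (2 * (n - i)) * (1 + 'X) ^+ (2 * (i - K)))) <=
  s ^+ (2 * K) * (1 + t / s) ^+ (2 * n).
Proof.
move=> s0 Kin; have t0 : 0 <= t by rewrite sqr_ge0.
rewrite norm2sq_mix_pow -/s -/t mulr_sumr.
have -> : s ^+ (2 * K) * (1 + t / s) ^+ (2 * n) =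
    \sum_(l < (2 * n).+1) s ^+ (2 * K) * ((t / s) ^+ l *+ 'C(2 * n, l)).
  by rewrite addrC exprD1n mulr_sumr.
have le2 : ((2 * K).+1 <= (2 * n).+1)%N by lia.
(* The left side has indices l up to 2K only; the further terms of the binomial expansion on the
   right are nonnegative, and the comparison is termwise. *)
apply: (@le_trans _ _ (\sum_(l < (2 * K).+1) s ^+ (2 * K) * ((t / s) ^+ l *+ 'C(2 * n, l)))); last first.
  rewrite (big_ord_widen _ (fun l => s ^+ (2 * K) * ((t / s) ^+ l *+ 'C(2 * n, l))) le2).
  rewrite [leRHS](bigID (fun l : 'I_(2 * n).+1 => (l < (2 * K).+1)%N)) /= lerDl.
  apply: sumr_ge0 => l _; apply: mulr_ge0; first by rewrite exprn_ge0 // ltW.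
  by rewrite mulrn_wge0 // exprn_ge0 // divr_ge0 // ltW.
apply: ler_sum => l _; have lK : (l <= 2 * K)%N by rewrite -ltnS.
have -> : (1 - 'X) ^+ l * (1 + 'X) ^+ (2 * K - l) *
    ((1 - 'X) ^+ (2 * (n - i)) * (1 + 'X) ^+ (2 * (i - K))) =
    (1 - 'X) ^+ (2 * (n - i) + l) * (1 + 'X) ^+ (2 * i - l) :> {poly R}.
  rewrite exprD; have -> : (2 * i - l = 2 * (i - K) + (2 * K - l))%N by lia.
  by rewrite exprD; ring.
rewrite norm2sq_pow.
have -> : (2 * (n - i) + l + (2 * i - l) = 2 * n)%N by lia.
have -> : ('C(2 * n, 2 * (n - i) + l) = 'C(2 * n, 2 * i - l))%N.
  by rewrite -bin_sub; [congr 'C(_, _); lia | lia].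
have cle k : cbin R k <= 1 by rewrite -(cbin0 R) cbin_dec.
set A := 'C(n, i)%:R; set B : R := 'C(2 * n, 2 * i - l)%:R.
set C : R := 'C(2 * K, l)%:R; set D : R := 'C(2 * n, l)%:R.
have B0 : 0 < B by rewrite ltr0n bin_gt0; lia.
(* The denominator B produced by [norm2sq_pow] absorbs the squared prefactor C(n, i)^2; only the
   binomial coefficient D remains. *)
have ACBD : A ^+ 2 * C <= D * B.
  rewrite -natrX -!natrM ler_nat.
  apply: leq_trans (bin_mul_le Kin lK).
  by rewrite mulnC leq_mul2l bin_sq_le orbT.
set ca := cbin _ _; set cb := cbin _ _.
have cab : ca * cb <= 1 by rewrite mulr_ile1 ?cle // ltW // cbin_gt0.
have e4 : 4 ^+ n != 0 :> R by rewrite expf_neq0 ?pnatr_eq0.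
have -> : (A / 4 ^+ n) ^+ 2 * (C * (s ^+ (2 * K - l) * t ^+ l * (4 ^+ (2 * n) * ca * cb / B)))
   = (A ^+ 2 * C) * (ca * cb) / B * (s ^+ (2 * K - l) * t ^+ l).
  have -> : 4 ^+ (2 * n) = (4 ^+ n) ^+ 2 :> R by rewrite mulnC exprM.
  by field; rewrite e4 gt_eqF.
have -> : s ^+ (2 * K) * ((t / s) ^+ l *+ 'C(2 * n, l)) = D * (s ^+ (2 * K - l) * t ^+ l).
  have -> : s ^+ (2 * K) = s ^+ (2 * K - l) * s ^+ l by rewrite -exprD subnK.
  rewrite -mulr_natr -/D expr_div_n; field.
  by rewrite expf_neq0 // gt_eqF.
apply: ler_wpM2r; first by apply: mulr_ge0; apply: exprn_ge0 => //; apply: ltW.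
rewrite ler_pdivrMr //; apply: le_trans _ ACBD.
by rewrite ler_piMr // mulr_ge0 ?sqr_ge0 ?ler0n.
Qed.

End MixedPowers.

(** * Coefficients of the lower tail of the expansion of X^n *)

Section BinomialTail.
Variable R : realFieldType.

Definition tail_term n i : {poly R} :=
  ((-1) ^+ (n - i) * ('C(n, i)%:R / 4 ^+ n)) *:
    ((1 - 'X) ^+ (2 * (n - i)) * (1 + 'X) ^+ (2 * i)).

Definition lower_tail n K : {poly R} := \sum_(i < K) tail_term n i.

Lemma size_pow2 a b :
  (size ((1 - 'X : {poly R}) ^+ a * (1 + 'X) ^+ b)%R <= (a + b).+1)%N.
Proof.
have s1 : size (1 - 'X : {poly R}) = 2.
  by rewrite -opprB size_polyN -polyC1 size_XsubC.
have s2 : size (1 + 'X : {poly R}) = 2.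
  by rewrite addrC -polyC1 size_XaddC.
apply: leq_trans (size_polyMleq _ _) _.
have := size_poly_exp_leq (1 - 'X : {poly R}) a; rewrite s1.
have := size_poly_exp_leq (1 + 'X : {poly R}) b; rewrite s2.
by lia.
Qed.

Lemma size_tail_term n i : (i <= n)%N -> (size (tail_term n i) <= (2 * n).+1)%N.
Proof.
move=> lin; apply: leq_trans (size_scale_leq _ _) _.
by apply: leq_trans (size_pow2 _ _) _; lia.
Qed.

Lemma sum_tail_term n : \sum_(i < n.+1) tail_term n i = 'X^n.
Proof.
transitivity ((4^-1 *: (- (1 - 'X) ^+ 2 + (1 + 'X) ^+ 2)) ^+ n : {poly R}); last first.
  congr (_ ^+ _); have -> : - (1 - 'X) ^+ 2 + (1 + 'X) ^+ 2 = 4 *: 'X :> {poly R}.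
    by rewrite -mul_polyC polyC_natr; ring.
  by rewrite scalerA mulVf ?pnatr_eq0 // scale1r.
rewrite exprZn exprDn scaler_sumr; apply: eq_bigr => i _.
have sg k (p : {poly R}) : (-1) ^+ k * p = (-1) ^+ k *: p.
  by rewrite -mul_polyC rmorphXn rmorphN1.
rewrite exprNn -!exprM -mulrA sg -[_ *+ 'C(n, i)]scaler_nat !scalerA exprVn /tail_term.
by congr (_ *: _); ring.
Qed.

(** Up to a scalar, each term is a square f^2 with f of degree n, so Cauchy-Schwarz bounds its
    coefficients by the square norm of f. There C(n, i) cancels and cbin i cbin (n - i) is left;
    [sum_cbin] adds these up to the order of sqrt(K / (n - K)). *)
Lemma lower_tail_coef n K j : (K <= n)%N ->
  (lower_tail n K)`_j ^+ 2 * (n - K)%:R <= K%:R.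
Proof.
move=> Kn; set b := cbin R (n - K).
have b0 : 0 < b := cbin_gt0 _ _.
have H : `|(lower_tail n K)`_j| <= (2 * K)%:R * cbin R K * b.
  rewrite coef_sum; apply: le_trans (ler_norm_sum _ _ _) _.
  rewrite -sum_cbin mulr_suml; apply: ler_sum => i _.
  have iK : (i < K)%N := ltn_ord i.
  have iN : (i <= n)%N by apply: leq_trans Kn; apply: ltnW.
  apply: (@le_trans _ _ (cbin R i * cbin R (n - i))); last first.
    by rewrite ler_wpM2l ?cbin_dec ?leq_sub2l ?(ltW (cbin_gt0 _ _)) // ltnW.
  rewrite coefZ normrM normrM normrX normrN1 expr1n mul1r.
  set f := (1 - 'X : {poly R}) ^+ (n - i) * (1 + 'X) ^+ i.
  have -> : (1 - 'X) ^+ (2 * (n - i)) * (1 + 'X) ^+ (2 * i) = f ^+ 2.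
    by rewrite /f exprMn -!exprM ![(_ * 2)%N]mulnC.
  have := coefM_sq_le f f j; rewrite -expr2 norm2sq_pow subnK // bin_sub //.
  set N := (4 ^+ n * cbin R (n - i) * cbin R i / 'C(n, i)%:R); rewrite -!expr2 => HN.
  have N0 : 0 <= N.
apply: divr_ge0; last exact: ler0n.
    by apply: mulr_ge0; [apply: mulr_ge0; first exact: exprn_ge0|]; apply/ltW/cbin_gt0.
  have : `|(f ^+ 2)`_j| <= N.
    by rewrite -(@ler_pXn2r _ 2) ?nnegrE // real_normK ?num_real.
  have C0 : 0 < 'C(n, i)%:R / 4 ^+ n :> R.
    by rewrite divr_gt0 ?exprn_gt0 ?ltr0n // bin_gt0.
  move=> /(ler_wpM2l (ltW C0)) H; rewrite (ger0_norm (ltW C0)).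
  apply: (le_trans H); rewrite /N le_eqVlt; apply/orP; left; apply/eqP.
  have e4 : 4 ^+ n != 0 :> R by rewrite expf_neq0 ?pnatr_eq0.
  have eC : 'C(n, i)%:R != 0 :> R by rewrite pnatr_eq0 -lt0n bin_gt0.
  by field; rewrite e4 eC.
have [->|K0] := posnP K.
  by rewrite /lower_tail big_ord0 coef0 expr0n mul0r.
have := H; rewrite -(@ler_pXn2r _ 2) ?nnegrE //; last first.
  by rewrite !mulr_ge0 ?ler0n // ltW ?cbin_gt0.
rewrite real_normK ?num_real // => /(ler_wpM2r (ler0n R (n - K))) /le_trans; apply.
have h1 := cbin_sq_le R K; have h2 := cbin_sq_le R (n - K).
rewrite natrD natrM in h1; rewrite natrD natrM in h2; rewrite -/b in h2.
rewrite natrM !exprMn.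
set c := cbin R K ^+ 2 in h1 *; set x := K%:R in h1 *; set y := (n - K)%:R in h2 *.
set d := b ^+ 2 in h2 *.
have c0 : 0 <= c by exact: sqr_ge0.
have d0 : 0 <= d by exact: sqr_ge0.
have x0 : 0 <= x by exact: ler0n.
have y0 : 0 <= y by exact: ler0n.
have H1 : 2 * x * c <= 1 by lra.
have H2 : 2 * y * d <= 1 by lra.
have -> : 2 ^+ 2 * x ^+ 2 * c * d * y = x * ((2 * x * c) * (2 * y * d)) by ring.
have p1 : 0 <= 2 * x * c by rewrite mulr_ge0 // mulr_ge0.
have p2 : 0 <= 2 * y * d by rewrite mulr_ge0 // mulr_ge0.
by rewrite ler_piMr // mulr_ile1.
Qed.

(** The operator X d/dX - n kills the full sum X^n and turns each term into a difference of
    consecutive products of the displayed form, so the partial sum telescopes to a single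
    product. *)
Lemma deriv_lower_tail n K : (K <= n)%N ->
  'X * (lower_tail n K)^`() - n%:R *: lower_tail n K =
  ((-1) ^+ (n - K) * (K%:R * ('C(n, K)%:R / 4 ^+ n))) *:
    ((1 - 'X) ^+ (2 * (n - K)).+1 * (1 + 'X) ^+ (2 * K).-1).
Proof.
elim: K => [_|K IH Kn].
  by rewrite /lower_tail big_ord0 deriv0 mulr0 scaler0 subr0 mul0r mulr0 scale0r.
have E2 : (2 * K.+1).-1 = (2 * K).+1 by lia.
rewrite {}E2 /lower_tail big_ord_recr /= -/(lower_tail n K) derivD mulrDr scalerDr opprD.
rewrite addrACA IH ?(ltnW Kn) // /tail_term derivZ derivM.
have d1 : (1 - 'X : {poly R})^`() = -1 by rewrite derivB derivX -polyC1 derivC sub0r.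
have d2 : (1 + 'X : {poly R})^`() = 1 by rewrite derivD derivX -polyC1 derivC add0r.
rewrite !deriv_exp d1 d2.
have [a ->] : exists a, n = (K + a.+1)%N by exists (n - K.+1)%N; lia.
have -> : (K + a.+1 - K = a.+1)%N by lia.
have -> : (K + a.+1 - K.+1 = a)%N by lia.
have -> : (2 * a.+1).-1 = (2 * a).+1 by lia.
have -> : (2 * a.+1)%N = (2 * a).+2 by lia.
have EC : K.+1%:R * 'C(K + a.+1, K.+1)%:R = a.+1%:R * 'C(K + a.+1, K)%:R :> R.
  rewrite -!natrM; congr (_%:R); rewrite (mul_bin_left (K + a.+1) K).
  by congr (_ * _)%N; lia.
rewrite [K.+1%:R * _]mulrA EC [(-1) ^+ a.+1]exprS.
set C := 'C(_, K)%:R; set q := 4 ^+ _; set S := (-1) ^+ a.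
rewrite -!mul_polyC !polyCM !polyCN !polyC1 -[_ *+ (2 * a).+2]mulr_natr -[_ *+ (2 * K)]mulr_natr !polyC_natr.
(* In the single variable U the identity is within reach of [ring], once the symbolic powers are
   aligned; K = 0 is separate because of the predecessor of 2K. *)
set U := 1 - 'X; set W := 1 + 'X; have -> : 'X = 1 - U by rewrite /U; ring.
have -> : W = 2 - U by rewrite /U /W; ring.
rewrite !(exprS U).
have -> : (K + a.+1)%:R = K%:R + a%:R + 1 :> {poly R} by rewrite -natrD natr1 addnS.
have -> : a.+1%:R = a%:R + 1 :> {poly R} by rewrite -natr1.
have -> : (2 * a).+2%:R = 2 * (a%:R + 1) :> {poly R}.
  by rewrite natr1 -natrM; congr (_%:R); lia.
rewrite natrM.
case: (posnP K) => [->|K0]; first by rewrite muln0 !expr0 exprS; ring.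
have -> : (2 * K)%N = (2 * K).-1.+1 by lia.
by rewrite /= !(exprS (2 - U)); ring.
Qed.

(** On the coefficient of index j the operator of [deriv_lower_tail] is multiplication by j - n, so
    a bound on its single product is decay at rate 1 / |j - n|. *)
Lemma lower_tail_coef_decay n K j : (K <= n)%N ->
  ((j%:R - n%:R) * (lower_tail n K)`_j) ^+ 2 <= 1.
Proof.
move=> Kn.
have -> : (j%:R - n%:R) * (lower_tail n K)`_j =
    ('X * (lower_tail n K)^`() - n%:R *: lower_tail n K)`_j.
  rewrite coefB coefXM coefZ mulrBl; congr (_ - _).
  by case: j => [|j]; rewrite ?mul0r // coef_deriv /= mulr_natl.
rewrite deriv_lower_tail // coefZ.
have [->|K0] := posnP K; first by rewrite mul0r mulr0 mul0r expr0n ler01.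
have [k Ek] : exists k, K = k.+1 by exists K.-1; lia.
(* Two factors of degree n each, so that the two binomials coming from [norm2sq_pow] match the
   prefactor C(n, K)^2. *)
have -> : (1 - 'X) ^+ (2 * (n - K)).+1 * (1 + 'X) ^+ (2 * K).-1 =
    ((1 - 'X) ^+ (n - K) * (1 + 'X) ^+ K) *
    ((1 - 'X) ^+ (n - K).+1 * (1 + 'X) ^+ K.-1) :> {poly R}.
  rewrite mulrACA -!exprD; congr (_ ^+ _ * _ ^+ _); lia.
rewrite exprMn; apply: le_trans (_ : _ <= _ ^+ 2 * _) _.
  by apply: ler_wpM2l; [exact: sqr_ge0|exact: coefM_sq_le].
rewrite !norm2sq_pow subnK // bin_sub // Ek /= -Ek.
have nK : ((n - K).+1 + k = n)%N by lia.
rewrite nK.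
rewrite exprMn -exprM mulnC exprM sqrrN !expr1n mul1r.
set c1 := cbin R (n - K); set c2 := cbin R K; set c3 := cbin R (n - K).+1.
set c4 := cbin R k; set C := 'C(n, K)%:R; set C' := 'C(n, (n - K).+1)%:R.
have CC : K%:R * C = (n - K).+1%:R * C' :> R.
  rewrite -!natrM /C' -(bin_sub (_ : (n - K).+1 <= n)%N); last by lia.
  have -> : (n - (n - K).+1 = k)%N by lia.
  by congr (_%:R); rewrite Ek mul_bin_left; congr (_ * _)%N; lia.
have q0 : 4 ^+ n != 0 :> R by rewrite expf_neq0 ?pnatr_eq0.
have C0 : C != 0 by rewrite pnatr_eq0 -lt0n bin_gt0.
have C'0 : C' != 0 by rewrite pnatr_eq0 -lt0n bin_gt0; lia.
have -> : (K%:R * (C / 4 ^+ n)) ^+ 2 * (4 ^+ n * c1 * c2 / C * (4 ^+ n * c3 * c4 / C')) =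
    (K%:R * C) / C' * K%:R * (c1 * c2 * c3 * c4) by field; rewrite C'0 C0 q0.
have -> : (K%:R * C) / C' * K%:R * (c1 * c2 * c3 * c4) =
  ((n - K).+1%:R * (c1 * c3)) * (K%:R * (c4 * c2)) by rewrite CC; field.
have half i : 0 <= i.+1%:R * (cbin R i * cbin R i.+1) <= 1.
  have c0 := ltW (cbin_gt0 R i); apply/andP; split.
    by rewrite !mulr_ge0 ?ler0n // ltW // cbin_gt0.
  apply: le_trans (cbin_sq_le R i); rewrite expr2 [leRHS]mulrC.
  apply: (@le_trans _ _ (i.+1%:R * (cbin R i * cbin R i))).
    by rewrite ler_wpM2l // ler_wpM2l // cbin_dec.
  by rewrite ler_wpM2r ?mulr_ge0 // ler_nat; lia.
have /andP[h1 h2] := half (n - K)%N; have /andP[h3 h4] := half k.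
by rewrite -Ek in h3 h4; rewrite mulr_ile1.
Qed.

End BinomialTail.

(** * Positive kernels that majorize the tail *)

Section BinomialKernel.
Variable R : realFieldType.

(** Induction with the ratio (k - j) / (k + j + 1) of consecutive binomials. The relative loss j^2 /
    k is at most one half as long as 2 j^2 <= k, the range used in [binomial_kernel_ge]. *)
Lemma bin_central_ge k j : (j <= k)%N ->
  'C(2 * k, k)%:R * (k%:R - j%:R ^+ 2) <= 'C(2 * k, k + j)%:R * k%:R :> R.
Proof.
elim: j => [_|j IH jk]; first by rewrite expr0n subr0 addn0.
have E : (k + j.+1)%:R * 'C(2 * k, k + j.+1)%:R = (k%:R - j%:R) * 'C(2 * k, k + j)%:R :> R.
  rewrite -natrB ?(ltnW jk) // -!natrM addnS mul_bin_left.
  by congr (_ * _)%:R; lia.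
have /IH H := ltnW jk.
have p0 : 0 < (k + j.+1)%:R :> R by rewrite ltr0n; lia.
rewrite -(ler_pM2l p0) !mulrA E.
have kj : 0 <= k%:R - j%:R :> R by rewrite subr_ge0 ler_nat ltnW.
apply: (@le_trans _ _ ((k%:R - j%:R) * ('C(2 * k, k)%:R * (k%:R - j%:R ^+ 2)))); last first.
  by rewrite -mulrA ler_wpM2l.
set C := 'C(2 * k, k)%:R; have C0 : 0 <= C :> R by exact: ler0n.
have -> : (k + j.+1)%:R = k%:R + j%:R + 1 :> R by rewrite -!natrD natr1 addnS.
rewrite -natr1; set x := k%:R; set y := j%:R.
have y0 : 0 <= y :> R by exact: ler0n.
have -> : (x + y + 1) * C * (x - (y + 1) ^+ 2) = C * ((x + y + 1) * (x - (y + 1) ^+ 2)) by ring.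
rewrite [leRHS]mulrCA ler_wpM2l //.
have : 0 <= y ^+ 3 by rewrite exprn_ge0.
have : 0 <= (y + 1) ^+ 3 by rewrite exprn_ge0 // addr_ge0.
lra.
Qed.

(* The [2k]-fold convolution of the uniform distribution on two consecutive
   integers, centred at [c]. *)
Definition binomial_kernel c k : {poly R} := (4 ^- k) *: ('X^(c - k) * (1 + 'X) ^+ (2 * k)).

Lemma binomial_kernel_ge0 c k i : 0 <= (binomial_kernel c k)`_i.
Proof.
rewrite coefZ coefXnM coef_add1X_exp mulr_ge0 ?invr_ge0 ?exprn_ge0 //.
by case: ifP; rewrite ?ler0n.
Qed.

Lemma binomial_kernel_ge (c k i : nat) (d := `|i%:Z - c%:Z|%N) : (k <= c)%N -> (0 < k)%N ->
  (2 * d ^ 2 <= k)%N -> cbin R k <= 2 * (binomial_kernel c k)`_i.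
Proof.
move=> kc k0 dk.
have dlek : (d <= k)%N by rewrite /d in dk *; nia.
rewrite coefZ coefXnM coef_add1X_exp cbinE.
have -> : (i < c - k)%N = false by rewrite /d in dlek *; lia.
have -> : 'C(2 * k, i - (c - k)) = 'C(2 * k, k + d).
  rewrite /d in dlek *; have [ic|ci] := leqP c i; first by congr 'C(_, _); lia.
  by rewrite -bin_sub; [congr 'C(_, _); lia | lia].
rewrite mulrCA mulrC ler_wpM2l ?invr_ge0 ?exprn_ge0 //.
have kp : 0 < k%:R :> R by rewrite ltr0n.
rewrite -(ler_pM2r kp) -mulrA.
apply: le_trans (ler_wpM2l (ler0n _ 2) (bin_central_ge dlek)).
rewrite mulrCA ler_wpM2l ?ler0n //.
have : 2 * d%:R ^+ 2 <= k%:R :> R by rewrite -natrX -natrM ler_nat.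
by lra.
Qed.

Lemma binomial_kernel_le c k : coef_bounded (binomial_kernel c k) (cbin R k).
Proof.
move=> i; rewrite ger0_norm ?binomial_kernel_ge0 // coefZ coefXnM cbinE mulrC.
rewrite ler_wpM2r ?invr_ge0 ?exprn_ge0 //; case: ifP => _; first exact: ler0n.
set j := (i - _)%N; have := coefM_sq_le ((1 + 'X : {poly R}) ^+ k) ((1 + 'X) ^+ k) j.
rewrite -exprD addnn -mul2n norm2sq_binomial -expr2 coef_add1X_exp.
by rewrite ler_pXn2r ?nnegrE ?ler0n.
Qed.

Lemma norm1_add1X_exp N : norm1 ((1 + 'X : {poly R}) ^+ N) <= 2 ^+ N.
Proof.
apply: le_trans (norm1X _ _) _; rewrite lerXn2r ?nnegrE ?norm1_ge0 //.
by apply: le_trans (norm1D _ _) _; rewrite norm1_1 -['X]expr1 norm1Xn; lra.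
Qed.

Lemma norm1_binomial_kernel c k : norm1 (binomial_kernel c k) <= 1.
Proof.
rewrite norm1Z norm1MXn ger0_norm ?invr_ge0 ?exprn_ge0 // mulrC ler_pdivrMr ?exprn_gt0 //.
have := norm1_add1X_exp (2 * k); rewrite (exprM 2) mul1r.
by have -> : 2 ^+ 2 = 4 :> R by ring.
Qed.

End BinomialKernel.

(** * Approximate inverses of 1 - wX for |w| <= 1 *)

Section CesaroInverse.
Variable K : numFieldType.
Variables (w : K) (d : nat).
Hypothesis w1 : `|w| <= 1.
Hypothesis d0 : (0 < d)%N.

(** A Cesaro mean of the geometric series of 1 / (1 - wX). A partial sum of that series leaves the
    error (wX)^d, of modulus 1 when |w| = 1; the mean spreads it over d coefficients of modulus at
    most 1/d. *)
Definition cesaro_inverse : {poly K} := \poly_(i < d) ((1 - i%:R / d%:R) * w ^+ i).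
Definition cesaro_error : {poly K} := \poly_(i < d.+1) (if i == 0%N then 0 else w ^+ i / d%:R).

Lemma cesaro_inverse0 : cesaro_inverse`_0 = 1.
Proof. by rewrite coef_poly d0 mul0r subr0 mul1r. Qed.

Lemma cesaro_inverseE : (1 - w *: 'X) * cesaro_inverse = 1 - cesaro_error.
Proof.
have dn0 : d%:R != 0 :> K by rewrite pnatr_eq0 -lt0n.
apply/polyP => i; rewrite mulrBl mul1r -scalerAl !coefB coefZ coefXM coef1 !coef_poly.
case: i => [|i] /=; first by rewrite d0 mul0r subr0 mul1r mulr0 !subr0.
rewrite ltnS sub0r; have [id|di] := ltnP i d; last by rewrite ltnNge leqW // mulr0 subr0 oppr0.
have [id1|di1] := ltnP i.+1 d.
  by rewrite exprS -natr1; field.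
have -> : d%:R = i.+1%:R :> K by congr (_%:R); lia.
by rewrite exprS -natr1; field; rewrite natr1 pnatr_eq0.
Qed.

Lemma cesaro_error_coef : coef_bounded cesaro_error d%:R^-1.
Proof.
move=> i; rewrite coef_poly; case: ifP => _; last by rewrite normr0 invr_ge0.
case: ifP => _; first by rewrite normr0 invr_ge0.
rewrite normrM normrX normfV normr_nat ler_piMl ?invr_ge0 //.
by rewrite exprn_ile1.
Qed.

Lemma norm1_cesaro_error : norm1 cesaro_error <= 1.
Proof.
rewrite (@norm1_wide _ _ d.+1) ?size_poly // big_ord_recl coef_poly /= normr0 add0r.
apply: (@le_trans _ _ (\sum_(i < d) d%:R^-1)).
  by apply: ler_sum => i _; apply: cesaro_error_coef.
by rewrite sumr_const card_ord -[leLHS]mulr_natr mulVf // pnatr_eq0 -lt0n.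
Qed.

Lemma norm1_one_sub_cesaro_error : norm1 (1 - cesaro_error) <= 2.
Proof.
apply: le_trans (norm1D _ _) _; rewrite norm1N norm1_1.
by have := norm1_cesaro_error; rewrite -(lerD2l 1).
Qed.

End CesaroInverse.

(* The bound [c * b ^+ k <= z] is what the interpolation between the supremum
   (at most [c]) and the integral (at most [b]) needs, see [lpnorm_interp]. *)
Definition peak_bounded (K : numDomainType) k (z : K) (f : {poly K}) :=
  exists c b : K, [/\ coef_bounded f c, norm1 f <= b, c <= z & c * b ^+ k <= z].

(** With (1 + X) Q = 1 - E, the difference (1 - E)^M - 1 is E times a factor whose norm is at most M
    2^M whatever d is. So the norm of the error stays below B while its coefficients are at most B /
    d, and d > C / e makes both B / d and B^(k + 1) / d smaller than e. *)
Lemma cesaro_power (R : archiRealFieldType) k M (z : {poly R}) (e : R) : 0 < e ->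
  exists Q f : {poly R}, [/\ Q`_0 = 1, ((1 + 'X) * Q) ^+ M * z = z + f & peak_bounded k e f].
Proof.
move=> e0; set B := M%:R * 2 ^+ M * norm1 z.
have B0 : 0 <= B by rewrite !mulr_ge0 ?ler0n ?exprn_ge0 ?norm1_ge0.
pose C := B * B ^+ k + B + 1.
have C0 : 0 < C by rewrite ltr_wpDl // addr_ge0 // mulr_ge0 // exprn_ge0.
set d := Num.Def.archi_bound (C / e).
have Cd : C / e < d%:R by apply: archi_boundP; rewrite divr_ge0 // ltW.
have d0 : (0 < d)%N by rewrite -(ltr_nat R); apply: le_lt_trans Cd; rewrite divr_ge0 // ltW.
have dp : 0 < d%:R :> R by rewrite ltr0n.
have w1 : `|-1 : R| <= 1 by rewrite normrN1.
pose Q := cesaro_inverse (-1 : R) d; pose E := cesaro_error (-1 : R) d.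
have QE : (1 + 'X) * Q = 1 - E by have := cesaro_inverseE w1 d0; rewrite scaleN1r opprK.
pose G := \sum_(i < M) (1 - E) ^+ (M.-1 - i) * 1 ^+ i.
have GE : (1 - E) ^+ M = 1 + (- E) * G.
  have := subrXX (1 - E) 1 M; rewrite expr1n => /(canRL (subrK _)) ->.
  by rewrite addrC /G; congr (_ + _ * _); ring.
have nG : norm1 G <= M%:R * 2 ^+ M.
  apply: le_trans (norm1_sum _ _ _) _.
  apply: (@le_trans _ _ (\sum_(i < M) 2 ^+ M)); last first.
    by rewrite sumr_const card_ord mulr_natl.
  apply: ler_sum => i _; rewrite expr1n mulr1; apply: le_trans (norm1X _ _) _.
  apply: (@le_trans _ _ (2 ^+ (M.-1 - i))).
    rewrite lerXn2r ?nnegrE ?norm1_ge0 //; exact: norm1_one_sub_cesaro_error.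
  by rewrite ler_eXn2l ?ltr1n //; lia.
have nGz : norm1 (G * z) <= B.
  by apply: le_trans (norm1M _ _) _; rewrite ler_wpM2r ?norm1_ge0.
exists Q, (- E * (G * z)); split; first exact: cesaro_inverse0.
  by rewrite QE GE; ring.
have Ced : C < e * d%:R by rewrite mulrC -ltr_pdivrMr.
have BB0 : 0 <= B * B ^+ k by rewrite mulr_ge0 // exprn_ge0.
exists (B / d%:R), B; split.
- move=> i; have := coef_boundedM (G * z) (cesaro_error_coef d w1) i.
  rewrite mulNr coefN normrN mulrC => /le_trans; apply.
  by rewrite ler_wpM2r ?invr_ge0 // ltW.
- rewrite mulNr norm1N; apply: le_trans (norm1M _ _) _.
  by apply: le_trans nGz; rewrite ler_piMl ?norm1_ge0 // norm1_cesaro_error.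
- by rewrite ler_pdivrMr // (le_trans _ (ltW Ced)) // /C; lra.
- by rewrite mulrAC ler_pdivrMr // (le_trans _ (ltW Ced)) // /C; lra.
Qed.

(** * Bernoulli inequalities *)

Section Bernoulli.
Variable R : realFieldType.

Lemma bernoulli_le (x : R) n : -1 <= x -> 1 + n%:R * x <= (1 + x) ^+ n.
Proof.
move=> x1; have p0 : 0 <= 1 + x by lra.
elim: n => [|n IH]; first by rewrite mul0r addr0 expr0.
rewrite exprS; apply: le_trans (ler_wpM2l p0 IH).
rewrite -natr1; have : 0 <= n%:R * x ^+ 2 by rewrite mulr_ge0 ?ler0n ?sqr_ge0.
by lra.
Qed.

Lemma add_mul_sub_pow_le (x : R) n : 0 <= x <= 1 -> (1 + x) ^+ n * (1 - x) ^+ n <= 1.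
Proof. by move=> x01; rewrite -exprMn exprn_ile1 //; nra. Qed.

(** Bernoulli gives (1 + x)^M >= 2 at x = 1 / M, while (1 + x)^M (1 - x)^M <= 1. The next lemma uses
    the same product, with Bernoulli applied to 1 - x / M. *)
Lemma one_sub_inv_pow_le (M : nat) : (0 < M)%N -> (1 - M%:R^-1) ^+ M <= 2^-1 :> R.
Proof.
move=> M0; have Mp : 0 < M%:R :> R by rewrite ltr0n.
have x1 : M%:R^-1 <= 1 :> R by rewrite invf_le1 // -[1]/(1%:R) ler_nat.
have Mx : M%:R * M%:R^-1 = 1 :> R by rewrite mulfV // gt_eqF.
set x := M%:R^-1 : R in x1 Mx *; have x0 : 0 < x by rewrite invr_gt0.
have x01 : 0 <= x <= 1 by rewrite x1 ltW.
have x1' : -1 <= x by lra.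
have := bernoulli_le M x1'; have := add_mul_sub_pow_le M x01.
have : 0 <= (1 - x) ^+ M by rewrite exprn_ge0 // subr_ge0.
rewrite Mx; nra.
Qed.

Lemma add_div_pow_le (x : R) (M : nat) : (0 < M)%N -> 0 <= x -> x < 1 ->
  (1 + x / M%:R) ^+ M <= (1 - x)^-1.
Proof.
move=> M0 x0 x1; have Mp : 0 < M%:R :> R by rewrite ltr0n.
have M1 : 1 <= M%:R :> R by rewrite -[1]/(1%:R) ler_nat.
have My : M%:R * (x / M%:R) = x by rewrite mulrCA mulfV ?mulr1 // gt_eqF.
have y0 : 0 <= x / M%:R by rewrite divr_ge0 // ltW.
have y1 : x / M%:R <= 1 by rewrite ler_pdivrMr // mul1r (le_trans (ltW x1)).
have y01 : 0 <= x / M%:R <= 1 by rewrite y0.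
have y1' : -1 <= - (x / M%:R) by lra.
have := bernoulli_le M y1'; have := add_mul_sub_pow_le M y01.
rewrite mulrN My; set y := x / M%:R; move=> H1 H2.
have p0 : 0 < 1 - x by rewrite subr_gt0.
rewrite -[leRHS]mul1r ler_pdivlMr //; apply: le_trans H1.
by rewrite ler_wpM2l // exprn_ge0 // addr_ge0.
Qed.

End Bernoulli.

(** * The nearly invariant polynomial with explicit parameters *)

Section NearlyInvariantPolynomial.
Variable R : archiRealFieldType.
Variables a q : nat.
Hypothesis q2 : (2 <= q)%N.

(** K = m q makes (1 - 1/(2m))^(2K) at most 2^-q. The ratio n / K = m makes the lower tail of order
    m^(-1/2). The [kk l] are squared widths of kernels, from K up to c = K n^2, the last of which
    covers every distance up to n. *)
Let m := (q ^ a.+1)%N.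
Let K := (m * q)%N.
Let n := (m * K)%N.
Let kk l := (K * q ^ (2 * l))%N.
Let I := (2 * a + 3)%N.
Let c := kk I.
Let B : R := (8 * q * I.+1)%:R.
Let T : {poly R} := 'X^(c - n) * lower_tail R n K.
Let Y : {poly R} := \sum_(l < I.+1) (8 * q)%:R *: binomial_kernel R c (kk l).

Let m2 : (2 <= m)%N.
Proof. by rewrite /m expnS (leq_trans q2) // leq_pmulr // expn_gt0; lia. Qed.

Let K0 : (0 < K)%N. Proof. by rewrite /K muln_gt0; lia. Qed.

Let kk0 l : (0 < kk l)%N.
Proof. by rewrite /kk muln_gt0 K0 expn_gt0; lia. Qed.

Let kkS l : kk l.+1 = (kk l * q ^ 2)%N.
Proof. by rewrite /kk -mulnA -expnD; congr (_ * _ ^ _)%N; lia. Qed.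

Let kk_mono i j : (i <= j)%N -> (kk i <= kk j)%N.
Proof. by move=> ij; rewrite leq_mul2l leq_pexp2l ?orbT //; lia. Qed.

Let n2c : (2 * n ^ 2 <= c)%N.
Proof.
rewrite /c /kk /n.
have -> : (q ^ (2 * I) = q ^ 2 * m ^ 4)%N.
  by rewrite /m -expnM -expnD; congr (_ ^ _)%N; rewrite /I; lia.
have -> : (2 * (m * K) ^ 2 = 2 * (q ^ 2 * m ^ 4))%N by rewrite /K; ring.
by rewrite leq_mul2r /K; apply/orP; right; have := m2; nia.
Qed.

Let nc : (n <= c)%N. Proof. by have := n2c; nia. Qed.

Let Kn : (K <= n)%N. Proof. by rewrite /n leq_pmull //; lia. Qed.

Let kkc l : (l <= I)%N -> (kk l <= c)%N. Proof. exact: kk_mono. Qed.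

Let q0 : 0 < q%:R :> R. Proof. by rewrite ltr0n; lia. Qed.

(** The tail is bounded near its centre and decays like 1 / d at distance d. A function 1 / d is
    majorized by kernels whose widths sqrt(kk l) are in geometric progression and whose heights are
    of order 1 / sqrt(kk l). *)
Let tail_le i : `|T`_i| <= Y`_i.
Proof.
have Y0 : 0 <= Y`_i.
  by rewrite coef_sum sumr_ge0 // => l _; rewrite coefZ mulr_ge0 ?ler0n // binomial_kernel_ge0.
rewrite coefXnM; case: ifPn => [_|]; first by rewrite normr0.
rewrite -leqNgt => ci; set j := (i - (c - n))%N.
have [jn|nj] := leqP j (2 * n); last first.
  rewrite nth_default ?normr0 //; apply: leq_trans nj.
  apply: (leq_trans (size_sum _ _ _)); apply/bigmax_leqP => l _.
  by apply: size_tail_term; apply: leq_trans Kn; apply: ltnW.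
set d := `|i%:Z - c%:Z|%N.
have dn : (d <= n)%N by rewrite /d /j in jn *; have := nc; lia.
(* One scale suffices: with u = cbin (kk l) >= 1 / (2 sqrt(kk l)), the kernel of index l is at least
   u / 2 at distance d, so the weight 8 q yields at least 4 q u >= 2 q / sqrt(kk l). *)
have kkd l : (l <= I)%N -> (2 * d ^ 2 <= kk l)%N ->
    (lower_tail R n K)`_j ^+ 2 * (kk l)%:R <= 4 * q%:R ^+ 2 ->
    `|(lower_tail R n K)`_j| <= Y`_i.
  move=> lI dk H.
  apply: (@le_trans _ _ ((8 * q)%:R * (binomial_kernel R c (kk l))`_i)); last first.
    have lI' : (l < I.+1)%N by [].
    rewrite coef_sum (bigD1 (Ordinal lI')) //= (coefZ (8 * q)%:R) lerDl sumr_ge0 // => l' _.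
    by rewrite coefZ mulr_ge0 ?ler0n // binomial_kernel_ge0.
  have := binomial_kernel_ge R (kkc lI) (kk0 l) dk; set b := (binomial_kernel _ _ _)`_i => Hb.
  have := cbin_sq_ge R (kk0 l); set u := cbin R (kk l) in Hb *.
  have u0 : 0 < u := cbin_gt0 _ _.
  rewrite natrM => Hu; set t := (lower_tail R n K)`_j in H *.
  have kp : 0 < (kk l)%:R :> R by rewrite ltr0n.
  apply: (@le_trans _ _ (4 * q%:R * u)); last first.
    have : q%:R * u <= q%:R * (2 * b) by rewrite ler_wpM2l // ltW.
    rewrite natrM; lra.
  rewrite -(@ler_pXn2r _ 2) ?nnegrE ?mulr_ge0 ?ler0n ?(ltW u0) //.
  rewrite real_normK ?num_real // -(ler_pM2r kp); apply: (le_trans H).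
  have -> : (4 * q%:R * u) ^+ 2 * (kk l)%:R = 4 * q%:R ^+ 2 * (u ^+ 2 * (4 * (kk l)%:R)) by ring.
  by rewrite ler_peMr // mulr_ge0 // sqr_ge0.
have h0 : (2 * d ^ 2 <= K)%N -> (2 * d ^ 2 <= kk 0)%N by rewrite /kk muln0 expn0 muln1.
(* Close to the centre the uniform bound 1 / (m - 1) on the squared coefficient is enough, as kk 0 =
   m q. *)
have [dK|Kd] := leqP (2 * d ^ 2) (kk 0).
  apply: (kkd 0%N) => //; rewrite /kk muln0 expn0 muln1.
  have := lower_tail_coef R j Kn; set t2 := _ ^+ 2.
  have t20 : 0 <= t2 by exact: sqr_ge0.
  have -> : (n - K)%:R = (m%:R - 1) * K%:R :> R.
    by rewrite natrB // mulrBl mul1r natrM.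
  rewrite mulrA mulrAC => H.
  have Kp : 0 < K%:R :> R by rewrite ltr0n.
  have m1 : 1 <= m%:R - 1 :> R by rewrite lerBrDr -(natrD _ 1 1) ler_nat.
  have : t2 * (m%:R - 1) <= 1 by rewrite -(ler_pM2r Kp) mul1r -mulrA [_ * K%:R]mulrC mulrA.
  have -> : K%:R = m%:R * q%:R :> R by rewrite natrM.
  move=> H2; apply: (@le_trans _ _ (t2 * (2 * (m%:R - 1) * q%:R))).
    rewrite ler_wpM2l // ler_wpM2r ?ler0n //; lra.
  have -> : t2 * (2 * (m%:R - 1) * q%:R) = 2 * q%:R * (t2 * (m%:R - 1)) by ring.
  apply: (@le_trans _ _ (2 * q%:R * 1)); first by rewrite ler_wpM2l // mulr_ge0 // ltW.
  have : 1 <= q%:R :> R by rewrite -[1]/(1%:R) ler_nat; lia.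
  rewrite expr2; nra.
(* Further out, take the smallest scale reaching d. By minimality it exceeds 2 d^2 by less than a
   factor q^2, so the decay 1 / d suffices. *)
have : exists l, (2 * d ^ 2 <= kk l)%N && (l <= I)%N.
  by exists I; rewrite leqnn andbT; apply: leq_trans n2c; rewrite leq_mul2l leq_sqr dn.
case/(ex_minnP) => l /andP[dl lI] lmin.
case: l dl lI lmin => [|l] dl lI lmin; first by move: Kd; rewrite ltnNge dl.
have ld : (kk l < 2 * d ^ 2)%N.
  rewrite ltnNge; apply/negP => H.
  by have := lmin l; rewrite H (ltnW lI) ltnn => /(_ isT).
apply: (kkd l.+1) => //; rewrite kkS natrM.
have := lower_tail_coef_decay R j Kn; set t := (lower_tail R n K)`_j; rewrite exprMn.
have -> : (j%:R - n%:R : R) ^+ 2 = d%:R ^+ 2.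
  have [ic|ci'] := leqP c i.
    have -> : j = (n + d)%N by rewrite /j /d; have := nc; lia.
    by rewrite natrD addrAC subrr add0r.
  have -> : n = (j + d)%N by rewrite /j /d; have := nc; lia.
  by rewrite natrD opprD addNKr sqrrN.
move=> H; have t20 : 0 <= t ^+ 2 by exact: sqr_ge0.
have : t ^+ 2 * (kk l)%:R <= t ^+ 2 * (2 * d%:R ^+ 2).
  by rewrite ler_wpM2l // -natrX -natrM ler_nat ltnW.
move=> H2; rewrite natrX [leLHS]mulrA; have Q0 : 0 <= q%:R ^+ 2 :> R by exact: sqr_ge0.
apply: (@le_trans _ _ (2 * q%:R ^+ 2)); last by lra.
by rewrite ler_wpM2r //; lra.
Qed.

Let v : {poly R} := Y - T.

Let norm1_Y : norm1 Y <= B.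
Proof.
apply: le_trans (norm1_sum _ _ _) _.
apply: (@le_trans _ _ (\sum_(l < I.+1) (8 * q)%:R)); last first.
  by rewrite sumr_const card_ord -[leLHS]mulr_natr -natrM.
apply: ler_sum => l _; rewrite norm1Z ger0_norm ?ler0n // ler_piMr ?ler0n //.
exact: norm1_binomial_kernel.
Qed.

Let coef_Y : coef_bounded Y (B * cbin R K).
Proof.
move=> i; rewrite coef_sum; apply: le_trans (ler_norm_sum _ _ _) _.
apply: (@le_trans _ _ (\sum_(l < I.+1) (8 * q)%:R * cbin R K)); last first.
  by rewrite sumr_const card_ord -[leLHS]mulr_natr /B [in leRHS]natrM mulrAC.
apply: ler_sum => l _; rewrite (coefZ (8 * q)%:R) normrM ger0_norm ?ler0n //.
rewrite ler_wpM2l ?ler0n //; apply: le_trans (binomial_kernel_le R _ _ _) _.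
by apply: cbin_dec; rewrite /kk leq_pmulr // expn_gt0; lia.
Qed.

Let v_ge0 i : 0 <= v`_i.
Proof. by rewrite coefB subr_ge0; apply: le_trans (ler_norm _) (tail_le i). Qed.

Let v_le i : `|v`_i| <= 2 * Y`_i.
Proof.
rewrite coefB; apply: le_trans (ler_normB _ _) _; have H := tail_le i.
have Y0 : 0 <= Y`_i by apply: le_trans H.
by rewrite (ger0_norm Y0); lra.
Qed.

Let norm1_v : norm1 v <= 2 * B.
Proof.
apply: (@le_trans _ _ (2 * norm1 Y)); last by rewrite ler_wpM2l // norm1_Y.
set s := maxn (size v) (size Y).
rewrite (@norm1_wide _ v s) ?leq_maxl // (@norm1_wide _ Y s) ?leq_maxr // mulr_sumr.
apply: ler_sum => i _; apply: le_trans (v_le i) _.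
by rewrite ler_wpM2l // ler_norm.
Qed.

Let coef_v : coef_bounded v (2 * (B * cbin R K)).
Proof.
move=> i; apply: le_trans (v_le i) _.
by rewrite ler_wpM2l // (le_trans (ler_norm _) (coef_Y i)).
Qed.

Let rho : R := 1 - m%:R^-1.
(** The multiplier W will be D times a power of the Cesaro inverse of 1 + X. It exchanges the factor
    (1 + X)^(2K) of X^c + v for D, and z is the outcome of this exchange. *)
Let D : {poly R} := (1 + rho *: 'X) ^+ (2 * K).
Let y (i : nat) : {poly R} := ((-1) ^+ (n - i) * ('C(n, i)%:R / 4 ^+ n)) *:
  (D * ((1 - 'X) ^+ (2 * (n - i)) * (1 + 'X) ^+ (2 * (i - K)))).
Let y2 : {poly R} := \sum_(l < I.+1) (8 * q)%:R *: ((4 ^- kk l) *: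
  ('X^(c - kk l) * (1 + 'X) ^+ (2 * (kk l - K)) * D)).
Let z : {poly R} := 'X^(c - n) * (\sum_(K <= i < n.+1) y i) + y2.

(** The lower tail cancels: X^c + v is X^(c - n) times the upper tail, plus Y. Both contain (1 +
    X)^(2K), the kernels of Y because kk l >= K. *)
Let factor_z : D * ('X^c + v) = (1 + 'X) ^+ (2 * K) * z.
Proof.
have -> : 'X^c + v = 'X^(c - n) * (\sum_(K <= i < n.+1) tail_term R n i) + Y.
  have := sum_tail_term R n; rewrite -(big_mkord xpredT (tail_term R n)).
  rewrite (big_cat_nat _ (n := K)) //=; last by rewrite leqW.
  rewrite big_mkord -/(lower_tail R n K) => /(canRL (addKr _)) ->.
  by rewrite /v /T -{1}(subnK nc) exprD; ring.
rewrite mulrDr /z mulrDr mulrCA; congr (_ + _).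
  rewrite [RHS]mulrCA; congr (_ * _); rewrite !mulr_sumr.
  rewrite !big_nat; apply: eq_bigr => i /andP[Ki iN].
  rewrite /tail_term /y -!scalerAr; congr (_ *: _).
  have -> : (2 * i = 2 * K + 2 * (i - K))%N by lia.
  by rewrite exprD; ring.
rewrite /Y /y2 !mulr_sumr; apply: eq_bigr => l _.
rewrite /binomial_kernel -!scalerAr; congr (_ *: (_ *: _)).
have Kkk : (K <= kk l)%N by rewrite /kk leq_pmulr // expn_gt0; lia.
have -> : (2 * kk l = 2 * K + 2 * (kk l - K))%N by lia.
by rewrite exprD; ring.
Qed.

Let rho_half : (1 + rho) / 2 = 1 - (2 * m)%:R^-1.
Proof. by rewrite /rho natrM invfM; field; rewrite pnatr_eq0; have := m2; lia. Qed.

Let norm1_D : norm1 (4 ^- K *: D) <= 2^-1 ^+ q.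
Proof.
have mp : 0 < m%:R :> R by rewrite ltr0n; have := m2; lia.
have im : m%:R^-1 <= 1 :> R by rewrite invf_le1 // -[1]/(1%:R) ler_nat; have := m2; lia.
have rho0 : 0 <= rho by rewrite subr_ge0.
rewrite norm1Z ger0_norm ?invr_ge0 ?exprn_ge0 //.
have H : norm1 D <= (1 + rho) ^+ (2 * K).
  apply: le_trans (norm1X _ _) _.
  rewrite lerXn2r ?nnegrE ?norm1_ge0 ?(addr_ge0 ler01 rho0) //.
  apply: le_trans (norm1D _ _) _; rewrite norm1_1 norm1Z -['X]expr1 norm1Xn mulr1.
  by rewrite ger0_norm.
apply: (@le_trans _ _ (4 ^- K * (1 + rho) ^+ (2 * K))).
  by rewrite ler_wpM2l // invr_ge0 exprn_ge0.
have -> : 4 ^- K * (1 + rho) ^+ (2 * K) = (((1 + rho) / 2) ^+ (2 * m)) ^+ q.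
  rewrite -exprM -mulnA -/K expr_div_n mulrC [2 ^+ (2 * K)]exprM.
  by have -> : 2 ^+ 2 = 4 :> R by ring.
have M0 : (0 < 2 * m)%N by have := m2; lia.
rewrite rho_half lerXn2r ?nnegrE ?invr_ge0 ?exprn_ge0 ?one_sub_inv_pow_le //.
by rewrite subr_ge0 invf_le1 ?ltr0n // -[1]/(1%:R) ler_nat.
Qed.

(** Here s = (1 - 1/(2m))^2 >= 9/16 and t = 1/(4 m^2). Hence s^m <= 1/2 and t/s <= (4/9) / m^2,
    which gives (1 + t/s)^(m^2) <= 1 / (1 - 4/9) = 9/5. The product is 9/10, and the exponents 2K =
    2q m and 2n = 2q m^2 raise it to the power 2q. The factor 2n + 1 pays for passing from the
    square norm to [norm1]. *)
Let norm1_y i : (K <= i <= n)%N -> norm1 (y i) <= (2 * n + 1)%:R * (9 / 10) ^+ q.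
Proof.
move=> Kin; have mp : 0 < m%:R :> R by rewrite ltr0n; have := m2; lia.
have M0 : (0 < 2 * m)%N by have := m2; lia.
have i2m : (2 * m)%:R^-1 <= 4^-1 :> R.
  by rewrite lef_pV2 ?posrE ?ltr0n // ler_nat; have := m2; lia.
have Mp : 0 < (2 * m)%:R :> R by rewrite ltr0n.
have ip : 0 < (2 * m)%:R^-1 :> R by rewrite invr_gt0.
set s := ((1 + rho) / 2) ^+ 2; set t := ((1 - rho) / 2) ^+ 2.
have s916 : 9 / 16 <= s by rewrite /s rho_half; nra.
have tE : t = (4 * (m ^ 2)%:R)^-1.
  by rewrite /t /rho natrX; field; rewrite gt_eqF.
have s0 : 0 < s by apply: lt_le_trans s916; lra.
have m0 : (0 < m)%N by apply: leq_trans m2.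
have m2p : 0 < (m ^ 2)%:R :> R by rewrite ltr0n expn_gt0 m0.
have sz : (size (y i) <= 2 * n + 1)%N.
  apply: leq_trans (size_scale_leq _ _) _.
  apply: leq_trans (size_polyMleq _ _) _.
  have sD : (size D <= (2 * K).+1)%N.
    rewrite /D; apply: leq_trans (size_poly_exp_leq _ _) _; rewrite ltnS.
    have : (size (1 + rho *: 'X : {poly R})%R <= 2)%N.
      apply: leq_trans (size_polyD _ _) _; rewrite size_poly1 geq_max /=.
      by apply: leq_trans (size_scale_leq _ _) _; rewrite size_polyX.
    by move=> s2; rewrite -[leqRHS]mul1n leq_mul2r -subn1 leq_subLR s2 orbT.
  have aux (x1 x2 k n' j : nat) : (k <= j <= n')%N -> (x1 <= (2 * k).+1)%N ->
    (x2 <= (2 * (n' - j) + 2 * (j - k)).+1)%N -> ((x1 + x2).-1 <= 2 * n' + 1)%N.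
    by clear; lia.
  exact: aux Kin sD (size_pow2 R _ _).
have H := norm1_sq_le sz.
have Hy : norm2sq (y i) <= ((9 / 10) ^+ q) ^+ 2.
  rewrite /y norm2sqZ exprMn sqrr_sign mul1r.
  apply: le_trans (norm2sq_tail_term s0 Kin) _.
  have -> : (2 * n = m ^ 2 * (q * 2))%N by rewrite /n /K; ring.
  have -> : (2 * K = m * (q * 2))%N by rewrite /K; ring.
  rewrite (exprM s m) (exprM (1 + t / s) (m ^ 2)) -(exprMn _ (s ^+ m)) -(exprM (9 / 10)).
  have sm : s ^+ m <= 2^-1.
    rewrite /s -exprM rho_half; exact: one_sub_inv_pow_le.
  have t0 : 0 <= t by exact: sqr_ge0.
  have y0 : 0 <= 4 / 9 / (m ^ 2)%:R :> R by apply: divr_ge0; [lra | exact: ltW].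
  have ts0 : 0 <= t / s by apply: divr_ge0; [|exact: ltW].
  have ts : t / s <= 4 / 9 / (m ^ 2)%:R.
    rewrite ler_pdivrMr // tE.
    have -> : (4 * (m ^ 2)%:R)^-1 = 4 / 9 / (m ^ 2)%:R * (9 / 16) :> R.
      by field; rewrite gt_eqF.
    by rewrite ler_wpM2l.
  have tm : (1 + t / s) ^+ (m ^ 2) <= 9 / 5.
    apply: le_trans (_ : _ <= (1 + 4 / 9 / (m ^ 2)%:R) ^+ (m ^ 2)) _.
      by rewrite lerXn2r ?nnegrE ?lerD2l // addr_ge0.
    have -> : 9 / 5 = (1 - 4 / 9)^-1 :> R by field.
    by apply: add_div_pow_le; [rewrite expn_gt0 m0 | lra | lra].
  have p1 : 0 <= s ^+ m by rewrite exprn_ge0 // ltW.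
  have p2 : 0 <= (1 + t / s) ^+ (m ^ 2) by rewrite exprn_ge0 // addr_ge0.
  apply: lerXn2r; rewrite ?nnegrE; [by rewrite mulr_ge0 | lra | nra].
have r0 : 0 <= 9 / 10 :> R by lra.
rewrite -(@ler_pXn2r _ 2) ?nnegrE ?norm1_ge0 ?mulr_ge0 ?ler0n ?exprn_ge0 //.
apply: (le_trans H); rewrite [leRHS]exprMn; apply: ler_pM => //.
- exact: norm2sq_ge0.
- by rewrite -natrX ler_nat -[leqLHS]expn1 leq_pexp2l // addn1.
Qed.

Let norm1_z : norm1 z <=
  (n + 1)%:R * ((2 * n + 1)%:R * (9 / 10) ^+ q) + B * 2^-1 ^+ q.
Proof.
apply: le_trans (norm1D _ _) _; rewrite norm1MXn; apply: lerD.
  apply: le_trans (norm1_sum _ _ _) _.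
  apply: (@le_trans _ _ (\sum_(K <= i < n.+1) (2 * n + 1)%:R * (9 / 10) ^+ q)).
    by rewrite !big_nat; apply: ler_sum => i /andP[Ki iN]; apply: norm1_y; rewrite Ki.
  rewrite sumr_const_nat -[leLHS]mulr_natl; apply: ler_wpM2r.
    by apply: mulr_ge0; [exact: ler0n | apply: exprn_ge0; lra].
  by rewrite ler_nat addn1 leq_subr.
apply: le_trans (norm1_sum _ _ _) _.
apply: (@le_trans _ _ (\sum_(l < I.+1) (8 * q)%:R * 2^-1 ^+ q)); last first.
  by rewrite sumr_const card_ord -[leLHS]mulr_natr /B [in leRHS]natrM mulrAC.
apply: ler_sum => l _; rewrite norm1Z ger0_norm ?ler0n // ler_wpM2l ?ler0n //.
have Kkk : (K <= kk l)%N by rewrite /kk leq_pmulr // expn_gt0; lia.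
have -> : 4 ^- kk l *: ('X^(c - kk l) * (1 + 'X) ^+ (2 * (kk l - K)) * D) =
    'X^(c - kk l) * ((4 ^- (kk l - K) *: (1 + 'X) ^+ (2 * (kk l - K))) * (4 ^- K *: D)).
  rewrite -scalerAl -!scalerAr scalerA mulrA; congr (_ *: _).
  by rewrite -invfM -exprD subnK.
rewrite norm1MXn; apply: le_trans (norm1M _ _) _.
apply: le_trans norm1_D; rewrite ler_piMl ?norm1_ge0 //.
rewrite norm1Z ger0_norm ?invr_ge0 ?exprn_ge0 // mulrC ler_pdivrMr ?exprn_gt0 // mul1r.
have := norm1_add1X_exp R (2 * (kk l - K)); rewrite (exprM 2).
by have -> : 2 ^+ 2 = 4 :> R by ring.
Qed.

Lemma nearly_invariant_core : exists (N : nat) (v D z : {poly R}),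
  [/\ [/\ forall i, 0 <= v`_i, D`_0 = 1
        & exists M, D * ('X^N + v) = (1 + 'X) ^+ M * z],
      coef_bounded v (2 * (8 * q * (2 * a + 4))%:R * cbin R (q ^ (a + 2))),
      norm1 v <= 2 * (8 * q * (2 * a + 4))%:R
    & norm1 z <= (q ^ (2 * a + 3) + 1)%:R * ((2 * q ^ (2 * a + 3) + 1)%:R * (9 / 10) ^+ q)
      + (8 * q * (2 * a + 4))%:R * 2^-1 ^+ q].
Proof.
have EK : K = (q ^ (a + 2))%N by rewrite /K /m -expnSr; congr (_ ^ _)%N; lia.
have En : n = (q ^ (2 * a + 3))%N by rewrite /n EK /m -expnD; congr (_ ^ _)%N; lia.
have EB : B = (8 * q * (2 * a + 4))%:R by rewrite /B /I; congr (_%:R); lia.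
exists c, v, D, z; rewrite -EK -En -EB; split.
- split; first exact: v_ge0.
    by rewrite -horner_coef0 /D !hornerE expr1n.
  by exists (2 * K)%N; exact: factor_z.
- by rewrite -mulrA; exact: coef_v.
- exact: norm1_v.
- exact: norm1_z.
Qed.

End NearlyInvariantPolynomial.

(** * Choice of the parameters *)

Section NearlyInvariant.
Variable R : archiRealFieldType.

(** Take q = (c + 1) t. Bernoulli gives (9/10)^t <= 9 / t, and its power c + 1 beats q^c by one
    factor t. *)
Lemma exists_poly_geometric_le c (C e : R) Q0 : 0 <= C -> 0 < e ->
  exists q, (Q0 <= q)%N /\ C * q%:R ^+ c * (9 / 10) ^+ q <= e.
Proof.
move=> C0 e0; pose A := C * c.+1%:R ^+ c * 9 ^+ c.+1.
have A0 : 0 <= A by rewrite !mulr_ge0 ?exprn_ge0 ?ler0n.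
pose t := (Num.Def.archi_bound (A / e) + Q0).+1.
have tA : A / e < t%:R.
  apply: lt_le_trans (_ : (Num.Def.archi_bound (A / e))%:R <= _).
    by apply: archi_boundP; rewrite divr_ge0 // ltW.
  by rewrite ler_nat /t; lia.
have tp : 0 < t%:R :> R by rewrite ltr0n.
exists (c.+1 * t)%N; split; first by rewrite /t; nia.
have g : (9 / 10) ^+ t <= 9 / t%:R :> R.
  have x1 : -1 <= 9^-1 :> R by lra.
  have := bernoulli_le t x1; have -> : 1 + 9^-1 = (9 / 10)^-1 :> R by field.
  rewrite exprVn; have : 0 < (9 / 10) ^+ t :> R by apply: exprn_gt0; lra.
  move: (_ ^+ t) => p p0 H; rewrite ler_pdivlMr //.
  have : p * (1 + t%:R * 9^-1) <= 1 by rewrite -[leRHS](mulfV (lt0r_neq0 p0)) ler_pM2l.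
  by lra.
have g0 : 0 <= (9 / 10) ^+ t :> R by rewrite exprn_ge0 //; lra.
rewrite mulnC exprM; apply: (@le_trans _ _ (C * (t * c.+1)%:R ^+ c * (9 / t%:R) ^+ c.+1)).
  rewrite ler_wpM2l ?mulr_ge0 ?exprn_ge0 ?ler0n //.
  by rewrite lerXn2r ?nnegrE // divr_ge0 // ltW.
rewrite natrM exprMn expr_div_n.
have -> : C * (t%:R ^+ c * c.+1%:R ^+ c) * (9 ^+ c.+1 / t%:R ^+ c.+1) = A / t%:R.
  by rewrite /A [t%:R ^+ c.+1]exprS; field; rewrite expf_neq0 gt_eqF.
rewrite ler_pdivrMr // mulrC -ler_pdivrMr //; exact: ltW.
Qed.

Lemma peak_bounded_norm1 k (z : R) (f : {poly R}) : z <= 1 -> norm1 f <= z ->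
  peak_bounded k z f.
Proof.
move=> z1 fz; have f0 := norm1_ge0 f.
exists (norm1 f), (norm1 f); split => //; first exact: coef_le_norm1.
apply: (le_trans _ fz); rewrite ler_piMr // exprn_ile1 //.
exact: le_trans fz z1.
Qed.

(** The two summands are small in different ways: f1 is the polynomial z, whose norm is small, and
    f2 is the Cesaro error, of which only the coefficients are small. *)
Lemma nearly_invariant k (e : R) : 0 < e ->
  exists (N : nat) (v W f1 f2 : {poly R}),
  [/\ [/\ forall i, 0 <= v`_i, W`_0 = 1 & W * ('X^N + v) = f1 + f2],
      peak_bounded k e v, peak_bounded k e f1 & peak_bounded k e f2].
Proof.
(* The norm of v is of order q and its coefficients of order q^(1 - (a + 2)/2). With this a, the
   largest coefficient times the k-th power of the norm is of order q^(-1/2). *)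
move=> e0; pose a := (2 * k + 1)%N.
pose A : R := (16 * (2 * a + 4))%:R.
have A1 : 1 <= A by rewrite /A -[1]/(1%:R) ler_nat; lia.
(* With n = q^(2a + 3), so that q^(4a + 6) = n^2: 6 comes from (n + 1) (2n + 1) <= 6 n^2, the rest
   from q <= n^2. *)
pose C : R := (6 + 8 * (2 * a + 4))%:R.
pose e1 := Num.min e 1.
have e10 : 0 < e1 by rewrite lt_min e0 ltr01.
have e1e : e1 <= e by rewrite ge_min lexx.
have e11 : e1 <= 1 by rewrite ge_min lexx orbT.
pose Q0 := (Num.Def.archi_bound (A ^+ (2 * k + 2) / e ^+ 2)).+2.
have [q [Q0q Hq]] := @exists_poly_geometric_le (4 * a + 6) C e1 Q0 (ler0n _ _) e10.
have q2 : (2 <= q)%N by apply: leq_trans Q0q.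
have qp : 0 < q%:R :> R by rewrite ltr0n; lia.
have q1 : 1 <= q%:R :> R by rewrite -[1]/(1%:R) ler_nat; lia.
have qA : A ^+ (2 * k + 2) / e ^+ 2 <= q%:R.
  apply: le_trans (_ : (Num.Def.archi_bound (A ^+ (2 * k + 2) / e ^+ 2))%:R <= _).
    apply/ltW/archi_boundP; apply: divr_ge0; apply: exprn_ge0; last exact: ltW.
    exact: le_trans ler01 A1.
  by rewrite ler_nat; apply: leq_trans Q0q; rewrite /Q0 2?ltnW.
have [N [v [D [z [[v0 D0 [M DE]] cv nv nz]]]]] := @nearly_invariant_core R a q q2.
have [Q [f [Qc0 Qf pf]]] := cesaro_power k M z e0.
exists N, v, (D * Q ^+ M), z, f; split => //.
- split => //.
    by move: D0 Qc0; rewrite -!horner_coef0 !hornerE /= => -> ->; rewrite expr1n mulr1.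
  by rewrite mulrAC DE -Qf exprMn mulrAC.
- set b : R := 2 * (8 * q * (2 * a + 4))%:R in cv nv *.
  have bE : b = A * q%:R.
    by rewrite /b /A -!natrM; congr (_%:R); ring.
  have b1 : 1 <= b by rewrite bE; nra.
  set u := cbin R _ in cv *; have u0 : 0 < u := cbin_gt0 _ _.
  have buk : b * u * b ^+ k <= e.
    have -> : b * u * b ^+ k = b ^+ k.+1 * u by rewrite exprS; ring.
    rewrite -(@ler_pXn2r _ 2) ?nnegrE ?mulr_ge0 ?exprn_ge0 ?(ltW u0) ?(ltW e0) ?(le_trans ler01 b1) //.
    rewrite exprMn -exprM; have -> : (k.+1 * 2 = 2 * k + 2)%N by rewrite mulnC mulnS addnC.
    rewrite bE exprMn; have := cbin_sq_le R (q ^ (a + 2)); rewrite -/u natrD natrM natrX.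
    have -> : (a + 2 = (2 * k + 2).+1)%N by rewrite /a -addnA -addnS.
    rewrite (exprS q%:R); move: qA; set S := A ^+ _; set P := q%:R ^+ _ => qA.
    have S0 : 0 <= S by rewrite exprn_ge0 // (le_trans ler01 A1).
    have P0 : 0 <= P by rewrite exprn_ge0 // ltW.
    have : S <= q%:R * e ^+ 2 by rewrite -ler_pdivrMr // exprn_gt0.
    have U0 : 0 <= u ^+ 2 by exact: sqr_ge0.
    move=> h1 h2; have h3 : u ^+ 2 * (q%:R * P) <= 1.
      have p0 : 0 <= u ^+ 2 * (q%:R * P) by rewrite mulr_ge0 // mulr_ge0 // ltW.
      by clear -h2 p0 U0; lra.
    apply: (@le_trans _ _ (q%:R * e ^+ 2 * (P * u ^+ 2))).
      by rewrite -mulrA ler_wpM2r // mulr_ge0.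
    have -> : q%:R * e ^+ 2 * (P * u ^+ 2) = e ^+ 2 * (u ^+ 2 * (q%:R * P)) by ring.
    by rewrite ler_piMr // sqr_ge0.
  exists (b * u), b; split => //.
  apply: le_trans buk; rewrite ler_peMr ?exprn_ege1 // mulr_ge0 ?(ltW u0) //.
  exact: le_trans ler01 b1.
- have [c [d [h1 h2 h3 h4]]] : peak_bounded k e1 z.
    apply: peak_bounded_norm1 => //; apply: (le_trans nz); apply: (le_trans _ Hq).
    set n := (q ^ (2 * a + 3))%N.
    have r0 : 0 <= (9 / 10) ^+ q :> R by apply: exprn_ge0; lra.
    have n1 : 1 <= n%:R :> R by rewrite -[1]/(1%:R) ler_nat expn_gt0 (ltnW q2).
    have qn : q%:R ^+ (4 * a + 6) = n%:R * n%:R :> R.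
      rewrite -natrM -natrX /n -expnD; congr (_%:R); congr (_ ^ _)%N; ring.
    have qnn : q%:R <= n%:R * n%:R :> R.
      by rewrite -qn -[leLHS]expr1 ler_weXn2l // !addnS.
    have h : 2^-1 ^+ q <= (9 / 10) ^+ q :> R by rewrite lerXn2r ?nnegrE; lra.
    have Cn : (n + 1)%:R * (2 * n + 1)%:R <= 6 * (n%:R * n%:R) :> R.
      have -> : (n + 1)%:R * (2 * n + 1)%:R = (n%:R + 1) * (2 * n%:R + 1) :> R by ring.
      by clear -n1; nra.
    have CE : C = 6 + 8 * (2 * a%:R + 4) by rewrite /C; ring.
    rewrite CE qn; set r := (9 / 10) ^+ q in r0 h *.
    have -> : (6 + 8 * (2 * a%:R + 4)) * (n%:R * n%:R) * r =
      6 * (n%:R * n%:R) * r + 8 * (n%:R * n%:R) * (2 * a%:R + 4) * r by ring.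
    apply: lerD; first by rewrite mulrA ler_wpM2r.
    have -> : (8 * q * (2 * a + 4))%:R = 8 * q%:R * (2 * a%:R + 4) :> R by ring.
    have s0 : 0 <= 2 * a%:R + 4 :> R by rewrite addr_ge0 // mulr_ge0 // ler0n.
    have h0 : 0 <= 2^-1 ^+ q :> R by apply: exprn_ge0; lra.
    by apply: ler_pM => //; rewrite ler_wpM2r // ler_wpM2l.
  by exists c, d; split => //; apply: le_trans e1e.
Qed.

End NearlyInvariant.

(** * Lp seminorms and translation polynomials *)

Local Open Scope classical_set_scope.
Local Open Scope ring_scope.

Section Seminorm.
Variable R : realType.
Local Notation mu := (@lebesgue_measure R).
Implicit Types (F G : R -> R) (p t : R).

Definition lpnorm p F : \bar R := Lnorm mu p%:E (EFin \o F).

Lemma lpnormE p F : lpnorm p F = ((\int[mu]_x (`|F x| `^ p)%:E) `^ p^-1)%E.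
Proof.
by rewrite /lpnorm unlock.
Qed.

Lemma measurable_normpow p F : measurable_fun setT F ->
  measurable_fun [set: R] (fun x => (`|F x| `^ p)%:E).
Proof.
move=> mF; apply/measurable_EFinP.
apply: (@measurableT_comp _ _ _ _ _ _ (fun y => y `^ p)) => //.
exact: measurableT_comp.
Qed.

Lemma lpnorm_ge0 p F : (0 <= lpnorm p F)%E.
Proof. exact: Lnorm_ge0. Qed.

Lemma le_lpnorm p F G : 0 <= p -> measurable_fun setT F -> measurable_fun setT G ->
  (forall x, `|F x| <= G x) -> (lpnorm p F <= lpnorm p G)%E.
Proof.
move=> p0 mF mG FG; rewrite !lpnormE; apply: gt0_ler_poweR.
- by rewrite invr_ge0.
- by rewrite in_itv /= leey andbT integral_ge0.
- by rewrite in_itv /= leey andbT integral_ge0.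
apply: ge0_le_integral => //; try exact: measurable_normpow.
move=> x _; rewrite lee_fin; apply: ge0_ler_powR => //; rewrite ?nnegrE //.
by rewrite (le_trans (FG x)) // ler_norm.
Qed.

Lemma lpnormD p F G : 1 <= p -> measurable_fun setT F -> measurable_fun setT G ->
  (lpnorm p (fun x => F x + G x)%R <= lpnorm p F + lpnorm p G)%E.
Proof. by move=> p1 mF mG; exact: minkowski_EFin. Qed.

Lemma lpnorm0 p : 0 < p -> lpnorm p (fun=> 0) = 0%E.
Proof.
move=> p0; rewrite lpnormE; under eq_integral do rewrite normr0 powR0 ?gt_eqF //.
by rewrite integral0 poweR0r // invr_neq0 // gt_eqF.
Qed.

Lemma lpnormZ p c F : 0 < p -> measurable_fun setT F ->
  lpnorm p (fun x => c * F x) = (`|c|%:E * lpnorm p F)%E.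
Proof.
move=> p0 mF; rewrite !lpnormE.
under eq_integral do rewrite normrM powRM // EFinM.
rewrite ge0_integralZl_EFin ?powR_ge0 //; last exact: measurable_normpow.
rewrite poweRM ?lee_fin ?powR_ge0 ?integral_ge0 //.
by rewrite poweR_EFin -powRrM mulfV ?gt_eqF // powRr1.
Qed.

Lemma lpnormN p F : 0 < p -> measurable_fun setT F ->
  lpnorm p (fun x => - F x) = lpnorm p F.
Proof.
move=> p0 mF; have := lpnormZ (-1) p0 mF; rewrite normrN1 mul1e => <-.
by congr lpnorm; apply/funext => x; rewrite mulN1r.
Qed.

Lemma lpnorm_sum p n (F : 'I_n -> R -> R) : 1 <= p -> (forall i, measurable_fun setT (F i)) ->
  (lpnorm p (fun x => \sum_(i < n) F i x)%R <= \sum_(i < n) lpnorm p (F i))%E.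
Proof.
move=> p1; elim: n F => [|n IH] F mF.
  rewrite big_ord0; under [X in lpnorm _ X]funext do rewrite big_ord0.
  by rewrite lpnorm0 // (lt_le_trans ltr01).
rewrite big_ord_recl; under [X in lpnorm _ X]funext do rewrite big_ord_recl.
apply: le_trans (lpnormD p1 (mF _) _) _; first exact: measurable_sum.
by rewrite leeD2l // IH.
Qed.

Lemma lebesgue_measure_shift t (A : set R) : measurable A ->
  mu ((fun x => x - t) @^-1` A) = mu A.
Proof.
move=> mA; pose s (x : R) : measurableTypeR R := x - t.
have ms : measurable_fun setT s by exact: measurable_funB.
pose mm := isMeasurableFun.Build _ _ _ _ _ ms.
pose ps : {mfun _ >-> _} := HB.pack s mm.
apply/esym; apply: (@lebesgue_measure_unique R (pushforward mu ps) _ A mA).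
move=> X /= [[a b] _ <-] /=; rewrite /pushforward.
have -> : s @^-1` `]a, b]%classic = `](a + t), (b + t)]%classic.
  by apply/seteqP; split => x /=; rewrite !in_itv /= /s ltrBrDr lerBlDr.
rewrite !lebesgue_measure_itv /= !lte_fin ltrD2r.
by case: ifP => // _; rewrite -!EFinD; congr (_%:E); ring.
Qed.

Lemma integral_shift t (f : R -> \bar R) : measurable_fun setT f ->
  (forall x, 0 <= f x)%E -> (\int[mu]_x f (x - t)%R = \int[mu]_x f x)%E.
Proof.
move=> mf f0; pose s (x : R) : measurableTypeR R := x - t.
have ms : measurable_fun setT s by exact: measurable_funB.
pose mm := isMeasurableFun.Build _ _ _ _ _ ms.
pose ps : {mfun _ >-> _} := HB.pack s mm.
have H : (\int[pushforward mu ps]_x f x = \int[mu]_x f (x - t)%R)%E.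
  by rewrite ge0_integral_pushforward.
rewrite -H; apply: eq_measure_integral => A mA _.
exact: lebesgue_measure_shift.
Qed.

Lemma measurable_shift t F : measurable_fun [set: R] F ->
  measurable_fun [set: R] (fun x => F (x - t)).
Proof. by move=> mF; apply: measurableT_comp => //; exact: measurable_funB. Qed.

Lemma lpnorm_shift p t F : measurable_fun setT F ->
  lpnorm p (fun x => F (x - t)) = lpnorm p F.
Proof.
move=> mF; rewrite !lpnormE; congr (_ `^ _)%E.
by rewrite (integral_shift t (measurable_normpow p mF)).
Qed.

Lemma lpnorm_le_fin p F (C : R) : 1 <= p -> 0 <= C ->
  (\int[mu]_x (`|F x| `^ p)%:E <= (C `^ p)%:E)%E -> (lpnorm p F <= C%:E)%E.
Proof.
move=> p1 C0 H; have p0 : 0 < p by apply: lt_le_trans p1.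
rewrite lpnormE; have -> : C%:E = ((C `^ p)%:E `^ p^-1)%E.
  by rewrite poweR_EFin -powRrM mulfV ?gt_eqF // powRr1.
apply: gt0_ler_poweR => //; first by rewrite invr_ge0 ltW.
- by rewrite in_itv /= leey andbT integral_ge0.
- by rewrite in_itv /= leey andbT lee_fin powR_ge0.
Qed.

Lemma lpnorm_fin_integral p F : 0 < p -> (lpnorm p F < +oo)%E ->
  (\int[mu]_x (`|F x| `^ p)%:E < +oo)%E.
Proof. by move=> p0; rewrite lpnormE; apply: lty_poweRy; rewrite invr_eq0 gt_eqF. Qed.

(* Interpolation between the supremum and the integral; the bound is uniform
   over exponents in [1 + 1/k, k]. *)
Lemma lpnorm_interp k p F (a b e : R) : (0 < k)%N -> 1 + k%:R^-1 <= p <= k%:R ->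
  measurable_fun setT F -> (forall x, `|F x| <= a) -> (\int[mu]_x `|F x|%:E <= b%:E)%E ->
  0 <= e <= 1 -> 0 <= b -> a <= 1 -> a * b ^+ k <= e ^+ (k * k) -> (lpnorm p F <= e%:E)%E.
Proof.
move=> k0 /andP[p1 pk] mF Fa Fb /andP[e0 e1] b0 a1 ab.
have kp : 0 < k%:R :> R by rewrite ltr0n.
have ik : 0 < k%:R^-1 :> R by rewrite invr_gt0.
have a0 : 0 <= a by apply: le_trans (Fa 0).
have p0 : 0 < p by apply: lt_le_trans p1; rewrite ltr_pwDl.
apply: lpnorm_le_fin => //; first by apply: le_trans p1; rewrite lerDl ltW.
(* |F|^(p - 1) <= a^(1/k), as |F| <= a <= 1 and p - 1 >= 1/k. *)
apply: (@le_trans _ _ ((a `^ (k%:R^-1))%:E * \int[mu]_x `|F x|%:E)%E).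
  rewrite -ge0_integralZl_EFin ?powR_ge0 //; last first.
    by apply/measurable_EFinP; exact: measurableT_comp.
  apply: ge0_le_integral => //; first exact: measurable_normpow.
    by apply/measurable_EFinP; apply: measurable_funM => //; exact: measurableT_comp.
  move=> x _; rewrite lee_fin.
  have [->|F0] := eqVneq (F x) 0; first by rewrite normr0 powR0 ?gt_eqF // mulr0.
  have Fp : 0 < `|F x| by rewrite normr_gt0.
  have -> : p = (p - 1) + 1 by ring.
  rewrite powRD ?(gt_eqF Fp) ?implybT // powRr1 // ler_wpM2r //.
  apply: (@le_trans _ _ (`|F x| `^ (k%:R^-1))).
    by apply: ger_powR; [rewrite Fp (le_trans (Fa x)) | rewrite lerBrDl].
  apply: ge0_ler_powR => //; rewrite ?nnegrE //; exact: ltW.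
apply: (@le_trans _ _ ((a `^ (k%:R^-1)) * b)%:E).
  by rewrite EFinM lee_wpmul2l // lee_fin powR_ge0.
(* The k-th power of the left side is a b^k <= e^(k k), and e^k <= e^p because p <= k and e <= 1. *)
rewrite lee_fin; apply: (@le_trans _ _ (e ^+ k)).
  rewrite -(@ler_pXn2r _ k) ?nnegrE ?exprn_ge0 ?mulr_ge0 ?powR_ge0 //.
  rewrite exprMn -exprM.
  have -> : (a `^ k%:R^-1) ^+ k = a; last by [].
  by rewrite -powR_mulrn ?powR_ge0 // -powRrM mulVf ?gt_eqF // powRr1.
have [->|e0'] := eqVneq e 0; first by rewrite expr0n gtn_eqF // powR_ge0.
by rewrite -powR_mulrn //; apply: ger_powR => //; rewrite lt0r e0' e0.
Qed.

End Seminorm.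

Lemma powR_cvg (R : realType) (p : R) (u : nat -> R) (l : R) : 0 < p -> (forall n, 0 <= u n) ->
  u n @[n --> \oo] --> l -> u n `^ p @[n --> \oo] --> l `^ p.
Proof.
move=> p0 u0 ul; have l0 : 0 <= l.
  move/cvg_lim : (ul) => <- //; apply: limr_ge; last exact: nearW.
  by apply/cvg_ex; exists l.
have [lp|] := ltP 0 l.
  have c : {for l, continuous (fun y : R => y `^ p)}.
    apply: differentiable_continuous; apply/derivable1_diffP.
    by apply: derivable_powR; rewrite in_itv /= lp.
  exact: (cvg_comp _ _ ul c).
move=> l0'; have {l0 l0'} l0 : l = 0 by apply/eqP; rewrite eq_le l0 l0'.
rewrite l0 powR0 ?gt_eqF // in ul *.
apply/cvgrPdist_lt => e e0; move/cvgrPdist_lt : ul => /(_ (e `^ p^-1)).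
rewrite powR_gt0 // => /(_ isT); apply: filterS => n.
rewrite !sub0r !normrN !ger0_norm ?powR_ge0 // => H.
have -> : e = (e `^ p^-1) `^ p by rewrite -powRrM mulVf ?gt_eqF // powRr1 // ltW.
by apply: gt0_ltr_powR => //; rewrite nnegrE // powR_ge0.
Qed.

(** * Dominated and monotone limits in the seminorm *)

Section Limits.
Variable R : realType.
Local Notation mu := (@lebesgue_measure R).

Lemma lpnorm_dominated p (F : nat -> R -> R) (G H : R -> R) : 1 <= p ->
  (forall n, measurable_fun [set: R] (F n)) -> measurable_fun [set: R] G ->
  measurable_fun [set: R] H ->
  (forall x, F n x @[n --> \oo] --> G x) -> (forall n x, `|F n x| <= H x) ->
  (lpnorm p H < +oo)%E ->
  forall e : R, 0 < e -> exists n, (lpnorm p (fun x => G x - F n x)%R < e%:E)%E.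
Proof.
move=> p1 mF mG mH FG FH Hp e e0; have p0 : 0 < p by apply: lt_le_trans p1.
have GH x : `|G x| <= H x.
  have : `|F n x| @[n --> \oo] --> `|G x| by apply: cvg_norm; exact: FG.
  move=> /cvg_lim <- //; apply: limr_le; last by near=> n; exact: FH.
  by apply: is_cvg_norm; apply/cvg_ex; exists (G x); exact: FG.
pose D n x := (`|G x - F n x| `^ p)%:E.
pose K x := (`|2 * H x| `^ p)%:E.
have mD n : measurable_fun [set: R] (D n) by apply: measurable_normpow; exact: measurable_funB.
have mK : measurable_fun [set: R] K by apply: measurable_normpow; exact: measurable_funM.
have iK : mu.-integrable setT K.
  apply/integrableP; split => //.
  under eq_integral do rewrite gee0_abs ?lee_fin ?powR_ge0 //.
  apply: lpnorm_fin_integral => //; rewrite lpnormZ //.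
  by rewrite lte_mul_pinfty // ?lee_fin.
have [] := @dominated_convergence _ _ _ mu setT measurableT D (cst 0%E) K mD (measurable_cst _).
- apply: aeW => x _; apply: cvg_EFin; first by apply: nearW.
  rewrite /D /= -[0](powR0 (lt0r_neq0 p0)); apply: powR_cvg => //.
  rewrite -(normr0 R) -(subrr (G x)); apply: cvg_norm; apply: cvgB; first exact: cvg_cst.
  exact: FG.
- exact: iK.
- apply: aeW => x n _; rewrite gee0_abs ?lee_fin ?powR_ge0 //.
  apply: (ge0_ler_powR (ltW p0)); rewrite ?nnegrE //.
  apply: le_trans (ler_normB _ _) _; apply: (le_trans _ (ler_norm _)).
  by have := GH x; have := FH n x; lra.
move=> _ cD _.
have ep : 0 < e `^ p by rewrite powR_gt0.
move: cD => /fine_cvgP[fD /cvgrPdist_lt /(_ _ ep) cD].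
near \oo => n; exists n.
have E : (\int[mu]_x `|D n x - cst 0 x| = \int[mu]_x D n x)%E.
  by apply: eq_integral => x _; rewrite sube0 gee0_abs // lee_fin powR_ge0.
have : (\int[mu]_x D n x)%E \is a fin_num by rewrite -E; near: n.
have : `|0 - fine (\int[mu]_x D n x)%E| < e `^ p by rewrite -E; near: n.
rewrite sub0r normrN => H1 /fineK H2.
rewrite lpnormE -H2 poweR_EFin lte_fin.
have -> : e = (e `^ p) `^ p^-1 by rewrite -powRrM mulfV ?gt_eqF // powRr1 // ltW.
have I0 : (0 <= \int[mu]_x D n x)%E by apply: integral_ge0 => x _; rewrite lee_fin powR_ge0.
apply: gt0_ltr_powR; rewrite ?nnegrE ?invr_gt0 ?fine_ge0 ?powR_ge0 //.
exact: le_lt_trans (ler_norm _) H1.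
Unshelve. all: by end_near. Qed.

Lemma lpnorm_monotone p (F : nat -> R -> R) (G : R -> R) (C : R) : 1 <= p -> 0 <= C ->
  (forall n, measurable_fun [set: R] (F n)) ->
  (forall n x, 0 <= F n x) -> (forall x, {homo F ^~ x : n m / (n <= m)%N >-> n <= m}) ->
  (forall x, F n x @[n --> \oo] --> G x) ->
  (forall n, (lpnorm p (F n) <= C%:E)%E) -> (lpnorm p G <= C%:E)%E.
Proof.
move=> p1 C0 mF F0 Fm FG FC; have p0 : 0 < p by apply: lt_le_trans p1.
have FpG x : `|F n x| `^ p @[n --> \oo] --> `|G x| `^ p.
  by apply: powR_cvg => //; apply: cvg_norm; exact: FG.
apply: lpnorm_le_fin => //.
pose D n x := (`|F n x| `^ p)%:E.
have mD n : measurable_fun [set: R] (D n) by apply: measurable_normpow.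
have D0 n x : setT x -> (0 <= D n x)%E by rewrite lee_fin powR_ge0.
have Dm x : setT x -> {homo D ^~ x : n m / (n <= m)%N >-> (n <= m)%E}.
  move=> _ n m nm; rewrite lee_fin; apply: (ge0_ler_powR (ltW p0)); rewrite ?nnegrE //.
  by rewrite !ger0_norm //; apply: Fm.
have := @cvg_monotone_convergence _ _ _ mu setT measurableT D mD D0 Dm.
have -> : (fun x => limn (D ^~ x)) = (fun x => (`|G x| `^ p)%:E).
  apply/funext => x; apply: cvg_lim => //; apply: cvg_EFin; last exact: FpG.
  exact: nearW.
move=> H; move/cvg_lim : (H) => <- //; apply: lime_le; first by apply/cvg_ex; eexists; exact: H.
apply: nearW => n; have := FC n; rewrite lpnormE => Hn.
have I0 : (0 <= \int[mu]_x D n x)%E by apply: integral_ge0 => x _; exact: D0.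
rewrite -[leLHS](poweRe1 I0) -(mulVf (lt0r_neq0 p0)) poweRrM -poweR_EFin.
apply: gt0_ler_poweR => //; first exact: ltW.
- by rewrite in_itv /= leey andbT poweR_ge0.
- by rewrite in_itv /= leey andbT lee_fin.
Qed.

End Limits.

(** * The common majorant 1 / (1 + x^2) *)

Section Envelope.
Variable R : realType.
Local Notation mu := (@lebesgue_measure R).

(** The Cauchy density up to the factor pi. It dominates polynomials times Gaussians up to
    constants, it is integrable, and its translates along a progression of step at least 1 have a
    bounded sum. *)
Definition envelope (x : R) : R := (1 + x ^+ 2)^-1.

Lemma one_add_sqr_gt0 (x : R) : 0 < 1 + x ^+ 2.
Proof. by rewrite ltr_pwDl // sqr_ge0. Qed.

Lemma envelope_gt0 x : 0 < envelope x.
Proof. by rewrite invr_gt0 one_add_sqr_gt0. Qed.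

Lemma envelope_ge0 x : 0 <= envelope x.
Proof. exact/ltW/envelope_gt0. Qed.

Lemma envelope_le1 x : envelope x <= 1.
Proof. by rewrite /envelope invf_le1 ?one_add_sqr_gt0 // lerDl sqr_ge0. Qed.

Lemma continuous_envelope : continuous envelope.
Proof. exact: continuous_oneDsqrV. Qed.

Lemma measurable_envelope : measurable_fun [set: R] envelope.
Proof. by apply: continuous_measurable_fun; exact: continuous_envelope. Qed.

Lemma integral_envelope : (\int[mu]_x (envelope x)%:E = pi%:E)%E.
Proof.
have even : envelope =1 envelope \o -%R by move=> x; rewrite /envelope /= sqrrN.
rewrite (ge0_symfun_integralT envelope_ge0 continuous_envelope even).
have -> : [set x : R | 0 <= x] = `[0, +oo[%classic.
  by apply/seteqP; split => x /=; rewrite in_itv /= andbT.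
have := integral0y_oneDsqr R; rewrite /oneDsqr => ->.
by rewrite -EFinM; congr (_%:E); field.
Qed.

(* The increments of the bounded increasing function [t / (1 + |t|)] dominate
   [envelope t / 4], so sums over 1-separated points telescope. *)
Lemma sum_envelope_le8 (N n : nat) (x : R) : (0 < N)%N ->
  \sum_(i < n) envelope (x - (i * N)%:R) <= 8.
Proof.
move=> N0; pose phi (t : R) := t / (1 + `|t|).
have np (t : R) : 0 < 1 + `|t| :> R by rewrite ltr_pwDl.
have phi1 t : `|phi t| <= 1.
  by rewrite normrM normfV (ger0_norm (ltW (np t))) ler_pdivrMr // mul1r; lra.
have phiE t : phi t = if 0 <= t then 1 - (1 + t)^-1 else (1 - t)^-1 - 1.
  rewrite /phi; case: ifPn => [t0|]; first by rewrite ger0_norm //; field; lra.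
  by rewrite -ltNge => t0; rewrite ltr0_norm //; field; lra.
have phi_mono s t : s <= t -> phi s <= phi t.
  move=> st; rewrite !phiE; case: ifPn => s0; case: ifPn => t0.
  - by rewrite lerD2l lerN2 lef_pV2 ?posrE; lra.
  - by move: t0; rewrite -ltNge; lra.
  - move: s0; rewrite -ltNge => s0.
    have : (1 - s)^-1 <= 1 by rewrite invf_le1; lra.
    have : (1 + t)^-1 <= 1 by rewrite invf_le1; lra.
    lra.
  - move: s0 t0; rewrite -!ltNge => s0 t0.
    by rewrite lerD2r lef_pV2 ?posrE; lra.
have key t : envelope t <= 4 * (phi (t + 1) - phi t).
  have e0 := one_add_sqr_gt0 t; rewrite /envelope -[leLHS]mul1r ler_pdivrMr //.
  rewrite !phiE; case: ifPn => t1; case: ifPn => t0.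
  - have -> : 1 - (1 + (t + 1))^-1 - (1 - (1 + t)^-1) = ((1 + t) * (2 + t))^-1.
      by field; lra.
    have d0 : 0 < (1 + t) * (2 + t) by rewrite mulr_gt0; lra.
    by rewrite mulrAC ler_pdivlMr // mul1r; have := sqr_ge0 (t - 2^-1); lra.
  - move: t0; rewrite -ltNge => t0.
    have -> : 1 - (1 + (t + 1))^-1 - ((1 - t)^-1 - 1) = 2 - (2 + t)^-1 - (1 - t)^-1.
      have -> : 1 + (t + 1) = 2 + t by ring.
      by ring.
    have h1 : (2 + t)^-1 <= 1 - 2^-1 * (t + 1).
      rewrite -[leLHS]mul1r ler_pdivrMr; nra.
    have h2 : (1 - t)^-1 <= 1 + 2^-1 * t.
      rewrite -[leLHS]mul1r ler_pdivrMr; nra.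
    nra.
  - by move: t1; rewrite -ltNge; lra.
  - move: t0 t1; rewrite -!ltNge => t0 t1.
    have -> : (1 - (t + 1))^-1 - 1 - ((1 - t)^-1 - 1) = ((1 - t) * (- t))^-1.
      by field; lra.
    have d0 : 0 < (1 - t) * (- t) by rewrite mulr_gt0; lra.
    by rewrite mulrAC ler_pdivlMr // mul1r; nra.
have : \sum_(i < n) envelope (x - (i * N)%:R) <= 4 * (phi (x + N%:R) - phi (x + N%:R - (n * N)%:R)).
  elim: n => [|n IH]; first by rewrite big_ord0 mul0n subr0 subrr mulr0.
  rewrite big_ord_recr /=; have K1 := key (x - (n * N)%:R).
  have M1 : phi (x - (n * N)%:R + 1) <= phi (x + N%:R - (n * N)%:R).
    apply: phi_mono; rewrite addrAC lerD2r lerD2l -[1]/(1%:R) ler_nat.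
    exact: N0.
  have -> : x + N%:R - (n.+1 * N)%:R = x - (n * N)%:R by rewrite mulSn natrD; ring.
  lra.
move/le_trans; apply.
have := phi1 (x + N%:R); have := phi1 (x + N%:R - (n * N)%:R).
by rewrite !ler_norml => /andP[? ?] /andP[? ?]; lra.
Qed.

End Envelope.

(** * Polynomials acting by convolution with unit translates *)

Section Action.
Variable R : realType.
Local Notation mu := (@lebesgue_measure R).
Local Notation envelope := (@envelope R).
Implicit Types (f g : {poly R}) (h : R -> R).

Definition act f h (x : R) : R := \sum_(i < size f) f`_i * h (x - i%:R).

Lemma act_wide f n h x : (size f <= n)%N -> act f h x = \sum_(i < n) f`_i * h (x - i%:R).
Proof.
move=> sfn; rewrite /act (big_ord_widen n (fun i => f`_i * h (x - i%:R))) //.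
rewrite [RHS](bigID (fun i : 'I_n => (i < size f)%N)) /= [X in _ + X]big1 ?addr0 //.
by move=> i; rewrite -leqNgt => ?; rewrite nth_default ?mul0r.
Qed.

Lemma actD f g h x : act (f + g) h x = act f h x + act g h x.
Proof.
set n := maxn (size f) (size g).
rewrite (@act_wide f n) ?leq_maxl // (@act_wide g n) ?leq_maxr //.
rewrite (@act_wide (f + g) n) ?size_polyD // -big_split /=.
by apply: eq_bigr => i _; rewrite coefD mulrDl.
Qed.

Lemma actZ c f h x : act (c *: f) h x = c * act f h x.
Proof.
rewrite (@act_wide _ (size f)) ?size_scale_leq // mulr_sumr.
by apply: eq_bigr => i _; rewrite coefZ mulrA.
Qed.

Lemma act0 h x : act 0 h x = 0.
Proof. by rewrite /act size_poly0 big_ord0. Qed.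

Lemma actN f h x : act (- f) h x = - act f h x.
Proof. by rewrite -scaleN1r actZ mulN1r. Qed.

Lemma actB f g h x : act (f - g) h x = act f h x - act g h x.
Proof. by rewrite actD actN. Qed.

Lemma act_sum n (F : 'I_n -> {poly R}) h x :
  act (\sum_(i < n) F i) h x = \sum_(i < n) act (F i) h x.
Proof.
elim: n F => [|n IH] F; first by rewrite !big_ord0 act0.
by rewrite !big_ord_recl actD IH.
Qed.

Lemma actMX f h x : act ('X * f) h x = act f h (x - 1).
Proof.
rewrite (@act_wide _ (size f).+1); last first.
  by apply: leq_trans (size_polyMleq _ _) _; rewrite size_polyX.
rewrite big_ord_recl coefXM eqxx mul0r add0r; apply: eq_bigr => i _.
by rewrite coefXM /= /bump leq0n add1n -natr1; congr (_ * h _); ring.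
Qed.

Lemma actMXn n f h x : act ('X^n * f) h x = act f h (x - n%:R).
Proof.
elim: n x => [|n IH] x; first by rewrite expr0 mul1r subr0.
by rewrite exprS -mulrA actMX IH -natr1; congr (act _ _ _); ring.
Qed.

Lemma act1 h x : act 1 h x = h x.
Proof. by rewrite (@act_wide _ 1) ?size_poly1 // big_ord1 coef1 mul1r subr0. Qed.

Lemma actXn n h x : act 'X^n h x = h (x - n%:R).
Proof. by rewrite -['X^n]mulr1 actMXn act1. Qed.

Lemma actM f g h x : act (f * g) h x = act f (act g h) x.
Proof.
rewrite -[X in X * g]coefK poly_def mulr_suml act_sum.
by apply: eq_bigr => i _; rewrite -scalerAl actZ actMXn.
Qed.

Lemma act_comp f N h x :
  act (f \Po 'X^N) h x = \sum_(i < size f) f`_i * h (x - (i * N)%:R).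
Proof.
rewrite comp_polyE act_sum; apply: eq_bigr => i _.
by rewrite actZ -exprM actXn mulnC.
Qed.

Lemma act_linear f (a b : R) h1 h2 x :
  act f (fun y => a * h1 y + b * h2 y) x = a * act f h1 x + b * act f h2 x.
Proof.
by rewrite /act !mulr_sumr -big_split /=; apply: eq_bigr => i _; ring.
Qed.

Lemma act_shift f h t x : act f (fun y => h (y - t)) x = act f h (x - t).
Proof. by apply: eq_bigr => i _; congr (_ * h _); ring. Qed.

Lemma measurable_act f h : measurable_fun [set: R] h -> measurable_fun [set: R] (act f h).
Proof.
move=> mh; apply: measurable_sum => i; apply: measurable_funM => //.
exact: measurable_shift.
Qed.

Lemma lpnorm_act p f h : 1 <= p -> measurable_fun [set: R] h ->
  (lpnorm p (act f h) <= (norm1 f)%:E * lpnorm p h)%E.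
Proof.
move=> p1 mh; have p0 : 0 < p by apply: lt_le_trans p1.
have ms i : measurable_fun [set: R] (fun x : R => h (x - i%:R)) by exact: measurable_shift.
apply: le_trans (lpnorm_sum (F := fun i x => f`_i * h (x - i%:R)) p1 _) _.
  by move=> i; apply: measurable_funM.
rewrite /norm1 -sumEFin ge0_sume_distrl; last by move=> i _; rewrite lee_fin.
by apply: lee_sum => i _; rewrite lpnormZ // lpnorm_shift.
Qed.

Lemma norm1_comp f N : norm1 (f \Po 'X^N) <= norm1 f.
Proof.
rewrite comp_polyE; apply: le_trans (norm1_sum _ _ _) _.
by apply: ler_sum => i _; rewrite norm1Z -exprM norm1Xn mulr1.
Qed.

Lemma norm1_comp_mul f g N : norm1 ((f \Po 'X^N) * g) <= norm1 f * norm1 g.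
Proof.
by apply: le_trans (norm1M _ _) _; rewrite ler_wpM2r ?norm1_ge0 // norm1_comp.
Qed.

Lemma act_le_norm1 f h (C x : R) : (forall y, `|h y| <= C) -> `|act f h x| <= norm1 f * C.
Proof.
move=> hC; apply: le_trans (ler_norm_sum _ _ _) _; rewrite mulr_suml.
by apply: ler_sum => i _; rewrite normrM ler_wpM2l.
Qed.

(** The bound is uniform in N: translates by multiples of N are 1-separated, which bounds the action
    of f on h by 8 c, and g then costs only its norm. *)
Lemma act_comp_le f g N h c x : (0 < N)%N -> coef_bounded f c ->
  (forall y, `|h y| <= envelope y) ->
  `|act ((f \Po 'X^N) * g) h x| <= norm1 g * (c * 8).
Proof.
move=> N0 fc hE; rewrite mulrC actM; apply: act_le_norm1 => y.
have c0 : 0 <= c by apply: le_trans (fc 0%N).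
rewrite act_comp; apply: le_trans (ler_norm_sum _ _ _) _.
apply: (@le_trans _ _ (\sum_(i < size f) c * envelope (y - (i * N)%:R))).
  by apply: ler_sum => i _; rewrite normrM ler_pM.
by rewrite -mulr_sumr ler_wpM2l // sum_envelope_le8.
Qed.

Lemma integral_act_le f h : measurable_fun [set: R] h -> (forall y, `|h y| <= envelope y) ->
  (\int[mu]_x `|act f h x|%:E <= (norm1 f * pi)%:E)%E.
Proof.
move=> mh hE.
have mE i : measurable_fun [set: R] (fun x => (`|f`_i| * envelope (x - i%:R))%:E).
  apply/measurable_EFinP; apply: measurable_funM => //.
  by apply: measurable_shift; exact: measurable_envelope.
apply: (@le_trans _ _ (\int[mu]_x \sum_(i < size f) (`|f`_i| * envelope (x - i%:R))%:E)%E).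
  apply: ge0_le_integral => //.
  - by apply/measurable_EFinP; apply: measurableT_comp => //; exact: measurable_act.
  - by apply: emeasurable_sum => i; exact: mE.
  - move=> x _; rewrite sumEFin lee_fin; apply: le_trans (ler_norm_sum _ _ _) _.
    by apply: ler_sum => i _; rewrite normrM ler_wpM2l.
rewrite ge0_integral_sum //; first last.
- by move=> i x _; rewrite lee_fin mulr_ge0 ?envelope_ge0.
- exact: mE.
rewrite /norm1 mulr_suml -sumEFin; apply: lee_sum => i _.
under eq_integral do rewrite EFinM.
have mS : measurable_fun [set: R] (fun x => (envelope (x - i%:R))%:E).
  by apply/measurable_EFinP; apply: measurable_shift; exact: measurable_envelope.
rewrite ge0_integralZl_EFin //; last by move=> x _; rewrite lee_fin envelope_ge0.
rewrite (integral_shift i%:R (f := fun x => (envelope x)%:E)); first last.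
- by move=> x; rewrite lee_fin envelope_ge0.
- by apply/measurable_EFinP; exact: measurable_envelope.
by rewrite integral_envelope EFinM.
Qed.

(** z depends on k, B and e only. So f may be chosen in terms of z, and N in terms of f. The two
    entries of the minimum serve the supremum and the hypothesis of [lpnorm_interp]. *)
Lemma peak_bounded_lpnorm k (B e : R) : (0 < k)%N -> 0 <= B -> 0 < e <= 1 ->
  exists2 z : R, 0 < z & forall f g N h, peak_bounded k z f -> norm1 g <= B -> (0 < N)%N ->
    measurable_fun [set: R] h -> (forall y, `|h y| <= envelope y) ->
    (forall x, `|act ((f \Po 'X^N) * g) h x| <= e) /\
    forall p, 1 + k%:R^-1 <= p <= k%:R -> (lpnorm p (act ((f \Po 'X^N) * g) h) <= e%:E)%E.
Proof.
move=> k0 B0 /andP[e0 e1]; pose u := B * 8; pose w := u * (B * pi) ^+ k.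
have u0 : 0 <= u by rewrite mulr_ge0.
have w0 : 0 <= w by rewrite mulr_ge0 // exprn_ge0 // mulr_ge0 // pi_ge0.
have ek : 0 < e ^+ (k * k) by rewrite exprn_gt0.
have u1 : 0 < u + 1 by rewrite ltr_wpDl.
have w1 : 0 < w + 1 by rewrite ltr_wpDl.
pose z := Num.min (e / (u + 1)) (e ^+ (k * k) / (w + 1)).
have z0 : 0 < z by rewrite lt_min !divr_gt0.
have zu : u * z <= e.
  apply: (@le_trans _ _ (u * (e / (u + 1)))); first by rewrite ler_wpM2l // ge_min lexx.
  by rewrite mulrA ler_pdivrMr // mulrC ler_wpM2l ?(ltW e0) // lerDl.
have zw : w * z <= e ^+ (k * k).
  apply: (@le_trans _ _ (w * (e ^+ (k * k) / (w + 1)))).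
    by rewrite ler_wpM2l // ge_min lexx orbT.
  by rewrite mulrA ler_pdivrMr // mulrC ler_wpM2l ?(ltW ek) // lerDl.
exists z => // f g N h [c [b [fc fb cz cbz]]] gB N0 mh hE.
have c0 : 0 <= c by apply: le_trans (fc 0%N).
have b0 : 0 <= b by apply: le_trans fb; exact: norm1_ge0.
have sup x : `|act ((f \Po 'X^N) * g) h x| <= u * c.
  apply: le_trans (act_comp_le _ _ N0 fc hE) _.
  by rewrite /u -mulrA [8 * c]mulrC ler_wpM2r // mulr_ge0.
have uc : u * c <= e by apply: le_trans zu; rewrite ler_wpM2l.
split=> [x|p pk]; first exact: le_trans uc.
apply: (lpnorm_interp (a := u * c) (b := b * B * pi)) k0 pk _ sup _ _ _ _ _.
- exact: measurable_act.
- apply: le_trans (integral_act_le _ mh hE) _; rewrite lee_fin ler_wpM2r ?pi_ge0 //.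
  apply: le_trans (norm1_comp_mul _ _ _) _.
  by apply: ler_pM => //; exact: norm1_ge0.
- by rewrite e1 ltW.
- by rewrite mulr_ge0 ?pi_ge0 // mulr_ge0.
- exact: le_trans e1.
- have -> : u * c * (b * B * pi) ^+ k = w * (c * b ^+ k).
    rewrite /w -[b * B * pi]mulrA (exprMn _ b).
    by move: (b ^+ k) ((B * pi) ^+ k) => y1 y2; ring.
  by apply: le_trans zw; rewrite ler_wpM2l.
Qed.

End Action.

(** * Multiples of a given polynomial close to a power of X *)

Section ApproximateInverse.
Local Open Scope complex_scope.
Variable R : realType.
Local Notation envelope := (@envelope R).
Local Notation C := R[i].
Implicit Types (F G : {poly C}) (z : C).

Definition modulus z : R := complex.Re `|z|.

Lemma modulusE z : `|z| = (modulus z)%:C.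
Proof. by rewrite /modulus RRe_real // normr_real. Qed.

Lemma modulus_ge0 z : 0 <= modulus z.
Proof. by rewrite -ler0c -modulusE. Qed.

Lemma modulusD z1 z2 : modulus (z1 + z2) <= modulus z1 + modulus z2.
Proof. by rewrite -lecR rmorphD /= -!modulusE ler_normD. Qed.

Lemma modulusN z : modulus (- z) = modulus z.
Proof. by rewrite /modulus normrN. Qed.

Lemma modulusR (x : R) : modulus x%:C = `|x|.
Proof.
rewrite /modulus normc_def /= expr0n addr0 sqrtr_sqr //.
Qed.

Lemma modulusX z n : modulus (z ^+ n) = modulus z ^+ n.
Proof. by apply: complexI; rewrite rmorphXn /= -!modulusE normrX. Qed.

Lemma Re_le_modulus z : `|complex.Re z| <= modulus z.
Proof. by rewrite -lecR -modulusE normc_ge_Re. Qed.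

Lemma modulus0 : modulus 0 = 0.
Proof. by rewrite /modulus normr0. Qed.

Definition modulus_poly F : {poly R} := \poly_(i < size F) modulus F`_i.

Lemma coef_modulus_poly F i : (modulus_poly F)`_i = modulus F`_i.
Proof.
rewrite coef_poly; case: ltnP => // Fi.
by rewrite nth_default // modulus0.
Qed.

Lemma size_modulus_poly F : (size (modulus_poly F) <= size F)%N.
Proof. exact: size_poly. Qed.

Lemma norm1_modulus_poly F : (norm1 (modulus_poly F))%:C = norm1 F.
Proof.
rewrite (norm1_wide (size_modulus_poly F)) rmorph_sum /=; apply: eq_bigr => i _.
by rewrite coef_modulus_poly ger0_norm ?modulus_ge0 // modulusE.
Qed.

Lemma le_act (f g : {poly R}) x : (forall i, `|f`_i| <= g`_i) ->
  `|act f envelope x| <= act g envelope x.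
Proof.
move=> fg; set n := maxn (size f) (size g).
rewrite (@act_wide _ f n) ?leq_maxl // (@act_wide _ g n) ?leq_maxr //.
apply: le_trans (ler_norm_sum _ _ _) _; apply: ler_sum => i _.
by rewrite normrM (ger0_norm (envelope_ge0 _)) ler_wpM2r ?envelope_ge0.
Qed.

Lemma le_lpnorm_act p (f g : {poly R}) : 0 <= p -> (forall i, `|f`_i| <= g`_i) ->
  (lpnorm p (act f envelope) <= lpnorm p (act g envelope))%E.
Proof.
move=> p0 fg; have mE := @measurable_envelope R.
by apply: le_lpnorm => // [||x]; [exact: measurable_act|exact: measurable_act|exact: le_act].
Qed.

Variable k : nat.
Hypothesis k0 : (0 < k)%N.

Let p_ge1 p : 1 + k%:R^-1 <= p -> 1 <= p :> R.
Proof. by apply: le_trans; rewrite lerDl invr_ge0 ler0n. Qed.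

(** Taking moduli of the coefficients makes the bound valid for every function under the envelope,
    and monotone in the coefficients. *)
Definition lp_small F (e : R) := forall p, 1 + k%:R^-1 <= p <= k%:R ->
  (lpnorm p (act (modulus_poly F) envelope) <= e%:E)%E.

Lemma lp_smallD F G a b : lp_small F a -> lp_small G b -> lp_small (F + G) (a + b).
Proof.
move=> Fa Gb p pk; have /andP[/p_ge1 p1 _] := pk.
have mE := @measurable_envelope R.
apply: (@le_trans _ _ (lpnorm p (act (modulus_poly F + modulus_poly G) envelope))).
  apply: le_lpnorm_act; first exact: le_trans p1.
  move=> i; rewrite coefD !coef_modulus_poly ger0_norm ?modulus_ge0 // coefD.
  exact: modulusD.
have -> : act (modulus_poly F + modulus_poly G) envelope =
   (fun x => act (modulus_poly F) envelope x + act (modulus_poly G) envelope x).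
  by apply/funext => x; rewrite actD.
apply: le_trans (lpnormD p1 (measurable_act _ mE) (measurable_act _ mE)) _.
by rewrite EFinD leeD // ?Fa ?Gb.
Qed.

Lemma lp_smallM F G a : lp_small F a -> lp_small (G * F) (norm1 (modulus_poly G) * a).
Proof.
move=> Fa p pk; have /andP[/p_ge1 p1 _] := pk.
have mE := @measurable_envelope R.
apply: (@le_trans _ _ (lpnorm p (act (modulus_poly G * modulus_poly F) envelope))).
  apply: le_lpnorm_act; first exact: le_trans p1.
  move=> i; rewrite coef_modulus_poly ger0_norm ?modulus_ge0 // !coefM.
  rewrite -lecR -modulusE rmorph_sum /=; apply: le_trans (ler_norm_sum _ _ _) _.
  by apply: ler_sum => j _; rewrite normrM !coef_modulus_poly rmorphM /= -!modulusE.
have -> : act (modulus_poly G * modulus_poly F) envelope =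
   act (modulus_poly G) (act (modulus_poly F) envelope).
  by apply/funext => x; rewrite actM.
apply: le_trans (lpnorm_act _ p1 (measurable_act _ mE)) _.
by rewrite EFinM lee_wpmul2l ?lee_fin ?norm1_ge0 // Fa.
Qed.

Lemma lp_small_le F a b : a <= b -> lp_small F a -> lp_small F b.
Proof. by move=> ab Fa p pk; apply: le_trans (Fa p pk) _; rewrite lee_fin. Qed.

Lemma peak_lp_small (e : R) : 0 < e <= 1 -> exists2 z : R, 0 < z &
  forall F, peak_bounded k z (modulus_poly F) -> lp_small F e.
Proof.
move=> e01; have [z z0 H] := peak_bounded_lpnorm k0 (ler01 : 0 <= (1 : R)) e01.
exists z => // F pF p pk.
have hE y : `|envelope y| <= envelope y by rewrite ger0_norm ?envelope_ge0.
have g1 : norm1 (1 : {poly R}) <= 1 by rewrite norm1_1.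
have [_] := H _ 1 1%N envelope pF g1 isT (@measurable_envelope R) hE.
by rewrite expr1 comp_polyXr mulr1; apply.
Qed.

(** If |a| < 1, then X - a divides X^d - a^d, and a^d is negligible; this is why a power of X is
    reached and not 1. If |a| >= 1, then X - a = - a (1 - X / a), and the Cesaro mean for w = 1 / a
    applies. *)
Lemma linear_approx_inverse (a : C) (e : R) : 0 < e <= 1 ->
  exists (c : {poly C}) (i : nat), lp_small (c * ('X - a%:P) - 'X^i) e.
Proof.
move=> e01; have [z z0 H] := peak_lp_small e01.
pose y := Num.min z 1; have y0 : 0 < y by rewrite lt_min z0 ltr01.
have yz : y <= z by rewrite ge_min lexx.
have y1 : y <= 1 by rewrite ge_min lexx orbT.
have up (f : {poly R}) : peak_bounded k y f -> peak_bounded k z f.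
  by move=> [c [b [h1 h2 h3 h4]]]; exists c, b; split => //; apply: le_trans yz.
have [a1|a1] := ltP (modulus a) 1.
  have [d Hd] : exists d, modulus a ^+ d <= y.
    have : modulus a ^+ d @[d --> \oo] --> 0.
      by apply: cvg_expr; rewrite ger0_norm ?modulus_ge0.
    move/cvgrPdist_lt => /(_ _ y0)[d _ /(_ d (leqnn d)) ad]; exists d.
    by move: ad; rewrite /= sub0r normrN ger0_norm ?exprn_ge0 ?modulus_ge0 // => /ltW.
  exists (\sum_(i < d) 'X^(d.-1 - i) * a%:P ^+ i), d; apply: H; apply: up.
  have -> : (\sum_(i < d) 'X^(d.-1 - i) * a%:P ^+ i) * ('X - a%:P) - 'X^d = - (a ^+ d)%:P.
    by rewrite mulrC -subrXX polyC_exp addrAC subrr sub0r.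
  apply: peak_bounded_norm1 => //.
  have : (norm1 (modulus_poly (- (a ^+ d)%:P)))%:C = (modulus a ^+ d)%:C.
    by rewrite norm1_modulus_poly norm1N norm1C modulusE modulusX.
  by move/complexI => ->.
have ma0 : 0 < modulus a by apply: lt_le_trans a1.
have a0 : a != 0 by apply/eqP => a0; rewrite a0 modulus0 ltxx in ma0.
have w1 : `|a^-1| <= 1.
  by rewrite normfV modulusE -fmorphV /= -[1]/(1%:C) lecR invf_le1.
pose d := (Num.Def.archi_bound (y^-1)).+1.
have dy : d%:R^-1 <= y.
  rewrite -[leRHS]invrK lef_pV2 ?posrE ?invr_gt0 ?ltr0n //.
  apply/ltW; apply: lt_le_trans (_ : (Num.Def.archi_bound (y^-1))%:R <= _).
    by apply: archi_boundP; rewrite invr_ge0 ltW.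
  by rewrite ler_nat.
exists (- a^-1 *: cesaro_inverse a^-1 d), 0%N; apply: H; apply: up.
have -> : - a^-1 *: cesaro_inverse a^-1 d * ('X - a%:P) - 'X^0 = - cesaro_error a^-1 d.
  rewrite expr0; have := cesaro_inverseE w1 (isT : 0 < d)%N => E.
  have -> : - cesaro_error a^-1 d = (1 - a^-1 *: 'X) * cesaro_inverse a^-1 d - 1.
    by rewrite E; ring.
  have -> : 1 - a^-1 *: 'X = - a^-1 *: ('X - a%:P).
    by rewrite scalerBr !scaleNr opprK -[a^-1 *: a%:P]mul_polyC -polyCM mulVf // addrC.
  by rewrite -!scalerAl [_ * ('X - _)]mulrC.
exists d%:R^-1, 1; split => //; last by rewrite expr1n mulr1.
  move=> i; rewrite coef_modulus_poly coefN modulusN ger0_norm ?modulus_ge0 //.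
  rewrite -lecR -modulusE; apply: le_trans (cesaro_error_coef d w1 i) _.
  by rewrite fmorphV /= rmorph_nat.
rewrite -lecR norm1_modulus_poly norm1N; exact: norm1_cesaro_error.
Qed.

Lemma split_approx_inverse (s : seq C) (e : R) : 0 < e <= 1 ->
  exists (c : {poly C}) (i : nat), lp_small (c * \prod_(a <- s) ('X - a%:P) - 'X^i) e.
Proof.
elim: s e => [|a s IH] e e01.
  exists 1, 0%N; rewrite big_nil mul1r expr0 subrr => p /andP[/p_ge1 p1 _].
  have -> : act (modulus_poly 0) envelope = (fun=> 0).
    by apply/funext => x; rewrite /modulus_poly size_poly0 poly_def big_ord0 act0.
  by rewrite lpnorm0 ?(lt_le_trans ltr01) // lee_fin ltW //; case/andP: e01.
have /andP[e0 e1] := e01.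
have h01 : 0 < e / 2 <= 1 by apply/andP; split; lra.
have [c [i H]] := IH _ h01.
set P := \prod_(a <- s) _ in H *; pose B := norm1 (modulus_poly (c * P)).
have B0 : 0 <= B := norm1_ge0 _.
(* c' is chosen after c, so its precision can absorb the norm of c P; the error of c is only
   translated by X^i'. *)
have d01 : 0 < e / 2 / (B + 1) <= 1.
  have B1 : 0 < B + 1 by lra.
  by rewrite divr_gt0 //=; [rewrite ler_pdivrMr // mul1r; lra|lra].
have [c' [i' H']] := linear_approx_inverse a d01.
exists (c' * c), (i' + i)%N; rewrite big_cons -/P.
have -> : c' * c * (('X - a%:P) * P) - 'X^(i' + i) =
    'X^i' * (c * P - 'X^i) + (c * P) * (c' * ('X - a%:P) - 'X^i').
  by rewrite exprD; ring.
have X1 : norm1 (modulus_poly 'X^i') = 1.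
  by apply: complexI; rewrite norm1_modulus_poly norm1Xn.
apply: lp_small_le (lp_smallD (lp_smallM _ H) (lp_smallM _ H')).
rewrite X1 mul1r -/B mulrA.
have : B * (e / 2) / (B + 1) <= e / 2.
  have B1 : 0 < B + 1 by lra.
  by rewrite ler_pdivrMr //; lra.
lra.
Qed.

(** Factor q over the complex numbers. As q and X^i are real, the real part of the complex
    multiplier does at least as well. *)
Lemma approx_inverse (q : {poly R}) (e : R) : q != 0 -> 0 < e <= 1 ->
  exists (c : {poly R}) (i : nat), forall p, 1 + k%:R^-1 <= p <= k%:R ->
    (lpnorm p (act (\poly_(j < size (c * q - 'X^i)) `|(c * q - 'X^i)`_j|)%R envelope) <= e%:E)%E.
Proof.
move=> q0 e01; pose Q := map_poly (real_complex R) q.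
have [s Qs] := closed_field_poly_normal Q.
have Q0 : lead_coef Q != 0 by rewrite lead_coef_eq0 map_poly_eq0.
have [c [i H]] := split_approx_inverse s e01.
pose c' := (lead_coef Q)^-1 *: c.
have cQ : c' * Q = c * \prod_(a <- s) ('X - a%:P).
  by rewrite {1}Qs /c' -scalerAl -scalerAr scalerA mulVf // scale1r.
pose r : {poly R} := \poly_(j < size c') complex.Re c'`_j.
exists r, i => p pk; apply: le_trans (H p pk); have /andP[/p_ge1 p1 _] := pk.
apply: le_lpnorm_act; first exact: le_trans p1.
move=> j; rewrite coef_modulus_poly coef_poly.
have E : (r * q - 'X^i)`_j = complex.Re (c * \prod_(a <- s) ('X - a%:P) - 'X^i)`_j.
  rewrite -cQ !coefB !coefM raddfB /=; congr (_ - _); last by rewrite !coefXn; case: eqP.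
  rewrite raddf_sum /=; apply: eq_bigr => l _; rewrite coef_map /= coef_poly.
  have -> : (if (j - l < size q)%N then (q`_(j - l))%:C else 0) = (q`_(j - l))%:C.
    by case: ltnP => // h; rewrite (nth_default 0 h).
  by case: (c'`_l) => x y /=; rewrite mulr0 subr0.
case: ifP => _; last by rewrite normr0 modulus_ge0.
by rewrite normr_id E; exact: Re_le_modulus.
Qed.

End ApproximateInverse.

(** * The generator *)

Section Steps.
Variable R : realType.
Variable alpha : nat -> R.
Hypothesis alpha_cvg0 : alpha n @[n --> \oo] --> (0 : R).
Local Notation envelope := (@envelope R).

(* [stage_bound] dominates the norms of the multipliers [W] and [c] attached to
   the previous steps; all later increments are small compared with it. *)
Record stage := Stage {stage_poly : {poly R}; stage_shift : nat; stage_bound : R}.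

Definition stage_inv s :=
  [/\ forall i, 0 <= (stage_poly s)`_i, stage_poly s != 0 & 1 <= stage_bound s].

Definition lp_le k (F : R -> R) (e : R) := forall p, 1 + k%:R^-1 <= p <= k%:R ->
  (lpnorm p F <= e%:E)%E.

Definition under_envelope (h : R -> R) :=
  measurable_fun [set: R] h /\ forall y, `|h y| <= envelope y.

(** [stage_shift] records the translation by X^(n N), to be undone later, so that a step only adds
    the contribution of v. The bound on [alpha j] starts k indices before N, to leave room for
    translates moved to the left by up to k. *)
Definition stage_step k s t := exists (n N : nat) (v W c : {poly R}) (i : nat),
  let q := stage_poly s in let e := 2^-1 ^+ k in
  [/\ stage_poly t = (('X^n + v) \Po 'X^N) * q, stage_shift t = (stage_shift s + n * N)%N,
      [/\ forall i, 0 <= v`_i, lp_le k (act ((v \Po 'X^N) * q) envelope) (e / stage_bound s)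
        & forall x, `|act ((v \Po 'X^N) * q) envelope x| <= e],
      [/\ W`_0 = 1, (k <= N)%N, forall j, (N <= j + k)%N -> norm1 W * `|alpha j| <= e
        & forall h, under_envelope h ->
            lp_le k (act (((W * ('X^n + v)) \Po 'X^N) * q) h) e]
    & [/\ stage_bound s <= stage_bound t, norm1 W <= stage_bound t,
          norm1 c <= stage_bound t
        & forall h, under_envelope h -> lp_le k (act (c * stage_poly t - 'X^i) h) e]].

Lemma coef_comp_ge0 (f : {poly R}) N : (forall i, 0 <= f`_i) ->
  forall i, 0 <= (f \Po 'X^N)`_i.
Proof.
move=> f0 i; rewrite comp_polyE coef_sum sumr_ge0 // => j _.
by rewrite coefZ -exprM coefXn mulr_ge0.
Qed.

Lemma coefM_ge0 (f g : {poly R}) : (forall i, 0 <= f`_i) -> (forall i, 0 <= g`_i) ->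
  forall i, 0 <= (f * g)`_i.
Proof. by move=> f0 g0 i; rewrite coefM sumr_ge0 // => j _; rewrite mulr_ge0. Qed.

(** The order of the choices matters: z from the current polynomial q, then v and W from z, then N
    from W and the decay of [alpha], then c from the new polynomial, and finally the new bound. *)
Lemma stage_next k s : (0 < k)%N -> stage_inv s -> exists t, stage_inv t /\ stage_step k s t.
Proof.
case: s => q O K k0 [/= q0 qn0 K1]; set e : R := 2^-1 ^+ k.
have e0 : 0 < e by rewrite exprn_gt0 // invr_gt0.
have e1 : e <= 1 by rewrite exprn_ile1 ?invr_ge0 // invf_le1 // ler1n.
have Kp : 0 < K by apply: lt_le_trans K1.
have B0 := norm1_ge0 q.
have eK : 0 < e / K <= 1.
  by rewrite divr_gt0 //= ler_pdivrMr // mul1r (le_trans e1).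
have eKe : e / K <= e by rewrite ler_pdivrMr // ler_peMr // ltW.
have e2 : 0 < e / 2 <= 1 by apply/andP; split; lra.
have [z1 z10 H1] := peak_bounded_lpnorm k0 B0 eK.
have [z2 z20 H2] := peak_bounded_lpnorm k0 B0 e2.
pose z := Num.min z1 z2; have z0 : 0 < z by rewrite lt_min z10 z20.
have pkm (f : {poly R}) y : z <= y -> peak_bounded k z f -> peak_bounded k y f.
  by move=> zy [c [b [h1 h2 h3 h4]]]; exists c, b; split => //; apply: le_trans zy.
have zz1 : z <= z1 by rewrite ge_min lexx.
have zz2 : z <= z2 by rewrite ge_min lexx orbT.
have [n [v [W [f1 [f2 [[v0 W0 WE] pv pf1 pf2]]]]]] := nearly_invariant k z0.
have [M HM] : exists M, forall j, (M <= j)%N -> norm1 W * `|alpha j| <= e.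
  have W1 : 0 < norm1 W + 1 by rewrite ltr_wpDl // norm1_ge0.
  have eW : 0 < e / (norm1 W + 1) by rewrite divr_gt0.
  move/cvgrPdist_lt : alpha_cvg0 => /(_ _ eW)[M _ HM]; exists M => j Mj.
  have := HM j Mj; rewrite /= sub0r normrN ltr_pdivlMr // => /ltW.
  by apply: le_trans; rewrite mulrC ler_wpM2l // lerDl.
pose N := (M + k)%N; pose q' := (('X^n + v) \Po 'X^N) * q.
have N0 : (0 < N)%N by rewrite addn_gt0 k0 orbT.
have s0 i : 0 <= ('X^n + v)`_i by rewrite coefD coefXn addr_ge0 // ler0n.
have sn0 : 'X^n + v != 0.
  apply/eqP => /(congr1 (fun f : {poly R} => f`_n)); rewrite coefD coefXn eqxx coef0.
  by apply/eqP; rewrite gt_eqF // ltr_pwDl.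
have q'0 i : 0 <= q'`_i by apply: coefM_ge0 => // j; exact: coef_comp_ge0.
have q'n0 : q' != 0.
  by rewrite mulf_neq0 // comp_poly_eq0 // size_polyXn.
have e01 : 0 < e <= 1 by rewrite e0.
have [c [i Hc]] := approx_inverse k0 q'n0 e01.
pose K' := K + norm1 W + norm1 c.
have E0 : under_envelope envelope.
  by split; [exact: measurable_envelope | move=> y; rewrite ger0_norm ?envelope_ge0].
exists (Stage q' (O + n * N) K'); split.
  split => //=; rewrite /K' -addrA; apply: le_trans K1 _.
  by rewrite lerDl addr_ge0 ?norm1_ge0.
have p1P p : 1 + k%:R^-1 <= p <= k%:R -> 1 <= p :> R.
  by case/andP => p1 _; apply: le_trans p1; rewrite lerDl invr_ge0 ler0n.
exists n, N, v, W, c, i; split => //=.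
- have [h1 h2] := H1 v q N envelope (pkm _ _ zz1 pv) (lexx _) N0 E0.1 E0.2.
  by split => // x; apply: le_trans (h1 x) eKe.
- split => //; first by rewrite /N leq_addl.
    by move=> j; rewrite /N leq_add2r; exact: HM.
  move=> h [mh hE] p pk; have p1 := p1P _ pk.
  have [_ h1] := H2 f1 q N h (pkm _ _ zz2 pf1) (lexx _) N0 mh hE.
  have [_ h2] := H2 f2 q N h (pkm _ _ zz2 pf2) (lexx _) N0 mh hE.
  rewrite WE comp_polyD mulrDl.
  have -> : act ((f1 \Po 'X^N) * q + (f2 \Po 'X^N) * q) h =
      (fun x => act ((f1 \Po 'X^N) * q) h x + act ((f2 \Po 'X^N) * q) h x).
    by apply/funext => x; rewrite actD.
  apply: le_trans (lpnormD p1 (measurable_act _ mh) (measurable_act _ mh)) _.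
  rewrite -/e; have -> : e = e / 2 + e / 2 by field.
  by rewrite EFinD leeD // ?h1 ?h2.
- rewrite /K'; have W0' := norm1_ge0 W; have c0' := norm1_ge0 c.
  split; [lra | lra | lra |] => h [mh hE] p pk; have p1 := p1P _ pk.
  apply: le_trans (Hc p pk); set f := c * q' - 'X^i.
  apply: le_lpnorm; first exact: le_trans p1.
  + exact: measurable_act.
  + by apply: measurable_act; exact: measurable_envelope.
  move=> x; rewrite (act_wide _ _ (size_poly _ _)); apply: le_trans (ler_norm_sum _ _ _) _.
  apply: ler_sum => j _; rewrite normrM coef_poly ltn_ord.
  by rewrite ler_wpM2l.
Qed.

Lemma stage_sequence : exists s : nat -> stage,
  [/\ stage_poly (s 0%N) = 1, stage_shift (s 0%N) = 0%N, forall k, stage_inv (s k)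
    & forall k, stage_step k.+1 (s k) (s k.+1)].
Proof.
(* Dependent choice asks for a successor of every pair; the implication makes the relation total,
   and the first component carries the step number. *)
pose rel (x y : nat * stage) := stage_inv x.2 ->
  [/\ y.1 = x.1.+1, stage_inv y.2 & stage_step x.1.+1 x.2 y.2].
have ex x : exists y, rel x y.
  have [xi|nxi] := pselect (stage_inv x.2); last by exists x => /nxi.
  by have [t [ti st]] := stage_next (ltn0Sn x.1) xi; exists (x.1.+1, t).
have [f [f0 fS]] := @dependent_choice _ rel (fun x => cid (ex x)) (0%N, Stage 1 0 1).
have inv k : (f k).1 = k /\ stage_inv (f k).2.
  elim: k => [|k [IH1 IH2]]; last by have [E1 E2 _] := fS k IH2; rewrite E1 IH1.
  rewrite f0; split => //; split => //=; last exact: oner_neq0.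
  by move=> i; rewrite coef1 ler0n.
exists (fun k => (f k).2); rewrite f0; split => // k.
  by have [] := inv k.
by have [E1 E2] := inv k; have [_ _] := fS k E2; rewrite E1.
Qed.

End Steps.

(** * The limit operator *)

Section Limit.
Variable R : realType.
Variable alpha : nat -> R.
Local Notation envelope := (@envelope R).

Lemma lpnorm_envelope p : 1 <= p -> (lpnorm p envelope < +oo)%E.
Proof.
move=> p1; have p0 : 0 < p by apply: lt_le_trans p1.
have mE := @measurable_envelope R.
rewrite lpnormE; apply: poweR_lty; apply: (@le_lt_trans _ _ (pi : R)%:E); last exact: ltry.
rewrite -integral_envelope; apply: ge0_le_integral => //.
- exact: measurable_normpow.
- exact/measurable_EFinP.
move=> x _; rewrite lee_fin ger0_norm ?envelope_ge0 //.
rewrite -[X in _ <= X]powRr1 ?envelope_ge0 //; apply: ger_powR => //.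
by rewrite envelope_gt0 envelope_le1.
Qed.

Definition dominated (h : R -> R) :=
  measurable_fun [set: R] h /\ exists C, forall x, `|h x| <= C * envelope x.

(** The interface through which completeness is proved, free of the stages. In
    [generator_annihilator], [kappa] is how far to the left a translate may have been moved. *)
Record generator (A : (R -> R) -> R -> R) : Prop := Generator {
  generator_measurable : forall h, dominated h -> measurable_fun [set: R] (A h);
  generator_linear : forall h1 h2 a b x, dominated h1 -> dominated h2 ->
    A (fun y => a * h1 y + b * h2 y) x = a * A h1 x + b * A h2 x;
  generator_shift : forall h t x, A (fun y => h (y - t)) x = A h (x - t);
  generator_ge0 : forall h x, dominated h -> (forall y, 0 <= h y) -> 0 <= A h x;
  generator_le : forall (h : R -> R) C x, measurable_fun [set: R] h ->
    (forall y, `|h y| <= C * envelope y) -> `|A h x| <= C * A envelope x;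
  generator_lpnorm : forall p, 1 < p -> (lpnorm p (A envelope) < +oo)%E;
  generator_annihilator : forall p h (kappa : nat) e, 1 < p -> dominated h -> 0 < e ->
    exists (W : {poly R}) (N : nat), [/\ W`_0 = 1, (kappa < N)%N,
      forall j, (N <= j + kappa.+1)%N -> norm1 W * `|alpha j| <= e
      & (lpnorm p (act (W \Po 'X^N) (A h)) <= e%:E)%E];
  generator_recover : forall p h e, 1 < p -> dominated h -> 0 < e ->
    exists (c : {poly R}) (O i : nat),
      (lpnorm p (fun x => h x - act c (A h) (x + i%:R - O%:R))%R <= e%:E)%E }.

Lemma dominated_le (h : R -> R) C : measurable_fun [set: R] h ->
  (forall x, `|h x| <= C * envelope x) -> dominated h.
Proof. by move=> mh hC; split => //; exists C. Qed.

Lemma dominated_envelope : dominated envelope.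
Proof.
apply: (@dominated_le _ 1); first exact: measurable_envelope.
by move=> x; rewrite mul1r ger0_norm ?envelope_ge0.
Qed.

Lemma dominated_pos h : dominated h ->
  exists2 C, 0 < C & forall x, `|h x| <= C * envelope x.
Proof.
case=> _ [C hC]; exists (`|C| + 1); first by rewrite ltr_wpDl.
move=> x; apply: le_trans (hC x) _; rewrite ler_wpM2r ?envelope_ge0 //.
by rewrite (le_trans (ler_norm C)) // lerDl.
Qed.

Lemma dominated_linear h1 h2 a b : dominated h1 -> dominated h2 ->
  dominated (fun y => a * h1 y + b * h2 y).
Proof.
move=> d1 d2; have [C1 C10 H1] := dominated_pos d1; have [C2 C20 H2] := dominated_pos d2.
apply: (@dominated_le _ (`|a| * C1 + `|b| * C2)).
  by apply: measurable_funD; apply: measurable_funM => //; [exact: d1.1|exact: d2.1].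
move=> x; apply: le_trans (ler_normD _ _) _; rewrite !normrM mulrDl -!mulrA.
by apply: lerD; rewrite ler_wpM2l.
Qed.

Variable s : nat -> stage R.
Hypothesis s0 : stage_poly (s 0%N) = 1.
Hypothesis O0 : stage_shift (s 0%N) = 0%N.
Hypothesis s_inv : forall k, stage_inv (s k).
Hypothesis s_step : forall k, stage_step alpha k.+1 (s k) (s k.+1).

Definition partial k h x := act (stage_poly (s k)) h (x + (stage_shift (s k))%:R).

Definition limit h x : R := limn (fun k => partial k h x).

Let bd k := stage_bound (s k).
Let bd1 k : 1 <= bd k. Proof. by have [_ _] := s_inv k. Qed.

Lemma partial_linear k h1 h2 a b x :
  partial k (fun y => a * h1 y + b * h2 y) x = a * partial k h1 x + b * partial k h2 x.
Proof. by rewrite /partial act_linear. Qed.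

Lemma partial_shift k h t x : partial k (fun y => h (y - t)) x = partial k h (x - t).
Proof. by rewrite /partial act_shift; congr act; ring. Qed.

Lemma measurable_partial k (h : R -> R) : measurable_fun [set: R] h ->
  measurable_fun [set: R] (partial k h).
Proof.
move=> mh; rewrite /partial; set t := _%:R.
have -> : (fun x => act (stage_poly (s k)) h (x + t)) =
  (fun x => act (stage_poly (s k)) h (x - - t)) by apply/funext => x; rewrite opprK.
by apply: measurable_shift; exact: measurable_act.
Qed.

Lemma partial_ge0 k h x : (forall y, 0 <= h y) -> 0 <= partial k h x.
Proof.
by move=> h0; have [q0 _ _] := s_inv k; apply: sumr_ge0 => i _; rewrite mulr_ge0.
Qed.

Lemma partial_le k h1 h2 x : (forall y, h1 y <= h2 y) -> partial k h1 x <= partial k h2 x.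
Proof.
by move=> h0; have [q0 _ _] := s_inv k; apply: ler_sum => i _; rewrite ler_wpM2l.
Qed.

Lemma increment k : exists r : {poly R}, [/\ forall i, 0 <= r`_i,
  lp_le k.+1 (act r envelope) (2^-1 ^+ k.+1 / bd k),
  forall x, act r envelope x <= 2^-1 ^+ k.+1
  & forall h x, partial k.+1 h x - partial k h x = act r h (x + (stage_shift (s k.+1))%:R)].
Proof.
have [n [N [v [W [c [i [qE OE [v0 D1 D2] _ _]]]]]]] := s_step k.
have [q0 _ _] := s_inv k.
exists ((v \Po 'X^N) * stage_poly (s k)); split => //.
- by apply: coefM_ge0 => // j; exact: coef_comp_ge0.
- by move=> x; apply: le_trans (D2 x); exact: ler_norm.
- move=> h x; rewrite /partial qE comp_polyD comp_Xn_poly -exprM mulrDl actD actMXn.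
  rewrite [X in X + _ - _](_ : _ = act (stage_poly (s k)) h (x + (stage_shift (s k))%:R)).
    by ring.
  by congr act; rewrite OE [(N * n)%N]mulnC natrD; ring.
Qed.

Lemma increment_ge0 k h x : (forall y, 0 <= h y) -> partial k h x <= partial k.+1 h x.
Proof.
move=> h0; have [r [r0 _ _ H]] := increment k.
by rewrite -subr_ge0 H; apply: sumr_ge0 => i _; rewrite mulr_ge0.
Qed.

Lemma partial_homo h x : (forall y, 0 <= h y) ->
  {homo (fun k => partial k h x) : n m / (n <= m)%N >-> n <= m}.
Proof.
by move=> h0; apply: homo_leq => [//|y u v|k]; [exact: le_trans|exact: increment_ge0].
Qed.

Lemma partial_envelope_bounded k x : partial k envelope x <= 2 - 2^-1 ^+ k.
Proof.
elim: k => [|k IH].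
  by rewrite /partial s0 O0 act1 addr0 expr0 (le_trans (envelope_le1 _)) //; lra.
have [r [_ _ H1 H]] := increment k.
rewrite -[partial _ _ _](subrK (partial k envelope x)) H.
apply: le_trans (lerD (H1 _) IH) _; rewrite exprS; lra.
Qed.

Lemma partial_bounded k C h x : (forall y, `|h y| <= C * envelope y) ->
  `|partial k h x| <= C * partial k envelope x.
Proof.
move=> hC; rewrite ler_norml.
have E a y : a * partial k envelope y = partial k (fun y => a * envelope y + 0 * 0) y.
  by rewrite (partial_linear k envelope (fun=> 0) a 0) mul0r addr0.
rewrite -mulNr !E; apply/andP; split; apply: partial_le => y; have := hC y;
  by rewrite ler_norml mul0r addr0 ?mulNr => /andP[].
Qed.

Lemma limit_envelope x : partial k envelope x @[k --> \oo] --> limit envelope x.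
Proof.
apply: nondecreasing_is_cvgn; first by apply: partial_homo; exact: envelope_ge0.
exists 2 => _ [k _ <-]; apply: le_trans (partial_envelope_bounded k x) _.
by rewrite gerBl exprn_ge0.
Qed.

(** h + C envelope is nonnegative, so its recentred convolutions increase and stay bounded at every
    point; subtract the convergent part coming from the envelope. *)
Lemma partial_cvg h x : dominated h -> partial k h x @[k --> \oo] --> limit h x.
Proof.
move=> /dominated_pos[C C0 hC].
have E k : partial k h x =
    partial k (fun y => 1 * h y + C * envelope y) x - C * partial k envelope x.
  by rewrite partial_linear; ring.
suff H : cvgn (fun k => partial k h x) by [].
rewrite (funext E); apply: is_cvgB; last first.
  by apply: is_cvgMr; apply/cvg_ex; exists (limit envelope x); exact: limit_envelope.
have p0 y : 0 <= 1 * h y + C * envelope y.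
  by have := hC y; rewrite ler_norml mul1r -lerBlDr sub0r => /andP[].
apply: nondecreasing_is_cvgn; first exact: partial_homo.
exists (2 * C * 2) => _ [k _ <-].
apply: le_trans (_ : partial k (fun y => (2 * C) * envelope y + 0 * envelope y) x <= _).
  apply: partial_le => y; have := hC y; rewrite ler_norml => /andP[_]; lra.
rewrite partial_linear mul0r addr0; apply: ler_wpM2l; first by rewrite mulr_ge0 // ltW.
by apply: le_trans (partial_envelope_bounded k x) _; rewrite gerBl exprn_ge0.
Qed.

Lemma limit_linear h1 h2 a b x : dominated h1 -> dominated h2 ->
  limit (fun y => a * h1 y + b * h2 y) x = a * limit h1 x + b * limit h2 x.
Proof.
move=> d1 d2; apply: cvg_lim => //.
under eq_fun do rewrite partial_linear.
by apply: cvgD; apply: cvgMr; exact: partial_cvg.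
Qed.

Lemma limit_shift h t x : limit (fun y => h (y - t)) x = limit h (x - t).
Proof. by rewrite /limit; under eq_fun do rewrite partial_shift. Qed.

Lemma measurable_limit h : dominated h -> measurable_fun [set: R] (limit h).
Proof.
move=> dh; apply: (@measurable_fun_cvg _ _ _ _ (fun k => partial k h)).
  by move=> k; apply: measurable_partial; exact: dh.1.
by move=> x _; exact: partial_cvg.
Qed.

Lemma limit_ge0 h x : dominated h -> (forall y, 0 <= h y) -> 0 <= limit h x.
Proof.
move=> dh h0; move/cvg_lim : (partial_cvg (x := x) dh) => <- //.
apply: limr_ge; last by apply: nearW => k; exact: partial_ge0.
by apply/cvg_ex; exists (limit h x); exact: partial_cvg.
Qed.

(** Every increment is a convolution with nonnegative coefficients, hence preserves the majorization
    of h by C envelope; sum the increments and pass to the limit. *)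
Lemma limit_tail_le k (h : R -> R) C x : measurable_fun [set: R] h ->
  (forall y, `|h y| <= C * envelope y) ->
  `|limit h x - partial k h x| <= C * (limit envelope x - partial k envelope x).
Proof.
move=> mh hC; have dh := dominated_le mh hC.
have step j : `|partial (j + k) h x - partial k h x| <=
    C * (partial (j + k) envelope x - partial k envelope x).
  elim: j => [|j IH]; first by rewrite !subrr normr0 mulr0.
  have [r [r0 _ _ H]] := increment (j + k).
  have := H h x; have := H envelope x; rewrite addSn.
  set t := x + _ => E1 E2.
  rewrite -[X in `|X|](subrKA (partial (j + k) h x)) E2.
  rewrite -[X in C * X](subrKA (partial (j + k) envelope x)) E1 mulrDr.
  apply: le_trans (ler_normD _ _) _; apply: lerD => //.
  apply: le_trans (ler_norm_sum _ _ _) _; rewrite mulr_sumr; apply: ler_sum => i _.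
  by rewrite normrM (ger0_norm (r0 i)) mulrCA ler_wpM2l.
have c1 : `|partial (j + k) h x - partial k h x| @[j --> \oo] --> `|limit h x - partial k h x|.
  apply: cvg_norm; apply: cvgB; last exact: cvg_cst.
  by rewrite (cvg_shiftn k (fun j => partial j h x)); exact: partial_cvg.
have c2 : C * (partial (j + k) envelope x - partial k envelope x) @[j --> \oo] -->
    C * (limit envelope x - partial k envelope x).
  apply: cvgMr; apply: cvgB; last exact: cvg_cst.
  by rewrite (cvg_shiftn k (fun j => partial j envelope x)); exact: limit_envelope.
by apply: ler_cvg_to c1 c2 _; exact: nearW.
Qed.

Lemma limit_le (h : R -> R) C x : measurable_fun [set: R] h ->
  (forall y, `|h y| <= C * envelope y) -> `|limit h x| <= C * limit envelope x.
Proof.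
move=> mh hC; rewrite -[limit h x](subrK (partial 0 h x)).
apply: le_trans (ler_normD _ _) _.
apply: le_trans (lerD (limit_tail_le 0 x mh hC) (partial_bounded 0 x hC)) _.
by rewrite -mulrDr subrK.
Qed.

(** Division by [bd k] is what lets the tail be multiplied by a W or c of an earlier step and remain
    small. The bounds increase, so all later increments can be compared with [bd k] and summed
    geometrically. *)
Lemma lpnorm_tail_envelope k p : 1 + k.+1%:R^-1 <= p <= k.+1%:R ->
  (lpnorm p (fun x => limit envelope x - partial k envelope x)%R <= (2^-1 ^+ k / bd k)%:E)%E.
Proof.
move=> pk; have /andP[pk1 pk2] := pk.
have p1 : 1 <= p by apply: le_trans pk1; rewrite lerDl invr_ge0.
have bp i : 0 < bd i by apply: lt_le_trans (bd1 i).
have mE := @measurable_envelope R.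
have mp i : measurable_fun [set: R] (partial i envelope) by exact: measurable_partial.
have mB i j : measurable_fun [set: R] (fun x => partial i envelope x - partial j envelope x).
  exact: measurable_funB.
apply: (@lpnorm_monotone _ p (fun j x => partial (j + k) envelope x - partial k envelope x)).
- exact: p1.
- by rewrite divr_ge0 ?exprn_ge0 // ltW.
- by move=> j; exact: mB.
- by move=> j x; rewrite subr_ge0 partial_homo ?leq_addl //; exact: envelope_ge0.
- move=> x i j ij; rewrite lerD2r partial_homo ?leq_add2r //; exact: envelope_ge0.
- move=> x; apply: cvgB; last exact: cvg_cst.
  by rewrite (cvg_shiftn k (fun j => partial j envelope x)); exact: limit_envelope.
move=> j; apply: (@le_trans _ _ ((2^-1 ^+ k - 2^-1 ^+ (j + k)) / bd k)%:E); last first.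
  by rewrite lee_fin ler_pM2r ?invr_gt0 // gerBl exprn_ge0.
elim: j => [|j IH].
  rewrite subrr mul0r; under [X in lpnorm _ X]funext do rewrite subrr.
  by rewrite lpnorm0 //; exact: lt_le_trans p1.
rewrite addSn; have [r [_ H2 _ H]] := increment (j + k).
have bk : bd k <= bd (j + k).
  elim: (j) => [//|l IHl]; apply: le_trans IHl _; rewrite addSn.
  by have [? [? [? [? [? [? [_ _ _ _ [? _ _ _]]]]]]]] := s_step (l + k).
have -> : (fun x => partial (j + k).+1 envelope x - partial k envelope x)%R =
  (fun x => (partial (j + k).+1 envelope x - partial (j + k) envelope x) +
     (partial (j + k) envelope x - partial k envelope x))%R.
  by apply/funext => x; rewrite subrKA.
apply: le_trans (lpnormD p1 (mB _ _) (mB _ _)) _.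
apply: (@le_trans _ _ (2^-1 ^+ (j + k).+1 / bd (j + k) +
  (2^-1 ^+ k - 2^-1 ^+ (j + k)) / bd k)%:E).
  rewrite EFinD leeD //.
  have -> : (fun x => partial (j + k).+1 envelope x - partial (j + k) envelope x)%R =
    (fun x => act r envelope (x - - (stage_shift (s (j + k).+1))%:R))%R.
    by apply/funext => x; rewrite H opprK.
  rewrite lpnorm_shift; last exact: measurable_act.
  apply: H2; apply/andP; split.
    by apply: le_trans pk1; rewrite lerD2l lef_pV2 ?posrE // ler_nat ltnS leq_addl.
  by apply: le_trans pk2 _; rewrite ler_nat ltnS leq_addl.
rewrite lee_fin; apply: (@le_trans _ _ (2^-1 ^+ (j + k).+1 / bd k +
  (2^-1 ^+ k - 2^-1 ^+ (j + k)) / bd k)).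
  by rewrite lerD2r ler_pM2l ?exprn_gt0 // lef_pV2 // posrE.
by rewrite -mulrDl ler_pM2r ?invr_gt0 // exprS; lra.
Qed.

Lemma lpnorm_tail k p (h : R -> R) C : 1 + k.+1%:R^-1 <= p <= k.+1%:R -> 0 <= C ->
  measurable_fun [set: R] h -> (forall y, `|h y| <= C * envelope y) ->
  (lpnorm p (fun x => limit h x - partial k h x)%R <= (C * (2^-1 ^+ k / bd k))%:E)%E.
Proof.
move=> pk C0 mh hC; have /andP[pk1 pk2] := pk.
have p1 : 1 <= p by apply: le_trans pk1; rewrite lerDl invr_ge0.
have dh := dominated_le mh hC; have dE := dominated_envelope.
have mB g : dominated g -> measurable_fun [set: R] (fun x => limit g x - partial k g x).
  by move=> dg; apply: measurable_funB; [exact: measurable_limit | exact: measurable_partial dg.1].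
apply: (@le_trans _ _ (lpnorm p (fun x => C * (limit envelope x - partial k envelope x))%R)).
  apply: le_lpnorm; [exact: le_trans p1 | exact: mB | | by move=> x; exact: limit_tail_le].
  by apply: measurable_funM => //; exact: mB.
rewrite lpnormZ; [| exact: lt_le_trans p1 | exact: mB].
by rewrite ger0_norm // EFinM lee_wpmul2l ?lee_fin // lpnorm_tail_envelope.
Qed.

Lemma lpnorm_partial_envelope k p : 1 <= p -> (lpnorm p (partial k envelope) < +oo)%E.
Proof.
move=> p1; have p0 : 0 < p by apply: lt_le_trans p1.
have mE := @measurable_envelope R.
have -> : partial k envelope =
    (fun x => act (stage_poly (s k)) envelope (x - - (stage_shift (s k))%:R))%R.
  by apply/funext => x; rewrite opprK.
rewrite lpnorm_shift; last exact: measurable_act.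
apply: le_lt_trans (lpnorm_act _ p1 mE) _.
by rewrite lte_mul_pinfty ?lee_fin ?norm1_ge0 ?lpnorm_envelope.
Qed.

Lemma eventually_range (p c e : R) : 1 < p -> 0 < e -> exists K : nat, forall k, (K <= k)%N ->
  1 + k.+1%:R^-1 <= p <= k.+1%:R /\ c * 2^-1 ^+ k <= e.
Proof.
move=> p1 e0; have p10 : 0 < p - 1 by rewrite subr_gt0.
exists (Num.truncn p + Num.truncn (p - 1)^-1 + Num.truncn (`|c| / e))%N => k Kk.
have T (x : R) : (Num.truncn x <= k)%N -> x <= k.+1%:R.
  by move=> xk; rewrite ltW // (lt_le_trans (truncnS_gt x)) // ler_nat ltnS.
have h1 : p <= k.+1%:R.
  by apply: T; apply: leq_trans Kk; rewrite -addnA leq_addr.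
have h2 : (p - 1)^-1 <= k.+1%:R.
  by apply: T; apply: leq_trans Kk; rewrite addnAC leq_addl.
have h3 : `|c| / e <= k.+1%:R.
  by apply: T; apply: leq_trans Kk; rewrite leq_addl.
split.
  rewrite h1 andbT -lerBrDl -[leRHS]invrK lef_pV2 ?posrE ?invr_gt0 //.
apply: (@le_trans _ _ (`|c| * 2^-1 ^+ k)); first by rewrite ler_wpM2r ?exprn_ge0 // ler_norm.
rewrite exprVn ler_pdivrMr ?exprn_gt0 // mulrC -ler_pdivrMr //.
by apply: le_trans h3 _; rewrite -natrX ler_nat ltn_expl.
Qed.

Lemma lpnorm_act_dominated k f (h : R -> R) (p e C : R) : 0 < C -> 1 + k%:R^-1 <= p <= k%:R ->
  measurable_fun [set: R] h -> (forall y, `|h y| <= C * envelope y) ->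
  (forall g, under_envelope g -> lp_le k (act f g) e) ->
  (lpnorm p (act f h) <= (C * e)%:E)%E.
Proof.
move=> C0 pk mh hC H; have /andP[pk1 pk2] := pk.
have p0 : 0 < p by apply: lt_le_trans pk1; rewrite ltr_pwDl // invr_ge0.
pose g x := C^-1 * h x.
have mg : measurable_fun [set: R] g by apply: measurable_funM.
have ug : under_envelope g.
  split=> // y; rewrite normrM gtr0_norm ?invr_gt0 // mulrC ler_pdivrMr // mulrC; exact: hC.
have -> : act f h = (fun x => C * act f g x).
  apply/funext => x; rewrite /act mulr_sumr; apply: eq_bigr => i _; rewrite /g.
  by field; rewrite gt_eqF.
rewrite lpnormZ ?gtr0_norm //; last exact: measurable_act.
by rewrite EFinM lee_wpmul2l ?lee_fin ?(ltW C0) // H.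
Qed.

Lemma actB_fun f h1 h2 x : act f (fun y => h1 y - h2 y) x = act f h1 x - act f h2 x :> R.
Proof.
have := act_linear f 1 (-1) h1 h2 x; rewrite mul1r mulN1r => <-.
by congr act; apply/funext => y; rewrite mul1r mulN1r.
Qed.

Lemma act_partial f k h t x :
  act f (partial k h) (x - t) =
  act (f * stage_poly (s k)) h (x - (t - (stage_shift (s k))%:R)) :> R.
Proof.
have -> : partial k h =
    (fun x => act (stage_poly (s k)) h (x - - (stage_shift (s k))%:R))%R.
  by apply/funext => y; rewrite opprK.
by rewrite act_shift actM; congr act; ring.
Qed.

Lemma lpnorm_act_tail k (p C t : R) f (h : R -> R) : 1 + k.+2%:R^-1 <= p <= k.+2%:R -> 0 <= C ->
  measurable_fun [set: R] h -> (forall y, `|h y| <= C * envelope y) ->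
  norm1 f <= bd k.+1 ->
  (lpnorm p (fun x => act f (fun y => limit h y - partial k.+1 h y) (x - t))%R <=
     (C * 2^-1 ^+ k.+1)%:E)%E.
Proof.
move=> pk C0 mh hC fb; have /andP[pk1 pk2] := pk.
have p1 : 1 <= p by apply: le_trans pk1; rewrite lerDl invr_ge0.
have dh := dominated_le mh hC.
have mB : measurable_fun [set: R] (fun x => limit h x - partial k.+1 h x).
  by apply: measurable_funB; [exact: measurable_limit | exact: measurable_partial].
rewrite lpnorm_shift; last exact: measurable_act.
apply: le_trans (lpnorm_act _ p1 mB) _.
apply: (@le_trans _ _ ((norm1 f)%:E * (C * (2^-1 ^+ k.+1 / bd k.+1))%:E)%E).
  by rewrite lee_wpmul2l ?lee_fin ?norm1_ge0 //; exact: lpnorm_tail.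
have b0 : 0 < bd k.+1 by apply: lt_le_trans (bd1 _).
rewrite -EFinM lee_fin; apply: (@le_trans _ _ (bd k.+1 * (C * (2^-1 ^+ k.+1 / bd k.+1)))).
  by apply: ler_wpM2r fb; rewrite mulr_ge0 ?divr_ge0 ?exprn_ge0 // ltW.
by rewrite le_eqVlt; apply/orP; left; apply/eqP; field; rewrite gt_eqF.
Qed.

(** Composed with X^N, W turns the polynomial of stage k + 1 into that of stage k times W (X^n + v)
    in X^N, which acts as a small operator. The tail beyond stage k + 1 is small against the norm of
    W. *)
Lemma limit_annihilator p h (kappa : nat) e : 1 < p -> dominated h -> 0 < e ->
  exists (W : {poly R}) (N : nat), [/\ W`_0 = 1, (kappa < N)%N,
      forall j, (N <= j + kappa.+1)%N -> norm1 W * `|alpha j| <= e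
      & (lpnorm p (act (W \Po 'X^N) (limit h)) <= e%:E)%E].
Proof.
move=> p1 dh e0; have [C C0 hC] := dominated_pos dh; have mh := dh.1.
have [K HK] := eventually_range (Num.max C 1) p1 e0.
(* K takes care of p and e; adding kappa makes the margin of k + 1 indices before N at least kappa +
   1. *)
pose k := (K + kappa)%N; have Kk : (K <= k)%N by rewrite leq_addr.
have [_ ek] := HK _ Kk; have [pk _] := HK k.+1 (leqW Kk); have [pk0 _] := HK k Kk.
have p1' := ltW p1.
have C1 : C <= Num.max C 1 by rewrite le_max lexx.
have e1 : C * 2^-1 ^+ k <= e.
  by apply: le_trans ek; rewrite ler_wpM2r ?exprn_ge0.
have e2 : 2^-1 ^+ k <= e.
  apply: le_trans ek; rewrite ler_peMl ?exprn_ge0 //; by rewrite le_max lexx orbT.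
have [n [N [v [W [c [i [qE OE _ [W0 kN Wa WE] [_ Wb _ _]]]]]]]] := s_step k.
exists W, N; split => //.
- by apply: leq_trans kN; rewrite ltnS leq_addl.
- move=> j Nj; apply: (le_trans (Wa j _)).
    by apply: leq_trans Nj _; rewrite leq_add2l ltnS leq_addl.
  apply: le_trans e2; by rewrite exprS ler_piMl ?exprn_ge0 // invf_le1 // ler1n.
have dB : measurable_fun [set: R] (fun x => limit h x - partial k.+1 h x).
  by apply: measurable_funB; [exact: measurable_limit | exact: measurable_partial].
have E : act (W \Po 'X^N) (limit h) = (fun x =>
    act (W \Po 'X^N) (fun y => limit h y - partial k.+1 h y) (x - 0) +
    act (((W * ('X^n + v)) \Po 'X^N) * stage_poly (s k)) h
      (x - (0 - (stage_shift (s k.+1))%:R))).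
  apply/funext => x; rewrite comp_polyM -mulrA -qE -act_partial subr0 actB_fun; ring.
rewrite E; have mA := measurable_act.
apply: le_trans (lpnormD p1' _ _) _.
- by apply: measurable_shift; exact: measurable_act.
- by apply: measurable_shift; exact: measurable_act.
apply: (@le_trans _ _ (C * 2^-1 ^+ k.+1 + C * 2^-1 ^+ k.+1)%:E); last first.
  by rewrite lee_fin; apply: le_trans e1; rewrite exprS -mulrDr; lra.
rewrite EFinD leeD //.
  apply: lpnorm_act_tail => //; first exact: ltW.
  exact: le_trans (norm1_comp _ _) Wb.
rewrite lpnorm_shift; last exact: measurable_act.
exact: lpnorm_act_dominated hC WE.
Qed.

Lemma limit_recover p h e : 1 < p -> dominated h -> 0 < e ->
  exists (c : {poly R}) (O i : nat),
    (lpnorm p (fun x => h x - act c (limit h) (x + i%:R - O%:R))%R <= e%:E)%E.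
Proof.
move=> p1 dh e0; have [C C0 hC] := dominated_pos dh; have mh := dh.1.
have [K HK] := eventually_range C p1 e0; pose k := K.
have [pk0 ek] := HK k (leqnn K); have [pk _] := HK k.+1 (leqnSn K).
have p1' := ltW p1.
have [n [N [v [W [c [i [qE OE _ _ [_ _ cb cE]]]]]]]] := s_step k.
exists c, (stage_shift (s k.+1)), i.
have dB : measurable_fun [set: R] (fun x => limit h x - partial k.+1 h x).
  by apply: measurable_funB; [exact: measurable_limit | exact: measurable_partial].
pose t : R := (stage_shift (s k.+1))%:R - i%:R.
have E : (fun x => h x - act c (limit h) (x + i%:R - (stage_shift (s k.+1))%:R))%R =
  (fun x => - (act c (fun y => limit h y - partial k.+1 h y) (x - t) +
    act (c * stage_poly (s k.+1) - 'X^i) h (x - - i%:R))).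
  apply/funext => x; rewrite actB actXn opprK addrK actB_fun act_partial.
  have -> : x - (t - (stage_shift (s k.+1))%:R) = x + i%:R by rewrite /t; ring.
  have -> : x + i%:R - (stage_shift (s k.+1))%:R = x - t by rewrite /t; ring.
  by ring.
have m1 : measurable_fun [set: R]
    (fun x => act c (fun y => limit h y - partial k.+1 h y) (x - t)).
  by apply: measurable_shift; exact: measurable_act.
have m2 : measurable_fun [set: R] (fun x => act (c * stage_poly (s k.+1) - 'X^i) h (x - - i%:R)).
  by apply: measurable_shift; exact: measurable_act.
rewrite E lpnormN; [| exact: lt_le_trans p1' | exact: measurable_funD].
apply: le_trans (lpnormD p1' m1 m2) _.
apply: (@le_trans _ _ (C * 2^-1 ^+ k.+1 + C * 2^-1 ^+ k.+1)%:E); last first.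
  by rewrite lee_fin; apply: le_trans ek; rewrite exprS -mulrDr; lra.
rewrite EFinD leeD //.
  by apply: lpnorm_act_tail => //; exact: ltW.
rewrite lpnorm_shift; last exact: measurable_act.
exact: lpnorm_act_dominated hC cE.
Qed.

Lemma limit_generator : generator limit.
Proof.
split.
- exact: measurable_limit.
- exact: limit_linear.
- exact: limit_shift.
- exact: limit_ge0.
- exact: limit_le.
- move=> p p1; have [K HK] := eventually_range 0 p1 ltr01.
  have [pk _] := HK K (leqnn K); have p1' := ltW p1.
  have mE := @measurable_envelope R.
  have -> : limit envelope =
      (fun x => (limit envelope x - partial K envelope x) + partial K envelope x).
    by apply/funext => x; rewrite subrK.
  apply: le_lt_trans (lpnormD p1' _ _) _.
  + by apply: measurable_funB; [apply: measurable_limit; exact: dominated_envelope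
      | exact: measurable_partial].
  + exact: measurable_partial.
  rewrite lte_add_pinfty ?lpnorm_partial_envelope //.
  by apply: le_lt_trans (lpnorm_tail_envelope pk) _; exact: ltry.
- exact: limit_annihilator.
- exact: limit_recover.
Qed.

End Limit.

Lemma exists_generator (R : realType) (alpha : nat -> R) :
  alpha n @[n --> \oo] --> (0 : R) -> exists A, generator alpha A.
Proof.
move=> a0; have [s [h1 h2 h3 h4]] := stage_sequence a0.
by exists (limit s); exact: limit_generator.
Qed.

(** * Estimates for Gaussians and the exponential series *)

Section Gaussian.
Variable R : realType.
Local Notation envelope := (@envelope R).

Lemma series_exp_le (z : R) n : 0 <= z -> \sum_(l < n) z ^+ l / l`!%:R <= expR z.
Proof.
move=> z0; have := @nondecreasing_cvgn_le R _ _ (is_cvg_series_exp_coeff z) n.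
rewrite /series /= big_mkord; apply.
by apply: nondecreasing_series => i _ _; exact: exp_coeff_ge0.
Qed.

Lemma exprn_le_expR (z : R) n : 0 <= z -> z ^+ n <= n`!%:R * expR z.
Proof.
move=> z0; rewrite mulrC -ler_pdivrMr ?ltr0n ?fact_gt0 //.
apply: le_trans (series_exp_le n.+1 z0); rewrite big_ord_recr /= lerDr sumr_ge0 // => i _.
by rewrite divr_ge0 ?exprn_ge0.
Qed.

(** As (n + i)! >= i!, the terms of index n + i are at most |z|^n times those of index i of the
    series of exp |z|. *)
Lemma exp_remainder (z : R) n :
  `|expR z - \sum_(l < n) z ^+ l / l`!%:R| <= `|z| ^+ n * expR `|z|.
Proof.
have c : `|series (exp_coeff z) m - \sum_(l < n) z ^+ l / l`!%:R| @[m --> \oo] -->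
    `|expR z - \sum_(l < n) z ^+ l / l`!%:R|.
  by apply: cvg_norm; apply: cvgB; [exact: is_cvg_series_exp_coeff | exact: cvg_cst].
move/cvg_lim : (c) => <- //; apply: limr_le; first by apply/cvg_ex; eexists; exact: c.
exists n => // m /= nm; rewrite /series /= big_mkord /exp_coeff /=.
rewrite -(subnKC nm) big_split_ord /= addrAC subrr add0r.
apply: le_trans (ler_norm_sum _ _ _) _.
apply: le_trans (_ : \sum_(i < m - n) `|z| ^+ n * (`|z| ^+ i / i`!%:R) <= _); last first.
  by rewrite -mulr_sumr ler_wpM2l ?exprn_ge0 // series_exp_le.
apply: ler_sum => i _; rewrite normrM normrX exprD -mulrA ler_wpM2l ?exprn_ge0 //.
rewrite normfV normr_nat ler_wpM2l ?exprn_ge0 //.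
rewrite lef_pV2 ?posrE ?ltr0n ?fact_gt0 // ler_nat.
have : (i <= n + i)%N by rewrite leq_addl.
elim: (n + i)%N => [|k IH]; first by rewrite leqn0 => /eqP ->.
rewrite leq_eqVlt => /orP[/eqP -> //|]; rewrite ltnS => /IH H.
by apply: leq_trans H _; rewrite factS leq_pmull.
Qed.

(** With t = |y|, use t^m <= m! exp t and 1 + t^2 <= 2 exp t; completing the square bounds (c + 2) t
    - d t^2 by (c + 2)^2 / (4d). *)
Lemma gaussian_envelope m (c d : R) : 0 < d -> exists C, forall y : R,
  `|y| ^+ m * expR (c * `|y| - d * y ^+ 2) <= C * envelope y.
Proof.
move=> d0; exists (m`!%:R * 2 * expR ((c + 2) ^+ 2 / (4 * d))) => y.
rewrite -ler_pdivrMr ?envelope_gt0 // /envelope invrK.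
set t := `|y|; have t0 : 0 <= t by exact: normr_ge0.
have -> : y ^+ 2 = t ^+ 2 by rewrite /t real_normK ?num_real.
have h1 := exprn_le_expR m t0.
have h2 : 1 + t ^+ 2 <= 2 * expR t.
  have := series_exp_le 3 t0; rewrite 3!big_ord_recr big_ord0 /= !factS fact0.
  rewrite expr0 expr1 => H; apply: le_trans (_ : 2 * (1 + t + t ^+ 2 / 2) <= _); first by lra.
  by rewrite ler_wpM2l //; apply: le_trans H; rewrite add0r !divr1 le_eqVlt ?muln1 ?mul1n eqxx.
apply: le_trans (_ : (m`!%:R * expR t) * expR (c * t - d * t ^+ 2) * (2 * expR t) <= _).
  apply: ler_pM => //; first by rewrite mulr_ge0 ?exprn_ge0 ?expR_ge0.
    by rewrite addr_ge0 ?sqr_ge0.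
  by rewrite ler_wpM2r ?expR_ge0.
have -> : m`!%:R * expR t * expR (c * t - d * t ^+ 2) * (2 * expR t) =
    m`!%:R * 2 * (expR t * expR (c * t - d * t ^+ 2) * expR t) by ring.
rewrite -!expRD ler_wpM2l ?mulr_ge0 ?ler0n // ler_expR.
rewrite ler_pdivlMr ?mulr_gt0 //.
rewrite -subr_ge0.
have -> : (c + 2) ^+ 2 - (t + (c * t - d * t ^+ 2) + t) * (4 * d) =
  (2 * d * t - (c + 2)) ^+ 2 by ring.
exact: sqr_ge0.
Qed.

Definition gaussian j (x : R) := x ^+ j * expR (- x ^+ 2).

Lemma measurable_gaussian j : measurable_fun [set: R] (gaussian j).
Proof.
apply: measurable_funM; first exact: measurable_funX.
apply: measurableT_comp; first exact: measurable_expR.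
by apply: measurableT_comp => //; exact: measurable_funX.
Qed.

Lemma dominated_gaussian j : dominated (gaussian j).
Proof.
have [C H] := @gaussian_envelope j 0 1 ltr01; apply: (@dominated_le _ _ C).
  exact: measurable_gaussian.
move=> x; rewrite normrM normrX [X in _ * X]ger0_norm ?expR_ge0 //.
by apply: le_trans (H x); rewrite mul0r mul1r sub0r.
Qed.

End Gaussian.

(** * Completeness *)

Section ClosedSubspace.
Variable R : realType.
Variable p : R.
Hypothesis p1 : 1 <= p.

Let p0 : 0 < p. Proof. exact: lt_le_trans p1. Qed.

(** Abstracts the closed span of the translates, so that the density arguments need not handle
    coefficients. *)
Record closed_subspace (S : set (R -> R)) : Prop := ClosedSubspace {
  closed_subspace_measurable : forall F, S F -> measurable_fun [set: R] F;
  closed_subspace_linear : forall F G a b, S F -> S G -> S (fun x => a * F x + b * G x);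
  closed_subspace_closure : forall F : R -> R, measurable_fun [set: R] F ->
    (forall e, 0 < e -> exists2 G, S G & (lpnorm p (fun x => F x - G x)%R <= e%:E)%E) -> S F }.

Section Theory.
Variable S : set (R -> R).
Hypothesis cS : closed_subspace S.

Lemma closed_subspaceZ a F : S F -> S (fun x => a * F x).
Proof.
move=> SF; have := closed_subspace_linear cS a 0 SF SF.
by under eq_fun do rewrite mul0r addr0.
Qed.

Lemma closed_subspaceD F G : S F -> S G -> S (fun x => F x + G x).
Proof.
move=> SF SG; have := closed_subspace_linear cS 1 1 SF SG.
by under eq_fun do rewrite !mul1r.
Qed.

Lemma closed_subspaceB F G : S F -> S G -> S (fun x => F x - G x).
Proof.
move=> SF SG; have := closed_subspace_linear cS 1 (-1) SF SG.
by under eq_fun do rewrite mul1r mulN1r.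
Qed.

Lemma closed_subspace0 F : S F -> S (fun=> 0).
Proof.
by move=> /(closed_subspaceZ 0); under eq_fun do rewrite mul0r.
Qed.

Lemma closed_subspace_sum n (F : 'I_n.+1 -> R -> R) :
  (forall i, S (F i)) -> S (fun x => \sum_(i < n.+1) F i x).
Proof.
elim: n F => [|n IH] F SF; first by under eq_fun do rewrite big_ord1; exact: SF.
under eq_fun do rewrite big_ord_recr /=.
by apply: closed_subspaceD => //; exact: IH.
Qed.

Lemma closed_subspace_sum0 n (F : 'I_n -> R -> R) : S (fun=> 0) ->
  (forall i, S (F i)) -> S (fun x => \sum_(i < n) F i x).
Proof.
case: n F => [|n] F S0 SF; last exact: closed_subspace_sum.
by under eq_fun do rewrite big_ord0.
Qed.

Lemma closed_subspace_dominated (F : nat -> R -> R) (G H : R -> R) :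
  (forall n, S (F n)) -> measurable_fun [set: R] G -> measurable_fun [set: R] H ->
  (forall x, F n x @[n --> \oo] --> G x) -> (forall n x, `|F n x| <= H x) ->
  (lpnorm p H < +oo)%E -> S G.
Proof.
move=> SF mG mH FG FH H_fin; apply: (closed_subspace_closure cS) => // e e0.
have mF n : measurable_fun [set: R] (F n) by exact: (closed_subspace_measurable cS).
have [n Hn] := lpnorm_dominated p1 mF mG mH FG FH H_fin e0.
by exists (F n) => //; exact: ltW.
Qed.

End Theory.

Section Span.
Variable u : nat -> R -> R.
Hypothesis mu : forall n, measurable_fun [set: R] (u n).

Definition comb N (c : nat -> R) (x : R) := \sum_(n < N) c n * u n x.

Definition closed_span : set (R -> R) := [set F : R -> R | measurable_fun [set: R] F /\
  forall e, 0 < e -> exists N c, (lpnorm p (fun x => F x - comb N c x)%R <= e%:E)%E].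

Lemma measurable_comb N c : measurable_fun [set: R] (comb N c).
Proof. by apply: measurable_sum => i; apply: measurable_funM. Qed.

Lemma comb_wide N M c : (N <= M)%N ->
  comb N c = comb M (fun n => if (n < N)%N then c n else 0).
Proof.
move=> NM; apply/funext => x; rewrite /comb (big_ord_widen M (fun n => c n * u n x)) // big_mkcond.
by apply: eq_bigr => i _; case: ifP => //; rewrite mul0r.
Qed.

Lemma comb_linear N M c d a b : exists K k,
  (fun x => a * comb N c x + b * comb M d x) = comb K k.
Proof.
have [Na Ma] := (leq_maxl N M, leq_maxr N M).
exists (maxn N M), (fun n => a * (if (n < N)%N then c n else 0) +
  b * (if (n < M)%N then d n else 0)); apply/funext => x.
rewrite (comb_wide c Na) (comb_wide d Ma) /comb !mulr_sumr -big_split /=.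
by apply: eq_bigr => i _; ring.
Qed.

Lemma closed_span_gen n : closed_span (u n).
Proof.
split => // e e0; exists n.+1, (fun i => if i == n then 1 else 0).
have -> : (fun x => u n x - comb n.+1 (fun i => if i == n then 1 else 0) x)%R = (fun=> 0).
  apply/funext => x; rewrite /comb big_ord_recr /= eqxx mul1r big1 ?add0r ?subrr //.
  by move=> i _; rewrite lt_eqF ?mul0r // ltEnat /= ltn_ord.
by rewrite lpnorm0 // lee_fin ltW.
Qed.

Lemma closed_span_subspace : closed_subspace closed_span.
Proof.
split.
- by move=> F [].
- move=> F G a b [mF HF] [mG HG]; split.
    by apply: measurable_funD; apply: measurable_funM.
  move=> e e0.
  (* Adding 1 avoids a division by zero when a = 0. *)
  have ha : 0 < e / 2 / (`|a| + 1) by rewrite !divr_gt0 // ltr_wpDl.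
  have hb : 0 < e / 2 / (`|b| + 1) by rewrite !divr_gt0 // ltr_wpDl.
  have [N [c Hc]] := HF _ ha; have [M [d Hd]] := HG _ hb.
  have [K [k Ek]] := comb_linear N M c d a b; exists K, k; rewrite -Ek.
  have -> : (fun x => a * F x + b * G x - (a * comb N c x + b * comb M d x))%R =
    (fun x => a * (F x - comb N c x) + b * (G x - comb M d x)).
    by apply/funext => x; ring.
  have m1 : measurable_fun [set: R] (fun x => F x - comb N c x).
    by apply: measurable_funB => //; exact: measurable_comb.
  have m2 : measurable_fun [set: R] (fun x => G x - comb M d x).
    by apply: measurable_funB => //; exact: measurable_comb.
  apply: le_trans (lpnormD p1 _ _) _; [exact: measurable_funM | exact: measurable_funM |].
  rewrite !lpnormZ //.
  have H (y : R) : 0 <= y -> y * (e / 2 / (y + 1)) <= e / 2.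
    move=> y0; rewrite mulrA ler_pdivrMr ?ltr_wpDl // mulrC ler_wpM2l ?lerDl //.
    by rewrite divr_ge0 // ltW.
  apply: (@le_trans _ _ (`|a| * (e / 2 / (`|a| + 1)) + `|b| * (e / 2 / (`|b| + 1)))%:E).
    by rewrite EFinD !EFinM leeD // lee_wpmul2l ?lee_fin.
  rewrite lee_fin [leRHS]splitr.
  by apply: lerD; apply: H.
- move=> F mF H; split => // e e0; have e2 : 0 < e / 2 by rewrite divr_gt0.
  have [G [mG HG] FG] := H _ e2; have [N [c Hc]] := HG _ e2; exists N, c.
  have -> : (fun x => F x - comb N c x)%R = (fun x => (F x - G x) + (G x - comb N c x)).
    by apply/funext => x; rewrite subrKA.
  apply: le_trans (lpnormD p1 _ _) _.
  + exact: measurable_funB.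
  + by apply: measurable_funB => //; exact: measurable_comb.
  have -> : e = e / 2 + e / 2 by field.
  by rewrite EFinD leeD.
Qed.

End Span.
End ClosedSubspace.

(** * From the given translates to the functions x^j exp(-x^2) *)

Section Translates.
Variable R : realType.
Variable alpha : nat -> R.
Hypothesis alpha_neq0 : forall n, alpha n != 0.
Variable A : (R -> R) -> R -> R.
Hypothesis genA : generator alpha A.
Variable p : R.
Hypothesis p1 : 1 < p.
Local Notation envelope := (@envelope R).
Local Notation gaussian := (@gaussian R).

Lemma generatorZ h a x : dominated h -> A (fun y => a * h y) x = a * A h x.
Proof.
move=> dh; have := generator_linear genA a 0 x dh dh; rewrite mul0r addr0 => <-.
by congr A; apply/funext => y; rewrite mul0r addr0.
Qed.

Lemma dominatedZ h a : dominated h -> dominated (fun y : R => a * h y).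
Proof.
move=> dh; have := dominated_linear a 0 dh dh.
by under eq_fun do rewrite mul0r addr0.
Qed.

Lemma dominatedB h1 h2 : dominated h1 -> dominated h2 -> dominated (fun y : R => h1 y - h2 y).
Proof.
move=> d1 d2; have := dominated_linear 1 (-1) d1 d2.
by under eq_fun do rewrite mul1r mulN1r.
Qed.

Lemma generatorB h1 h2 x : dominated h1 -> dominated h2 ->
  A (fun y => h1 y - h2 y) x = A h1 x - A h2 x.
Proof.
move=> d1 d2; have := generator_linear genA 1 (-1) x d1 d2; rewrite mul1r mulN1r => <-.
by congr A; apply/funext => y; rewrite mul1r mulN1r.
Qed.

Lemma generator_sum n (c : nat -> R) (h : nat -> R -> R) :
  (forall i, dominated (h i)) ->
  dominated (fun y => \sum_(i < n) c i * h i y) /\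
  forall x, A (fun y => \sum_(i < n) c i * h i y) x = \sum_(i < n) c i * A (h i) x.
Proof.
move=> dh; elim: n => [|n [IH1 IH2]].
  have -> : (fun y => \sum_(i < 0) c i * h i y) = (fun y => 0 * h 0%N y).
    by apply/funext => y; rewrite big_ord0 mul0r.
  by split=> [|x]; [exact: dominatedZ | rewrite generatorZ // mul0r big_ord0].
have -> : (fun y => \sum_(i < n.+1) c i * h i y) =
    (fun y => 1 * (\sum_(i < n) c i * h i y) + c n * h n y).
  by apply/funext => y; rewrite big_ord_recr /= mul1r.
split=> [|x]; first exact: dominated_linear.
by rewrite (generator_linear genA) // mul1r IH2 big_ord_recr.
Qed.

Definition exp_gaussian (t y : R) := expR (t * y) * expR (- y ^+ 2).

Lemma dominated_exp_gaussian t : dominated (exp_gaussian t).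
Proof.
have [C H] := @gaussian_envelope R 0 `|t| 1 ltr01; apply: (@dominated_le _ _ C).
  apply: measurable_funM; last first.
    by apply: measurableT_comp => //; apply: measurableT_comp => //; exact: measurable_funX.
  by apply: measurableT_comp => //; exact: measurable_funM.
move=> y; apply: le_trans (H y); rewrite /exp_gaussian expr0 !mul1r -expRD ger0_norm ?expR_ge0 //.
by rewrite ler_expR lerD2r -normrM ler_norm.
Qed.

(** Completing the square turns the modulated Gaussian into a multiple of a translated one, and A
    commutes with all real translations. *)
Lemma generator_exp_gaussian t x :
  A (exp_gaussian (2 * t)) x = expR (t ^+ 2) * A (gaussian 0) (x - t).
Proof.
rewrite -(generator_shift genA).
have -> : (fun y => gaussian 0 (y - t)) = (fun y => expR (- t ^+ 2) * exp_gaussian (2 * t) y).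
  apply/funext => y; rewrite /gaussian /exp_gaussian expr0 mul1r. rewrite -!expRD; congr expR; ring.
rewrite generatorZ; last exact: dominated_exp_gaussian.
by rewrite mulrA -expRD subrr expR0 mul1r.
Qed.

Variable S : set (R -> R).
Hypothesis cS : closed_subspace p S.
Hypothesis S_gen : forall n, S (fun x => A (gaussian 0) (x - (n.+1%:R + alpha n))).

Let p0 : 0 < p. Proof. by apply: lt_trans p1. Qed.

(** With t = 2 [alpha n], sigma is exp(-y^2) times j! / t^j times exp(t y) minus its Taylor terms of
    order below j. The Taylor error is of order j + 1, so division by t^j leaves a factor |t|. D is
    uniform in n because |[alpha n]| <= 1 bounds exp |t y| by exp(2 |y|), which the Gaussian
    absorbs. *)
Lemma approx_translate j :
  (forall l n, (l < j)%N -> S (fun x => A (gaussian l) (x - n.+1%:R))) ->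
  exists2 D, 0 <= D & forall n, `|alpha n| <= 1 -> exists2 H, S H &
    (lpnorm p (fun x => A (gaussian j) (x - n.+1%:R) - H x)%R <= (D * `|alpha n|)%:E)%E.
Proof.
move=> IH; have [C HC] := @gaussian_envelope R j.+1 2 1 ltr01.
have dE := @dominated_envelope R.
have C0 : 0 <= C.
  rewrite -(pmulr_lge0 _ (envelope_gt0 0)); apply: le_trans (HC 0).
  by rewrite mulr_ge0 ?exprn_ge0 ?expR_ge0.
pose L := fine (lpnorm p (A envelope)).
have LE : lpnorm p (A envelope) = L%:E.
  by rewrite fineK // ge0_fin_numE ?lpnorm_ge0 //; exact: (generator_lpnorm genA).
have L0 : 0 <= L by rewrite fine_ge0 ?lpnorm_ge0.
exists (j`!%:R * 2 * C * L); first by rewrite !mulr_ge0.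
move=> n an1; have [t tE0] : exists t, t = 2 * alpha n by exists (2 * alpha n).
have t0 : t != 0 by rewrite tE0 mulf_neq0.
set k := j`!%:R / t ^+ j.
have kt : k * (t ^+ j / j`!%:R) = 1.
  by rewrite /k mulrA divfK ?expf_neq0 // divff // pnatr_eq0 -lt0n fact_gt0.
have ke : `|k| * `|t| ^+ j = j`!%:R.
  rewrite -normrX -normrM /k divfK ?expf_neq0 // normr_nat //.
clearbody k.
have dg i : dominated (fun y => t ^+ i / i`!%:R * gaussian i y).
  by apply: dominatedZ; exact: dominated_gaussian.
have [dsum Asum] := generator_sum j (fun i => t ^+ i / i`!%:R) (@dominated_gaussian R).
set P := fun y => _ in dsum Asum.
have dexp := dominated_exp_gaussian t.
have ddif := dominatedB dexp dsum.
pose sigma y := k * (exp_gaussian t y - P y).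
have dsigma : dominated sigma by exact: dominatedZ.
have dmu := @dominated_gaussian R j.
exists (fun x => A sigma (x - n.+1%:R)).
  have -> : (fun x => A sigma (x - n.+1%:R)) = (fun x => k * (A (exp_gaussian t) (x - n.+1%:R)
      - \sum_(i < j) t ^+ i / i`!%:R * A (gaussian i) (x - n.+1%:R))).
    by apply/funext => x; rewrite /sigma generatorZ // generatorB // Asum.
  apply: (closed_subspaceZ cS); apply: (closed_subspaceB cS).
    have -> : (fun x => A (exp_gaussian t) (x - n.+1%:R)) =
        (fun x => expR (alpha n ^+ 2) * A (gaussian 0) (x - (n.+1%:R + alpha n))).
      by apply/funext => x; rewrite tE0 generator_exp_gaussian opprD addrA.
    exact: (closed_subspaceZ cS).
  apply: (closed_subspace_sum0 cS); first exact: (closed_subspace0 cS (S_gen 0)).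
  by move=> i; apply: (closed_subspaceZ cS); exact: IH.
have mA h : dominated h -> measurable_fun [set: R] (A h) by exact: (generator_measurable genA).
have -> : (fun x => A (gaussian j) (x - n.+1%:R) - A sigma (x - n.+1%:R))%R =
    (fun x => A (fun y => gaussian j y - sigma y) (x - n.+1%:R)).
  by apply/funext => x; rewrite generatorB.
have ddiff := dominatedB dmu dsigma.
rewrite lpnorm_shift; last exact: mA.
pose c := j`!%:R * 2 * C * `|alpha n|.
apply: (@le_trans _ _ (lpnorm p (fun x => c * A envelope x)%R)); last first.
  rewrite lpnormZ //; last exact: mA.
  rewrite LE -EFinM lee_fin ger0_norm ?mulr_ge0 //.
  by rewrite /c mulrAC.
apply: le_lpnorm; [exact: ltW | exact: mA | by apply: measurable_funM => //; exact: mA |].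
move=> x; apply: (generator_le genA); first exact: ddiff.1.
move=> y.
have -> : gaussian j y - sigma y = - (k * expR (- y ^+ 2) *
    (expR (t * y) - \sum_(i < j.+1) (t * y) ^+ i / i`!%:R)).
  rewrite big_ord_recr /= /sigma /P /exp_gaussian.
  have -> : \sum_(i < j) t ^+ i / i`!%:R * gaussian i y =
      (\sum_(i < j) (t * y) ^+ i / i`!%:R) * expR (- y ^+ 2).
    by rewrite mulr_suml; apply: eq_bigr => i _; rewrite /gaussian exprMn mulrA [_ / _ * _]mulrAC.
  have -> : gaussian j y = k * (t ^+ j / j`!%:R) * gaussian j y by rewrite kt mul1r.
  rewrite /gaussian exprMn; move: (expR (t * y)) (expR (- y ^+ 2)) (j`!%:R^-1 : R) => u v w.
  by ring.
rewrite normrN normrM normrM (ger0_norm (expR_ge0 _)).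
apply: le_trans (_ : `|k| * expR (- y ^+ 2) * (`|t * y| ^+ j.+1 * expR `|t * y|) <= _).
  by rewrite ler_wpM2l ?mulr_ge0 ?expR_ge0 // exp_remainder.
have -> : `|k| * expR (- y ^+ 2) * (`|t * y| ^+ j.+1 * expR `|t * y|) =
    (`|k| * `|t| ^+ j) * `|t| * (`|y| ^+ j.+1 * (expR `|t * y| * expR (- y ^+ 2))).
  by rewrite normrM exprMn [`|t| ^+ j.+1]exprS; ring.
rewrite ke -expRD.
have tE : `|t| = 2 * `|alpha n| by rewrite tE0 normrM ger0_norm.
apply: le_trans (_ : j`!%:R * `|t| * (`|y| ^+ j.+1 * expR (2 * `|y| - 1 * y ^+ 2)) <= _).
  rewrite ler_wpM2l ?mulr_ge0 // ler_wpM2l ?exprn_ge0 // ler_expR mul1r lerD2r normrM.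
  by rewrite ler_wpM2r // tE ler_piMr.
apply: le_trans (ler_wpM2l _ (HC y)) _; first by rewrite mulr_ge0.
by rewrite tE le_eqVlt; apply/orP; left; apply/eqP; rewrite /c; ring.
Qed.

(** The pair a, b encodes an integer a - b of either sign. The annihilator expresses this translate
    by those at i N + a - b with i > 0, which are positive since N > b, so that [approx_translate]
    covers them. *)
Lemma mem_translates j a b : S (fun x => A (gaussian j) (x + b%:R - a%:R)).
Proof.
elim/ltn_ind: j a b => j IH a b.
have [|D D0 HD] := @approx_translate j.
  by move=> l n lj; have := IH l lj n.+1 0%N; under eq_fun do rewrite addr0.
have dmu := @dominated_gaussian R j.
have mA : measurable_fun [set: R] (A (gaussian j)) by exact: (generator_measurable genA).
have ms t : measurable_fun [set: R] (fun x => A (gaussian j) (x - t)) by exact: measurable_shift.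
have Et : (fun x => A (gaussian j) (x + b%:R - a%:R)) =
    (fun x => A (gaussian j) (x - (a%:R - b%:R))).
  by apply/funext => x; congr A; ring.
apply: (closed_subspace_closure cS); first by rewrite Et.
move=> e e0; pose e1 := Num.min 1 (e / (D + 1)).
have D1 : 0 < D + 1 by rewrite ltr_wpDl.
have e10 : 0 < e1 by rewrite lt_min ltr01 divr_gt0.
have e11 : e1 <= 1 by rewrite ge_min lexx.
have e1e : (D + 1) * e1 <= e by rewrite mulrC -ler_pdivlMr // ge_min lexx orbT.
have [W [N [W0 bN Wa HW]]] := generator_annihilator genA b p1 dmu e10.
have W1 : 1 <= norm1 W by have := coef_le_norm1 W 0; rewrite W0 normr1.
have Wp : 0 < norm1 W by apply: lt_le_trans W1.
(* The index whose translate is i N + a - b = n i + 1; the truncated subtraction is exact for i >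
   0. *)
pose n i := (i * N + a - b.+1)%N.
have nE i : (0 < i)%N -> (n i).+1 = (i * N + a - b)%N.
  move=> i0; have : (b < i * N + a)%N.
    by apply: leq_trans bN _; apply: leq_trans (leq_addr _ _); rewrite leq_pmull.
  by rewrite /n; clear; lia.
have nN i : (0 < i)%N -> (N <= n i + b.+1)%N.
  move=> i0; have : (N <= i * N)%N by rewrite leq_pmull.
  by rewrite /n; clear; lia.
have an i : (0 < i)%N -> `|alpha (n i)| <= e1 / norm1 W.
  by move=> i0; rewrite ler_pdivlMr // mulrC; exact: Wa (nN _ i0).
have an1 i : (0 < i)%N -> `|alpha (n i)| <= 1.
  move=> i0; apply: le_trans (an i i0) _.
  by rewrite ler_pdivrMr // mul1r (le_trans e11).
have nR i : (0 < i)%N -> (n i).+1%:R = (i * N)%:R + a%:R - b%:R :> R.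
  move=> i0; rewrite nE // natrB ?natrD //.
  apply: ltnW; apply: leq_trans bN _; apply: leq_trans (leq_addr _ _); by rewrite leq_pmull.
have /choice[H HH] : forall i : 'I_(size W), exists H, S H /\ ((0 < i)%N ->
    (lpnorm p (fun x => A (gaussian j) (x - (n i).+1%:R) - H x)%R <= (D * `|alpha (n i)|)%:E)%E).
  move=> i; have [i0|i0] := posnP i.
    by exists (fun=> 0); split => //; exact: (closed_subspace0 cS (S_gen 0)).
  by have [H SH HH] := HD _ (an1 _ i0); exists H.
(* The constant term of W, equal to 1, carries the translate to be approximated; the other terms are
   moved to the right side. *)
pose d (i : nat) := if i == 0%N then 0 else W`_i.
exists (fun x => \sum_(i < size W) (- d i) * H i x).
  apply: (closed_subspace_sum0 cS); first exact: (closed_subspace0 cS (S_gen 0)).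
  by move=> i; apply: (closed_subspaceZ cS); exact: (HH i).1.
have sW : (0 < size W)%N.
  rewrite lt0n size_poly_eq0; apply/eqP => W00; move: W0; rewrite W00 coef0.
  by apply/eqP; rewrite eq_sym oner_neq0.
have -> : (fun x => A (gaussian j) (x + b%:R - a%:R) - \sum_(i < size W) - d i * H i x)%R =
  (fun x => act (W \Po 'X^N) (A (gaussian j)) (x - (a%:R - b%:R)) +
    \sum_(i < size W) d i * (- (A (gaussian j) (x - (n i).+1%:R) - H i x))).
  apply/funext => x; rewrite act_comp.
  pose F (i : nat) := A (gaussian j) (x - (n i).+1%:R).
  have EH : \sum_(i < size W) - d i * H i x = - \sum_(i < size W) d i * H i x.
    by rewrite -sumrN; apply: eq_bigr => i _; rewrite mulNr.
  have ES : \sum_(i < size W) d i * (- (A (gaussian j) (x - (n i).+1%:R) - H i x)) =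
      \sum_(i < size W) d i * H i x - \sum_(i < size W) d i * F i.
    by rewrite -sumrB; apply: eq_bigr => i _; rewrite opprB mulrBr.
  have EA : \sum_(i < size W) W`_i * A (gaussian j) (x - (a%:R - b%:R) - (i * N)%:R) =
      A (gaussian j) (x + b%:R - a%:R) + \sum_(i < size W) d i * F i.
    case: (size W) sW => // m _; rewrite !big_ord_recl /= W0 mul1r /d /= mul0r add0r mul0n subr0.
    congr (_ + _); first by congr A; ring.
    by apply: eq_bigr => i _; rewrite /= /bump /= /F nR //; congr (_ * A _ _); ring.
  by rewrite EH ES EA; ring.
have mH i : measurable_fun [set: R] (H i).
  by apply: (closed_subspace_measurable cS); exact: (HH i).1.
have mD i : measurable_fun [set: R] (fun x => A (gaussian j) (x - (n (val i)).+1%:R) - H i x).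
  exact: measurable_funB.
have mN i : measurable_fun [set: R] (fun x => - (A (gaussian j) (x - (n (val i)).+1%:R) - H i x)).
  by apply: measurableT_comp => //; exact: mD.
have p1' := ltW p1.
apply: le_trans (lpnormD p1' _ _) _.
- by apply: measurable_shift; exact: measurable_act.
- by apply: measurable_sum => i; apply: measurable_funM => //; exact: mN.
apply: le_trans (_ : (e1 + D * e1)%:E <= _)%E; last first.
  by rewrite lee_fin (_ : e1 + D * e1 = (D + 1) * e1) //; ring.
rewrite EFinD leeD //; first by rewrite lpnorm_shift //; exact: measurable_act.
apply: le_trans (lpnorm_sum (F := fun i x =>
  d i * (- (A (gaussian j) (x - (n (val i)).+1%:R) - H i x))) p1' _) _.
  by move=> i; apply: measurable_funM => //; exact: mN.
have -> : D * e1 = \sum_(i < size W) `|W`_i| * (D * (e1 / norm1 W)).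
  by rewrite -mulr_suml -/(norm1 W); field; rewrite gt_eqF.
rewrite -sumEFin; apply: lee_sum => i _.
rewrite lpnormZ // lpnormN // /d; case: eqVneq => [_|i0].
  rewrite normr0 mul0e lee_fin; apply: mulr_ge0 => //; apply: mulr_ge0 => //.
  by rewrite divr_ge0 // ltW.
have ip : (0 < i)%N by rewrite lt0n.
rewrite EFinM lee_wpmul2l ?lee_fin //; apply: le_trans ((HH i).2 ip) _.
by rewrite lee_fin ler_wpM2l // an.
Qed.

Lemma mem_gaussian j : S (gaussian j).
Proof.
apply: (closed_subspace_closure cS); first exact: measurable_gaussian.
move=> e e0; have [c [sh [i H]]] := generator_recover genA p1 (@dominated_gaussian R j) e0.
exists (fun x => act c (A (gaussian j)) (x + i%:R - sh%:R)) => //.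
apply: (closed_subspace_sum0 cS); first exact: (closed_subspace0 cS (S_gen 0)).
move=> l; apply: (closed_subspaceZ cS); have := mem_translates j (sh + l) i.
by under eq_fun do rewrite natrD opprD addrA.
Qed.

End Translates.

(** * From x^j exp(-x^2) to weighted indicators *)

Section Density.
Variable R : realType.
Variable p : R.
Hypothesis p1 : 1 <= p.
Variable S : set (R -> R).
Hypothesis cS : closed_subspace p S.
Hypothesis S_gaussian : forall j, S (@gaussian R j).
Local Notation envelope := (@envelope R).

Let p0 : 0 < p. Proof. exact: lt_le_trans p1. Qed.

Lemma lpnorm_dominated_lty (h : R -> R) : dominated h -> (lpnorm p h < +oo)%E.
Proof.
move=> dh; have [C C0 hC] := dominated_pos dh; have mE := @measurable_envelope R.
apply: (@le_lt_trans _ _ (lpnorm p (fun x => C * envelope x))).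
  by apply: le_lpnorm => //; [exact: ltW | exact: dh.1 | exact: measurable_funM].
by rewrite lpnormZ // lte_mul_pinfty ?lee_fin ?lpnorm_envelope.
Qed.

(** Dominated convergence of the exponential series, whose partial sums times F stay below exp |u|
    |F|. *)
Lemma mem_expR_mul (u F : R -> R) : measurable_fun [set: R] u ->
  (forall l, S (fun x => u x ^+ l * F x)) ->
  (lpnorm p (fun x => expR `|u x| * `|F x|)%R < +oo)%E ->
  S (fun x => expR (u x) * F x).
Proof.
move=> mu uF fin.
have mF : measurable_fun [set: R] F.
  have := closed_subspace_measurable cS (uF 0%N).
  by under eq_fun do rewrite expr0 mul1r.
have me : measurable_fun [set: R] (fun x => expR (u x)) by exact: measurableT_comp.
apply: (closed_subspace_dominated p1 cS
  (F := fun n x => \sum_(l < n) u x ^+ l / l`!%:R * F x)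
  (H := fun x => expR `|u x| * `|F x|)) => //.
- move=> n; apply: (closed_subspace_sum0 cS); first exact: (closed_subspace0 cS (uF 0%N)).
  move=> l; have := closed_subspaceZ cS (l`!%:R^-1) (uF l).
  by under eq_fun do rewrite mulrA [_^-1 * _]mulrC.
- exact: measurable_funM.
- apply: measurable_funM; last exact: measurableT_comp.
  by apply: measurableT_comp => //; exact: measurableT_comp.
- move=> x; under eq_fun do rewrite -mulr_suml.
  apply: cvgMl; have -> : (fun n => \sum_(l < n) u x ^+ l / l`!%:R) = series (exp_coeff (u x)).
    by apply/funext => n; rewrite /series /= big_mkord.
  exact: is_cvg_series_exp_coeff.
- move=> n x; rewrite -mulr_suml normrM ler_wpM2r //.
  apply: le_trans (ler_norm_sum _ _ _) _.
  apply: le_trans (series_exp_le n (normr_ge0 _)).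
  by apply: ler_sum => l _; rewrite normrM normrX normfV normr_nat.
Qed.

Lemma measurable_quadratic_exp j (t c : R) :
  measurable_fun [set: R] (fun x : R => x ^+ j * expR (t * x - c * x ^+ 2)).
Proof.
apply: measurable_funM; first exact: measurable_funX.
apply: measurableT_comp => //; apply: measurable_funB; apply: measurable_funM => //.
Qed.

(** Each step multiplies by exp(- s x^2) through its series. For s <= 1/2 the majorant exp(s x^2)
    exp(- (1 + s n) x^2) is at most exp(- x^2 / 2); larger exponents need several steps. *)
Lemma mem_gaussian_scaled (s : R) n j : 0 <= s <= 2^-1 ->
  S (fun x => x ^+ j * expR (- ((1 + s * n%:R) * x ^+ 2))).
Proof.
move=> /andP[s0 s1]; elim: n j => [|n IH] j.
  have := S_gaussian j; rewrite /gaussian.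
  by under [X in S X -> _]funext do rewrite -[X in expR (- X)]mul1r; rewrite mulr0 addr0.
have -> : (fun x => x ^+ j * expR (- ((1 + s * n.+1%:R) * x ^+ 2))) =
  (fun x => expR (- (s * x ^+ 2)) * (x ^+ j * expR (- ((1 + s * n%:R) * x ^+ 2)))).
  by apply/funext => x; rewrite [RHS]mulrCA -expRD; congr (_ * expR _); rewrite -natr1; ring.
apply: mem_expR_mul.
- by apply: measurableT_comp => //; apply: measurable_funM => //; exact: measurable_funX.
- move=> l; have := closed_subspaceZ cS ((- s) ^+ l) (IH (2 * l + j)%N).
  congr S; apply/funext => x.
  by rewrite -[- (s * x ^+ 2)]mulNr [(- s * _) ^+ l]exprMn exprD exprM; ring.
apply: lpnorm_dominated_lty; have [C HC] := @gaussian_envelope R j 0 2^-1 ltac:(by rewrite invr_gt0).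
apply: (@dominated_le _ _ C).
  apply: measurable_funM.
    apply: measurableT_comp => //; apply: measurableT_comp => //.
    by apply: measurableT_comp => //; apply: measurable_funM => //; exact: measurable_funX.
  apply: measurableT_comp => //; have := measurable_quadratic_exp j 0 (1 + s * n%:R).
  by under eq_fun do rewrite mul0r sub0r.
move=> x; apply: le_trans (HC x).
have sx : 0 <= s * x ^+ 2 by rewrite mulr_ge0 ?sqr_ge0.
rewrite ger0_norm; last by rewrite mulr_ge0 ?expR_ge0.
rewrite normrN (ger0_norm sx) normrM normrX (ger0_norm (expR_ge0 _)) mulrCA -expRD.
rewrite ler_wpM2l ?exprn_ge0 // ler_expR mul0r sub0r.
have h : 0 <= s * n%:R by rewrite mulr_ge0.
have := sqr_ge0 x; set y := x ^+ 2; nra.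
Qed.

Lemma mem_gaussian_ge1 (c : R) j : 1 <= c -> S (fun x => x ^+ j * expR (- (c * x ^+ 2))).
Proof.
move=> c1; pose n := (Num.truncn (2 * (c - 1))).+1.
have n0 : 0 < n%:R :> R by rewrite ltr0n.
have hn : 2 * (c - 1) < n%:R by rewrite /n truncnS_gt.
have := @mem_gaussian_scaled ((c - 1) / n%:R) n j; rewrite divfK ?gt_eqF //.
rewrite [1 + _]addrC subrK; apply; apply/andP; split.
  by rewrite divr_ge0 ?subr_ge0.
by rewrite ler_pdivrMr // ; move: hn; lra.
Qed.

Lemma mem_shifted_gaussian (t c : R) : 1 <= c -> S (fun x => expR (t * x - c * x ^+ 2)).
Proof.
move=> c1; have c0 : 0 < c by apply: lt_le_trans c1.
under eq_fun do rewrite expRD.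
apply: mem_expR_mul; first exact: measurable_funM.
  move=> l; have := closed_subspaceZ cS (t ^+ l) (mem_gaussian_ge1 l c1).
  by under eq_fun do rewrite mulrA -exprMn.
apply: lpnorm_dominated_lty; have [C HC] := @gaussian_envelope R 0 `|t| c c0.
apply: (@dominated_le _ _ C).
  apply: measurable_funM.
    by apply: measurableT_comp => //; apply: measurableT_comp => //; exact: measurable_funM.
  apply: measurableT_comp => //; have := measurable_quadratic_exp 0 0 c.
  by under eq_fun do rewrite mul0r sub0r expr0 mul1r.
move=> x; apply: le_trans (HC x).
rewrite ger0_norm; last by rewrite mulr_ge0 ?expR_ge0.
by rewrite (ger0_norm (expR_ge0 _)) expr0 mul1r -expRD ler_expR normrM.
Qed.

Definition weighted (E : set R) (x : R) := \1_E x * expR (- x ^+ 2).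

(* [expR (spike b r n)] tends to the indicator of [|x - b| > r]. *)
Let spike (b r : R) n (x : R) := - n%:R * expR (n%:R * (r ^+ 2 - (x - b) ^+ 2)).

(** For fixed n the spike is bounded, and its powers times exp(-x^2) are multiples of exp(t x - c
    x^2) with c >= 1. *)
Lemma mem_expR_spike b r n : S (fun x => expR (spike b r n x) * expR (- x ^+ 2)).
Proof.
have me : measurable_fun [set: R] (fun x : R => expR (- x ^+ 2)).
  have := @measurable_gaussian R 0; rewrite /gaussian.
  by under eq_fun do rewrite expr0 mul1r.
have ms : measurable_fun [set: R] (spike b r n).
  apply: measurable_funM => //; apply: measurableT_comp => //; apply: measurable_funM => //.
  by apply: measurable_funB => //; apply: measurable_funX; exact: measurable_funB.
apply: mem_expR_mul => //.
  move=> l; set k : R := n%:R * l%:R; have k0 : 0 <= k by rewrite mulr_ge0.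
  have c1 : 1 <= 1 + k by rewrite lerDl.
  have := closed_subspaceZ cS ((- n%:R) ^+ l * expR (k * (r ^+ 2 - b ^+ 2)))
    (mem_shifted_gaussian (2 * k * b) c1).
  congr S; apply/funext => x.
  rewrite /spike exprMn -expRM_natr -!mulrA -!expRD; congr (_ * expR _).
  by rewrite /k; ring.
pose M : R := n%:R * expR (n%:R * r ^+ 2).
apply: lpnorm_dominated_lty; have [C C0 HC] := dominated_pos (@dominated_gaussian R 0).
apply: (@dominated_le _ _ (expR M * C)).
  apply: measurable_funM; last exact: measurableT_comp.
  by apply: measurableT_comp => //; exact: measurableT_comp.
move=> x; rewrite normrM -mulrA normr_id; apply: ler_pM => //.
  rewrite ger0_norm ?expR_ge0 // ler_expR /spike normrM normrN normr_nat /M.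
  by rewrite ler_wpM2l // ger0_norm ?expR_ge0 // ler_expR ler_wpM2l // gerBl sqr_ge0.
by have := HC x; rewrite /gaussian expr0 mul1r.
Qed.

(** From z^2 <= 2 exp z at z = n s follows n exp(- n s) <= 2 / (s^2 n). *)
Lemma spike_cvg_out b r x : r ^+ 2 < (x - b) ^+ 2 -> spike b r n x @[n --> \oo] --> (0 : R).
Proof.
move=> rx; pose s := (x - b) ^+ 2 - r ^+ 2; have s0 : 0 < s by rewrite subr_gt0.
have c0 : 2 / s ^+ 2 * n.+1%:R^-1 @[n --> \oo] --> (0 : R).
  by rewrite -[X in _ --> X](mulr0 (2 / s ^+ 2)); apply: cvgMr; exact: cvg_harmonic.
rewrite -(cvg_shiftS (fun n => spike b r n x)).
apply: norm_cvg0; apply: (@squeeze_cvgr _ _ _ _ (fun=> 0) (fun n => 2 / s ^+ 2 * n.+1%:R^-1)).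
- near=> n; rewrite normr_ge0 /=.
  have n0 : 0 < n.+1%:R :> R by rewrite ltr0n.
  have := @exprn_le_expR R (n.+1%:R * s) 2 (ltW (mulr_gt0 n0 s0)).
  rewrite /spike normrM normrN normr_nat ger0_norm ?expR_ge0 //.
  have -> : n.+1%:R * (r ^+ 2 - (x - b) ^+ 2) = - (n.+1%:R * s) by rewrite /s; ring.
  rewrite expRN => H; rewrite ler_pdivrMr ?expR_gt0 //.
  have -> : 2 / s ^+ 2 / n.+1%:R * expR (n.+1%:R * s) =
      (2 * expR (n.+1%:R * s)) / (s ^+ 2 * n.+1%:R).
    by field; rewrite gt_eqF // gt_eqF.
  rewrite ler_pdivlMr ?mulr_gt0 ?exprn_gt0 //; apply: le_trans H.
  by rewrite exprMn le_eqVlt; apply/orP; left; apply/eqP; ring.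
- exact: cvg_cst.
- exact: c0.
Unshelve. all: by end_near.
Qed.

(** On the closed interval, endpoints included, the spike is at most - n. *)
Lemma expR_spike_cvg_in b r x : (x - b) ^+ 2 <= r ^+ 2 ->
  expR (spike b r n x) @[n --> \oo] --> (0 : R).
Proof.
move=> rx; rewrite -(cvg_shiftS (fun n => expR (spike b r n x))).
apply: (@squeeze_cvgr _ _ _ _ (fun=> 0) (fun n => n.+1%:R^-1)).
- near=> n; rewrite expR_ge0 /=.
  have n0 : 0 < n.+1%:R :> R by rewrite ltr0n.
  rewrite /spike mulNr expRN lef_pV2 ?posrE ?expR_gt0 //.
  apply: le_trans (expR_ge1Dx _); apply: le_trans (_ : n.+1%:R * 1 <= _); first by rewrite mulr1.
  apply: (@le_trans _ _ (n.+1%:R * expR (n.+1%:R * (r ^+ 2 - (x - b) ^+ 2)))).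
    rewrite ler_pM2l //; apply: le_trans (expR_ge1Dx _).
    by rewrite lerDl mulr_ge0 // subr_ge0.
  by rewrite lerDr.
- exact: cvg_cst.
- exact: cvg_harmonic.
Unshelve. all: by end_near.
Qed.

Lemma dominated_weight : dominated (fun x : R => expR (- x ^+ 2)).
Proof.
have := @dominated_gaussian R 0; rewrite /gaussian.
by under eq_fun do rewrite expr0 mul1r.
Qed.

Lemma measurable_weighted E : measurable E -> measurable_fun [set: R] (weighted E).
Proof.
by move=> mE; apply: measurable_funM; [exact: measurable_indic | exact: dominated_weight.1].
Qed.

Lemma weighted_le E x : `|weighted E x| <= expR (- x ^+ 2).
Proof.
rewrite normrM [X in _ * X]ger0_norm ?expR_ge0 // ler_piMl ?expR_ge0 //.
by rewrite indicE; case: (_ \in _); rewrite ?normr1 ?normr0.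
Qed.

Lemma mem_weighted_itv b r : S (weighted `[b - r, b + r]).
Proof.
have [r0|r0] := leP 0 r; last first.
  rewrite set_itv_ge; last by rewrite bnd_simp -ltNge; lra.
  have -> : weighted set0 = (fun=> 0).
    by apply/funext => x; rewrite /weighted indic0 mul0r.
  exact: (closed_subspace0 cS (S_gaussian 0)).
have mE : measurable (`[b - r, b + r]%classic : set R) by exact: measurable_itv.
have S1 : S (fun x : R => expR (- x ^+ 2)).
  by have := S_gaussian 0; rewrite /gaussian; under eq_fun do rewrite expr0 mul1r.
suff H : S (fun x => (1 - \1_(`[b - r, b + r]%classic) x) * expR (- x ^+ 2)).
  have := closed_subspaceB cS S1 H; congr S; apply/funext => x.
  by rewrite /weighted; ring.
apply: (closed_subspace_dominated p1 cS (F := fun n x => expR (spike b r n x) * expR (- x ^+ 2))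
   (H := fun x => expR (- x ^+ 2))).
- by move=> n; exact: mem_expR_spike.
- apply: measurable_funM; last exact: dominated_weight.1.
  by apply: measurable_funB => //; exact: measurable_indic.
- exact: dominated_weight.1.
- move=> x; apply: cvgMl; have [xr|xr] := leP ((x - b) ^+ 2) (r ^+ 2).
    have -> : \1_(`[b - r, b + r]%classic) x = 1 :> R.
      rewrite indicE mem_set //= in_itv /=.
      have := ler_sqrt ((x - b) ^+ 2) (sqr_ge0 r).
      by rewrite xr !sqrtr_sqr (ger0_norm r0) ler_norml; lra.
    by rewrite subrr; exact: expR_spike_cvg_in.
  have -> : \1_(`[b - r, b + r]%classic) x = 0 :> R.
    rewrite indicE memNset //= in_itv /= => /andP[h1 h2].
    have : (x - b) ^+ 2 <= r ^+ 2 by nra.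
    by rewrite leNgt xr.
  rewrite subr0 -expR0; apply: cvg_comp; first exact: spike_cvg_out xr.
  exact: continuous_expR.
- move=> n x; rewrite ger0_norm ?mulr_ge0 ?expR_ge0 // ler_piMl ?expR_ge0 //.
  rewrite -expR0 ler_expR /spike mulNr oppr_le0 mulr_ge0 ?expR_ge0 //.
- exact: lpnorm_dominated_lty dominated_weight.
Qed.

Lemma mem_weighted_bigcup (E : nat -> set R) : (forall n, measurable (E n)) ->
  {homo E : n m / (n <= m)%N >-> n `<=` m} -> (forall n, S (weighted (E n))) ->
  S (weighted (\bigcup_n E n)).
Proof.
move=> mE hE SE; apply: (closed_subspace_dominated p1 cS (F := fun n => weighted (E n))
   (H := fun x => expR (- x ^+ 2))) => //.
- by apply: measurable_weighted; exact: bigcupT_measurable.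
- exact: dominated_weight.1.
- move=> x; apply: cvgMl; have [[m _ Em]|nE] := pselect ((\bigcup_n E n) x).
    rewrite indicE mem_set; last by exists m.
    apply: cvg_near_cst; exists m => // n /= mn.
    by rewrite indicE mem_set //; exact: hE mn _ Em.
  rewrite indicE memNset //; apply: cvg_near_cst; apply: nearW => n.
  by rewrite indicE memNset // => En; apply: nE; exists n.
- by move=> n x; exact: weighted_le.
- exact: lpnorm_dominated_lty dominated_weight.
Qed.

(** Dynkin's argument: the half-lines [x, +oo[ are stable under intersection and generate the Borel
    sets, and the sets with this property form a lambda-system. *)
Lemma mem_weighted (E : set R) : measurable E -> S (weighted E).
Proof.
move=> mE; pose G := @RGenCInfty.G R.
suff : <<s G>> `<=` [set E : set R | measurable E /\ S (weighted E)].
  have GE : G.-sigma.-measurable E by rewrite -RGenCInfty.measurableE; exact: mE.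
  by move=> /(_ E GE)[].
apply: lambda_system_subset => //.
- move=> _ _ [x ->] [y ->]; exists (Num.max x y).
  apply/seteqP; split => z /=; rewrite !in_itv /= !andbT ge_max; first by case=> -> ->.
  by case/andP.
- split => //.
  + split => //; have := S_gaussian 0; congr S; apply/funext => x.
    by rewrite /gaussian /weighted expr0 indicT.
  + move=> A B BA [mA SA] [mB SB]; split; first exact: measurableD.
    have := closed_subspaceB cS SA SB; congr S; apply/funext => x.
    rewrite /weighted -mulrBl; congr (_ * _); rewrite !indicE.
    have [xB|xB] := pselect (B x).
      by rewrite (mem_set (BA _ xB)) (mem_set xB) memNset ?subrr // => -[].
    rewrite (memNset xB) subr0; have [xA|xA] := pselect (A x).
      by rewrite !mem_set.
    by rewrite !memNset // => -[].
  + move=> F ndF HF; split; first by apply: bigcupT_measurable => n; exact: (HF n).1.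
    apply: mem_weighted_bigcup => [n|n m nm|n]; [exact: (HF n).1 | | exact: (HF n).2].
    by apply/subsetPset; exact: ndF.
- move=> _ [x ->]; split; first exact: measurable_itv.
  (* An increasing union of the intervals [x, x + n], written by centre and radius. *)
  have -> : `[x, +oo[%classic =
      \bigcup_n `[x + n%:R / 2 - n%:R / 2, x + n%:R / 2 + n%:R / 2]%classic.
    apply/seteqP; split => z /=.
      rewrite in_itv /= andbT => xz; exists (Num.truncn (z - x)).+1 => //=.
      rewrite in_itv /= addrK xz /= -addrA -splitr -lerBlDl ltW //; exact: truncnS_gt.
    by case=> n _ /=; rewrite !in_itv /= addrK andbT => /andP[].
  apply: mem_weighted_bigcup => [n|n m nm|n]; [exact: measurable_itv | | exact: mem_weighted_itv].
  move=> z /=; rewrite !in_itv /= !addrK -!addrA -!splitr => /andP[-> /= h].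
  by apply: le_trans h _; rewrite lerD2l ler_nat.
Qed.

End Density.

Import HBSimple HBNNSimple.

(** * From weighted indicators to all of real L^p *)

Section LpDensity.
Variable R : realType.
Variable p : R.
Hypothesis p1 : 1 <= p.
Variable S : set (R -> R).
Hypothesis cS : closed_subspace p S.
Hypothesis S_gaussian : forall j, S (@gaussian R j).

(** The simple functions increase to F exp(x^2), not to F: multiplied by exp(-x^2) they are
    combinations of weighted indicators and stay below F. *)
Lemma mem_lpnorm_ge0 (F : R -> R) : measurable_fun [set: R] F -> (forall x, 0 <= F x) ->
  (lpnorm p F < +oo)%E -> S F.
Proof.
move=> mF F0 fin; pose h (x : R) : \bar R := (F x * expR (x ^+ 2))%:E.
have mh : measurable_fun [set: R] h.
  apply/measurable_EFinP; apply: measurable_funM => //.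
  by apply: measurableT_comp => //; exact: measurable_funX.
have h0 x : [set: R] x -> (0 <= h x)%E by move=> _; rewrite lee_fin mulr_ge0 ?expR_ge0.
pose g := nnsfun_approx measurableT mh.
have gh (x : R) : g n x @[n --> \oo] --> F x * expR (x ^+ 2).
  exact: fine_cvg (cvg_nnsfun_approx measurableT mh h0 (I : [set: R] x)).
have gn (x : R) : nondecreasing_seq (fun n => g n x).
  by move=> n m nm; have /lefP := nd_nnsfun_approx measurableT mh nm; exact.
apply: (closed_subspace_dominated p1 cS (F := fun n x => g n x * expR (- x ^+ 2)) (H := F)) => //.
- move=> n.
  have [N [s Es]] : exists N (s : nat -> R), forall x : R,
      g n x = \sum_(i < N) s i * \1_(g n @^-1` [set s i]) x.
    by eexists; exists (nth 0 (finmap.enum_fset (fset_set (range (g n))))) => x; exact: (fimfunEord (g n)).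
  have -> : (fun x => g n x * expR (- x ^+ 2)) =
      (fun x => \sum_(i < N) s i * weighted (g n @^-1` [set s i]) x).
    apply/funext => x; rewrite Es mulr_suml.
    by apply: eq_bigr => i _; rewrite /weighted mulrA.
  apply: (closed_subspace_sum0 cS); first exact: (closed_subspace0 cS (S_gaussian 0)).
  move=> i; apply: (closed_subspaceZ cS); apply: (mem_weighted p1 cS S_gaussian).
  exact: measurable_funPTI.
- move=> x; have e0 : expR (x ^+ 2) != 0 by rewrite gt_eqF ?expR_gt0.
  by rewrite -[X in _ --> X](mulfK e0) expRN; exact: cvgMl.
- move=> n x; rewrite ger0_norm ?mulr_ge0 ?expR_ge0 // expRN ler_pdivrMr ?expR_gt0 //.
  by have := nondecreasing_cvgn_le (gn x) (cvgP _ (gh x)) n; rewrite (cvg_lim _ (gh x)).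
Qed.

Lemma mem_lpnorm (F : R -> R) : measurable_fun [set: R] F -> (lpnorm p F < +oo)%E -> S F.
Proof.
move=> mF fin; have p0 : 0 <= p by apply: le_trans p1.
pose Fp (x : R) : R := (`|F x| + F x) / 2; pose Fm (x : R) : R := (`|F x| - F x) / 2.
have mN : measurable_fun [set: R] (fun x => `|F x|) by exact: measurableT_comp.
have mp : measurable_fun [set: R] Fp by apply: measurable_funM => //; exact: measurable_funD.
have mm : measurable_fun [set: R] Fm by apply: measurable_funM => //; exact: measurable_funB.
have fN : (lpnorm p (fun x => `|F x|)%R < +oo)%E.
  by apply: le_lt_trans fin; rewrite !lpnormE; under eq_integral do rewrite normr_id.
have F0 x : 0 <= Fp x /\ 0 <= Fm x /\ Fp x <= `|F x| /\ Fm x <= `|F x|.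
  have := ler_norm (F x); have := ler_norm (- F x); rewrite normrN /Fp /Fm.
  by move=> *; split; [lra | split; [lra | split; lra]].
have -> : F = (fun x => Fp x - Fm x) by apply/funext => x; rewrite /Fp /Fm; field.
apply: (closed_subspaceB cS); apply: mem_lpnorm_ge0 => //.
- by move=> x; have [] := F0 x.
- apply: le_lt_trans fN; apply: le_lpnorm => // x; have [? [_ [? _]]] := F0 x.
  by rewrite ger0_norm.
- by move=> x; have [_ []] := F0 x.
- apply: le_lt_trans fN; apply: le_lpnorm => // x; have [_ [? [_ ?]]] := F0 x.
  by rewrite ger0_norm.
Qed.

End LpDensity.

(** * Reduction of complex L^p to real functions *)

Section ComplexLp.
Local Open Scope complex_scope.
Variable R : realType.
Implicit Types (p : R) (h : R -> R) (f : R -> R[i]) (z : R[i]).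

Lemma Lp_normE p f : Lp_norm p f = lpnorm p (fun x => modulus (f x)).
Proof. by []. Qed.

Lemma modulus_sqrt z : modulus z = Num.sqrt (complex.Re z ^+ 2 + complex.Im z ^+ 2).
Proof. by case: z => a b; rewrite /modulus normc_def. Qed.

Lemma Im_le_modulus z : `|complex.Im z| <= modulus z.
Proof. by rewrite modulus_sqrt -sqrtr_sqr ler_wsqrtr // lerDr sqr_ge0. Qed.

Lemma modulus_le_Re_Im z : modulus z <= `|complex.Re z| + `|complex.Im z|.
Proof.
rewrite modulus_sqrt -[leRHS]ger0_norm ?addr_ge0 // -sqrtr_sqr ler_wsqrtr //.
rewrite sqrrD !real_normK ?num_real // -addrA [X in _ <= _ + X]addrC lerD2l lerDl.
by rewrite mulrn_wge0 ?mulr_ge0.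
Qed.

Lemma measurable_modulus f : measurable_fun [set: R] (fun x => complex.Re (f x)) ->
  measurable_fun [set: R] (fun x => complex.Im (f x)) ->
  measurable_fun [set: R] (fun x => modulus (f x)).
Proof.
move=> mr mi; under eq_fun do rewrite modulus_sqrt.
apply: measurableT_comp; first by apply: continuous_measurable_fun; exact: sqrt_continuous.
by apply: measurable_funD; apply: measurable_funX.
Qed.

Lemma in_Lp_real p h : measurable_fun [set: R] h -> (lpnorm p h < +oo)%E ->
  in_Lp p (fun x => (h x)%:C).
Proof.
move=> mh fin; split => //; rewrite Lp_normE; apply: le_lt_trans fin.
by rewrite !lpnormE; under eq_integral do rewrite modulusR normr_id.
Qed.

Lemma lin_comb_real (u : nat -> R -> R) N (c d : nat -> R) x :
  lin_comb (fun n y => (u n y)%:C) N (fun n => c n +i* d n) x = comb u N c x +i* comb u N d x.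
Proof.
rewrite /lin_comb /comb; elim: N => [|N IH]; first by rewrite !big_ord0.
rewrite !big_ord_recr /= IH; apply/eqP; rewrite eq_complex /=.
by rewrite !mulr0 subr0 add0r !eqxx.
Qed.

Lemma complete_real p (u : nat -> R -> R) : 1 <= p ->
  (forall n, measurable_fun [set: R] (u n)) -> (forall n, (lpnorm p (u n) < +oo)%E) ->
  (forall h, measurable_fun [set: R] h -> (lpnorm p h < +oo)%E -> closed_span p u h) ->
  complete_in_Lp p (fun n x => (u n x)%:C).
Proof.
move=> p1 mu fu H; split => [n|f [mr mi fin] e e0]; first exact: in_Lp_real.
have p0 : 0 <= p by apply: le_trans p1.
have mf := measurable_modulus mr mi.
(* Real and imaginary parts contribute e / 3 each, which leaves room for the strict inequality. *)
have e3 : 0 < e / 3 by rewrite divr_gt0.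
have [_ /(_ _ e3)[N [c Hc]]] : closed_span p u (fun x => complex.Re (f x)).
  apply: H => //; apply: le_lt_trans fin; apply: le_lpnorm => // x; exact: Re_le_modulus.
have [_ /(_ _ e3)[M [d Hd]]] : closed_span p u (fun x => complex.Im (f x)).
  apply: H => //; apply: le_lt_trans fin; apply: le_lpnorm => // x; exact: Im_le_modulus.
(* Pad both combinations with zeros to a common length, so that they combine into complex
   coefficients. *)
move: Hc Hd; rewrite (comb_wide u c (leq_maxl N M)) (comb_wide u d (leq_maxr N M)).
move: (maxn N M) (fun n => if (n < N)%N then c n else 0) (fun n => if (n < M)%N then d n else 0).
move=> {c d N M} N c d Hc Hd; exists N, (fun n => c n +i* d n).
have mc k : measurable_fun [set: R] (comb u N k) by exact: measurable_comb.
have m1 : measurable_fun [set: R] (fun x => complex.Re (f x) - comb u N c x).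
  exact: measurable_funB.
have m2 : measurable_fun [set: R] (fun x => complex.Im (f x) - comb u N d x).
  exact: measurable_funB.
have n1 : measurable_fun [set: R] (fun x => `|complex.Re (f x) - comb u N c x|).
  exact: measurableT_comp.
have n2 : measurable_fun [set: R] (fun x => `|complex.Im (f x) - comb u N d x|).
  exact: measurableT_comp.
have E : (fun x => f x - lin_comb (fun n y => (u n y)%:C) N (fun n => c n +i* d n) x)%R =
    (fun x => (complex.Re (f x) - comb u N c x) +i* (complex.Im (f x) - comb u N d x)).
  by apply/funext => x; rewrite lin_comb_real; case: (f x).
rewrite E Lp_normE; apply: (@le_lt_trans _ _ (lpnorm p (fun x =>
    `|complex.Re (f x) - comb u N c x| + `|complex.Im (f x) - comb u N d x|)%R)).
  apply: le_lpnorm => //; [exact: measurable_modulus | exact: measurable_funD |] => x.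
  by rewrite ger0_norm ?modulus_ge0 //; exact: modulus_le_Re_Im.
have nn h : lpnorm p (fun x => `|h x|)%R = lpnorm p h.
  by rewrite !lpnormE; under eq_integral do rewrite normr_id.
apply: le_lt_trans (lpnormD p1 n1 n2) _; rewrite !nn.
apply: (@le_lt_trans _ _ (e / 3 + e / 3)%:E); first by rewrite EFinD leeD.
by rewrite lte_fin; lra.
Qed.

End ComplexLp.

Local Open Scope complex_scope.
Unset Implicit Arguments.
Set Strict Implicit.

(* Index [n : nat] stands for the index n + 1 of a sequence starting at 1. *)
Theorem theorem2p2 (R : realType) (lambda alpha : nat -> R)
    (lambdaE : forall n : nat, lambda n = n.+1%:R + alpha n)
    (alpha_neq0 : forall n : nat, alpha n <> 0)
    (alpha_cvg0 : alpha n @[n --> \oo] --> (0 : R)) :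
  exists g : R -> R,
    [/\ forall x : R, 0 <= g x,
        forall p : R, 1 < p -> in_Lp p (fun x : R => (g x)%:C)
      & forall p : R, 1 < p ->
          complete_in_Lp p (fun (n : nat) (x : R) => (g (x - lambda n))%:C)].
Proof.
have [A genA] := exists_generator alpha_cvg0.
have dg := @dominated_gaussian R 0; have dE := @dominated_envelope R.
have mg := generator_measurable genA dg.
have fin p : 1 < p -> (lpnorm p (A (gaussian 0)) < +oo)%E.
  move=> p1; have p0 : 0 < p by apply: lt_trans p1.
  have [C C0 HC] := dominated_pos dg; have mE := generator_measurable genA dE.
  apply: (@le_lt_trans _ _ (lpnorm p (fun x => C * A (@envelope R) x))).
    apply: le_lpnorm => //; [exact: ltW | exact: measurable_funM |] => x.
    exact: generator_le genA _ _ _ dg.1 HC.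
  by rewrite lpnormZ // lte_mul_pinfty ?lee_fin // (generator_lpnorm genA).
exists (A (gaussian 0)); split.
- move=> x; apply: (generator_ge0 genA) => // y.
  by rewrite /gaussian expr0 mul1r expR_ge0.
- by move=> p p1; apply: in_Lp_real => //; exact: fin.
move=> p p1; have p1' := ltW p1; pose u n x := A (gaussian 0) (x - lambda n).
have mu n : measurable_fun [set: R] (u n) by exact: measurable_shift.
apply: (@complete_real R p u) => //.
  by move=> n; rewrite lpnorm_shift //; exact: fin.
have cS := closed_span_subspace p1' mu.
have an n : alpha n != 0 by apply/eqP.
move=> h; apply: (mem_lpnorm p1' cS); apply: (mem_gaussian an genA p1 cS) => n.
by rewrite -lambdaE; exact: closed_span_gen.
Qed.
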